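(* Let $q,a,b,c,d,e,f,g$ be complex numbers with $0<|q|<1$, with $a,b,c,d,e,f,g$ nonzero and such that no zero factors occur in denominators. If $\max\left\{\left|\frac{q^2a^3}{bcdefg}\right|,\left|\frac{qa}{bc}\right|\right\}<1$, then $$ {}_8\psi_8\left[\begin{matrix} q\sqrt a,-q\sqrt a,b,c,d,e,f,g\\ \sqrt a,-\sqrt a,\frac{qa}{b},\frac{qa}{c},\frac{qa}{d},\frac{qa}{e},\frac{qa}{f},\frac{qa}{g}\end{matrix};q,\frac{q^2a^3}{bcdefg}\right]=T(f,g)+T(g,f), $$ where $$ T(f,g)=\frac{\left(q,\,qa,\,\frac qa,\,\frac{qa}{bc},\,\frac{qa}{bf},\,\frac{qa}{cf},\,\frac{qa}{df},\,\frac{qa}{ef},\,\frac{qf}{d},\,\frac{qf}{e},\,g,\,\frac ga,\,\frac{q^2a^2}{bdeg},\,\frac{q^2a^2}{cdeg};q\right)_\infty}{\left(\frac qb,\,\frac qc,\,\frac qd,\,\frac qe,\,\frac qf,\,\frac{qa}{b},\,\frac{qa}{c},\,\frac{qa}{d},\,\frac{qa}{e},\,\frac{qa}{f},\,\frac gf,\,\frac{fg}{a},\,\frac{q^2af}{deg},\,\frac{q^2a^3}{bcdefg};q\right)_\infty} $$ $$ \times\;{}_8\phi_7\left[\begin{matrix}\lambda,\,q\sqrt{\lambda},\,-q\sqrt{\lambda},\,\frac{qa}{de},\,\frac{qa}{dg},\,\frac{qa}{eg},\,\frac{bf}{a},\,\frac{cf}{a}\\ \sqrt{\lambda},\,-\sqrt{\lambda},\,\frac{qf}{g},\,\frac{qf}{e},\,\frac{qf}{d},\,\frac{q^2a^2}{bdeg},\,\frac{q^2a^2}{cdeg}\end{matrix};q,\frac{qa}{bc}\right],\qquad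 \lambda=\frac{qaf}{deg}, $$ and $T(g,f)$ is the same expression with $f$ and $g$ interchanged (including in $\lambda$).
   Context: For complex $x$ and integer $n$: $(x;q)_n=\prod_{i=0}^{n-1}(1-xq^i)$ if $n>0$, $(x;q)_0=1$, and $(x;q)_n=1/\prod_{j=n}^{-1}(1-xq^j)$ if $n<0$; $(x;q)_\infty=\prod_{k\ge0}(1-xq^k)$ for $|q|<1$. Also $(x_1,\dots,x_m;q)_n=(x_1;q)_n\cdots(x_m;q)_n$, for $n$ an integer or $\infty$. The basic hypergeometric series are $${}_{r+1}\phi_r\left[\begin{matrix}a_0,a_1,\dots,a_r\\ b_1,\dots,b_r\end{matrix};q,z\right]=\sum_{k=0}^\infty\frac{(a_0,a_1,\dots,a_r;q)_k}{(q,b_1,\dots,b_r;q)_k}z^k,$$ $${}_r\psi_r\left[\begin{matrix}a_1,\dots,a_r\\ b_1,\dots,b_r\end{matrix};q,z\right]=\sum_{k=-\infty}^\infty\frac{(a_1,\dots,a_r;q)_k}{(b_1,\dots,b_r;q)_k}z^k.$$ Square roots denote any fixed choice; the combination $(q\sqrt a,-q\sqrt a;q)_k/(\sqrt a,-\sqrt a;q)_k$ equals $(1-aq^{2k})/(1-a)$. *)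

(* Defs.v *)
From Stdlib Require Import Reals ZArith List.
From Coquelicot Require Import Coquelicot.
Import ListNotations.

Open Scope C_scope.

Definition Czpow (x : C) (n : Z) : C :=
  match n with
  | Z0 => 1
  | Zpos p => x ^ Pos.to_nat p
  | Zneg p => / x ^ Pos.to_nat p
  end.

Fixpoint Cprod (u : nat -> C) (n : nat) : C :=
  match n with
  | O => 1
  | S m => Cprod u m * u m
  end.

(* For n < 0 the index n + i, for i = 0, ..., -n-1, runs over n, ..., -1.
   As / 0 = 0 in C, a vanishing factor in (x;q)_n with n < 0 makes both (x;q)_n
   and its reciprocal 0; for the reciprocal this is the usual convention
   1 / (x;q)_n = (1 - x q^n) ... (1 - x q^(-1)). *)
Definition qpoch (x q : C) (n : Z) : C :=
  match n with
  | Z0 => 1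
  | Zpos p => Cprod (fun i => 1 - x * q ^ i) (Pos.to_nat p)
  | Zneg p => / Cprod (fun j => 1 - x * Czpow q (n + Z.of_nat j)) (Pos.to_nat p)
  end.

Definition qpoch_inf (x q : C) : C :=
  iota (T := C_CompleteNormedModule) (fun l : C =>
    filterlim (Cprod (fun k => 1 - x * q ^ k)) eventually (locally l)).

Definition qpochs (xs : list C) (q : C) (n : Z) : C :=
  fold_right (fun x r => qpoch x q n * r) 1 xs.

Definition qpochs_inf (xs : list C) (q : C) : C :=
  fold_right (fun x r => qpoch_inf x q * r) 1 xs.

(* Meant for lists with length num = S (length den): the entry q of the
   denominator of the series is not listed in den. *)
Definition phi_term (num den : list C) (q z : C) (k : nat) : C :=
  qpochs num q (Z.of_nat k) / qpochs (q :: den) q (Z.of_nat k) * z ^ k.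

Definition phi (num den : list C) (q z : C) : C :=
  iota (T := C_CompleteNormedModule)
    (fun l : C => is_series (phi_term num den q z) l).

Definition psi_term (num den : list C) (q z : C) (k : Z) : C :=
  qpochs num q k / qpochs den q k * Czpow z k.

(* Convergence of both halves, which is stronger than convergence of the
   symmetric partial sums. *)
Definition is_bilateral_series (u : Z -> C) (l : C) : Prop :=
  exists l1 l2 : C,
    is_series (fun n : nat => u (Z.of_nat n)) l1 /\
    is_series (fun n : nat => u (- Z.of_nat (S n))%Z) l2 /\
    l = l1 + l2.

Definition is_psi (num den : list C) (q z l : C) : Prop :=
  is_bilateral_series (psi_term num den q z) l.

Definition nonzero_factors (q x : C) : Prop :=
  forall i : nat, 1 - x * q ^ i <> 0.

Definition nonzero_factors_neg (q x : C) : Prop :=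
  forall j : Z, (j < 0)%Z -> 1 - x * Czpow q j <> 0.

(* Numerator parameters are constrained too: (x;q)_k with k < 0 is itself a
   reciprocal. *)
Definition psi_well_defined (num den : list C) (q : C) : Prop :=
  List.Forall (nonzero_factors q) den /\ List.Forall (nonzero_factors_neg q) num.

Definition phi_well_defined (den : list C) (q : C) : Prop :=
  List.Forall (nonzero_factors q) (q :: den).

(* sa and sl stand for the chosen square roots of a and of lambda. *)
Definition psi_num (q b c d e f g sa : C) : list C :=
  [q * sa; - (q * sa); b; c; d; e; f; g].

Definition psi_den (q a b c d e f g sa : C) : list C :=
  [sa; - sa; q * a / b; q * a / c; q * a / d; q * a / e; q * a / f; q * a / g].

Definition psi_arg (q a b c d e f g : C) : C :=
  q ^ 2 * a ^ 3 / (b * c * d * e * f * g).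

Definition lambda (q a d e f g : C) : C := q * a * f / (d * e * g).

Definition T_num (q a b c d e f g : C) : list C :=
  [q; q * a; q / a; q * a / (b * c); q * a / (b * f); q * a / (c * f);
   q * a / (d * f); q * a / (e * f); q * f / d; q * f / e; g; g / a;
   q ^ 2 * a ^ 2 / (b * d * e * g); q ^ 2 * a ^ 2 / (c * d * e * g)].

Definition T_den (q a b c d e f g : C) : list C :=
  [q / b; q / c; q / d; q / e; q / f;
   q * a / b; q * a / c; q * a / d; q * a / e; q * a / f;
   g / f; f * g / a; q ^ 2 * a * f / (d * e * g);
   q ^ 2 * a ^ 3 / (b * c * d * e * f * g)].

Definition phi_num (q a b c d e f g sl : C) : list C :=
  [lambda q a d e f g; q * sl; - (q * sl); q * a / (d * e); q * a / (d * g);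
   q * a / (e * g); b * f / a; c * f / a].

Definition phi_den (q a b c d e f g sl : C) : list C :=
  [sl; - sl; q * f / g; q * f / e; q * f / d;
   q ^ 2 * a ^ 2 / (b * d * e * g); q ^ 2 * a ^ 2 / (c * d * e * g)].

Definition phi_arg (q a b c : C) : C := q * a / (b * c).

Definition T (q a b c d e f g sl : C) : C :=
  qpochs_inf (T_num q a b c d e f g) q / qpochs_inf (T_den q a b c d e f g) q *
  phi (phi_num q a b c d e f g sl) (phi_den q a b c d e f g sl)
    q (phi_arg q a b c).

(* Main.v *)
Require Import Defs.
From Stdlib Require Import Reals ZArith List Lia Lra Psatz Permutation Classical.
From Coquelicot Require Import Coquelicot.

(** Write [a = s^2] and regard the bilateral series as a function of [s], with the
    numerator parameters [b = s beta_b], ..., [g = s beta_g] moving along.  After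
    multiplication by the infinite products [(q s / beta, q / (s beta); q)_oo],
    one for each of the six parameters, the sum has, up to an elementary factor, the form
    [D(x) = sum_k q^(3 k^2) x^(6 k) P(x q^k)] at [x = s], where [P] is a
    convergent Laurent series with [P(1/x) = - P(x)].  Such a sum is a theta
    function of degree six that is odd under [x -> 1/x], and these functions form
    a space of dimension two ([wp_sum_span]).  Dimension two is visible on the
    Laurent coefficients: grouping the exponents modulo six expresses [D] by six
    explicit theta series, and the symmetry pairs them off.

    The products [theta(p x) theta(p / x) theta(x^2) / x] lie in the same space;
    this needs Jacobi's triple product ([jacobi]), and it is the case of the
    preceding paragraph in which four of the six parameters are absent.  The product
    for [p] vanishes at [x = p].  Taking [p = f / s] and [p = g / s] gives a basis in
    which the coordinates of [D] are, up to normalization, its values at [g / s] and at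
    [f / s] ([wsum_three_term]).  There the bilateral sum breaks off on one side, and
    is an 8-phi-7 with base [g^2 / a], respectively [f^2 / a].  This is the classical
    expansion of an 8-psi-8 into two 8-phi-7.

    Bailey's two-term transformation ([vwp_transform]) then replaces the base
    [f^2 / a] by [lambda = q a f / (d e g)] ([wsum_at_param]).  It comes from a
    double series that is summed in one order by Jackson's terminating sum
    ([jackson], proved by telescoping) and in the other by the 6-phi-5 sum
    ([six_phi_five], the limit of Jackson's sum).

    The intermediate series with base [f^2 / a] forces extra conditions on the
    parameters, such as [f^2 / a] not being a power of [q].  These are removed at
    the end: replacing [(f, g)] by [(f t, g t)] with real [t > 1] close to [1]
    leaves [lambda] unchanged and avoids the exceptional values, and both sides of
    the identity are continuous in [t] by Tannery's theorem
    ([qratio_sum_Clim]). *)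

Local Open Scope C_scope.

(** * Limits of complex-valued functions along a filter *)

Definition Clim {T : Type} (F : (T -> Prop) -> Prop) (f : T -> C) (l : C) : Prop :=
  forall eps : R, (0 < eps)%R -> F (fun t => (Cmod (f t - l) < eps)%R).

Lemma Clim_filterlim {T : Type} (F : (T -> Prop) -> Prop) (FF : Filter F)
  (f : T -> C) (l : C) :
  Clim F f l <-> filterlim f F (locally (l : C_NormedModule)).
Proof.
  rewrite (@filterlim_locally_ball_norm C_AbsRing T C_NormedModule F FF f l).
  split; intros H.
  - intros eps. exact (H eps (cond_pos eps)).
  - intros eps Heps. exact (H (mkposreal eps Heps)).
Qed.

Lemma Clim_unique {T : Type} (F : (T -> Prop) -> Prop) (FF : ProperFilter F)
  (f : T -> C) (l l' : C) : Clim F f l -> Clim F f l' -> l = l'.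
Proof.
  intros H H'. destruct FF as [Fex FF].
  apply Clim_filterlim in H, H'; try exact FF.
  assert (PF : ProperFilter' F).
  { constructor; try exact FF. intros P. destruct (Fex _ P) as [? []]. }
  exact (@filterlim_locally_unique T C_AbsRing C_NormedModule F PF f l l' H H').
Qed.

Lemma Clim_ext {T : Type} (F : (T -> Prop) -> Prop) (FF : Filter F)
  (f g : T -> C) (l : C) : (forall t, f t = g t) -> Clim F f l -> Clim F g l.
Proof.
  intros E H eps Heps. generalize (H eps Heps).
  apply filter_imp. intros t. now rewrite E.
Qed.

Lemma Clim_const {T : Type} (F : (T -> Prop) -> Prop) (FF : Filter F) (l : C) :
  Clim F (fun _ => l) l.
Proof.
  intros eps Heps. apply filter_forall. intros _.
  replace (l - l) with (RtoC 0) by ring. now rewrite Cmod_0.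
Qed.

Lemma Clim_plus {T : Type} (F : (T -> Prop) -> Prop) (FF : Filter F)
  (f g : T -> C) (l m : C) :
  Clim F f l -> Clim F g m -> Clim F (fun t => f t + g t) (l + m).
Proof.
  intros H H' eps Heps.
  assert (He : (0 < eps / 2)%R) by lra.
  generalize (filter_and _ _ (H _ He) (H' _ He)). apply filter_imp.
  intros t [A B].
  replace (f t + g t - (l + m)) with ((f t - l) + (g t - m)) by ring.
  eapply Rle_lt_trans; [apply Cmod_triangle|]. lra.
Qed.

Lemma Clim_mult {T : Type} (F : (T -> Prop) -> Prop) (FF : Filter F)
  (f g : T -> C) (l m : C) :
  Clim F f l -> Clim F g m -> Clim F (fun t => f t * g t) (l * m).
Proof.
  intros H H' eps Heps.
  set (K := (Cmod l + Cmod m + 1)%R).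
  pose proof (Cmod_ge_0 l). pose proof (Cmod_ge_0 m).
  assert (HK : (0 < K)%R) by (unfold K; lra).
  set (d := Rmin 1 (eps / (2 * K))).
  assert (Hd : (0 < d)%R).
  { unfold d. apply Rmin_pos; [lra|]. apply Rdiv_lt_0_compat; lra. }
  assert (Hd1 : (d <= 1)%R) by apply Rmin_l.
  assert (Hd2 : (d * K <= eps / 2)%R).
  { apply Rle_trans with (eps / (2 * K) * K)%R.
    - apply Rmult_le_compat_r; [lra|apply Rmin_r].
    - right. field. lra. }
  generalize (filter_and _ _ (H _ Hd) (H' _ Hd)). apply filter_imp.
  intros t [A B].
  replace (f t * g t - l * m)
    with ((f t - l) * (g t - m) + ((f t - l) * m + l * (g t - m))) by ring.
  eapply Rle_lt_trans; [apply Cmod_triangle|].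
  eapply Rle_lt_trans; [apply Rplus_le_compat_l, Cmod_triangle|].
  rewrite !Cmod_mult.
  pose proof (Cmod_ge_0 (f t - l)). pose proof (Cmod_ge_0 (g t - m)).
  unfold K in *. nra.
Qed.

Lemma Clim_inv {T : Type} (F : (T -> Prop) -> Prop) (FF : Filter F)
  (f : T -> C) (l : C) : l <> 0 -> Clim F f l -> Clim F (fun t => / f t) (/ l).
Proof.
  intros Hl H eps Heps.
  assert (Hm : (0 < Cmod l)%R) by now apply Cmod_gt_0.
  set (d := Rmin (Cmod l / 2) (eps * (Cmod l * Cmod l) / 2)).
  assert (Hd : (0 < d)%R).
  { unfold d. apply Rmin_pos; [lra|]. pose proof (Rmult_lt_0_compat _ _ Hm Hm).
    pose proof (Rmult_lt_0_compat _ _ Heps H0). lra. }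
  assert (Hd1 : (d <= Cmod l / 2)%R) by apply Rmin_l.
  assert (Hd2 : (d <= eps * (Cmod l * Cmod l) / 2)%R) by apply Rmin_r.
  generalize (H _ Hd). apply filter_imp. intros t A.
  assert (B : (Cmod l <= Cmod (f t) + Cmod (f t - l))%R).
  { replace l with (f t + - (f t - l)) at 1 by ring.
    eapply Rle_trans; [apply Cmod_triangle|]. rewrite Cmod_opp. lra. }
  assert (Hf : (Cmod l / 2 < Cmod (f t))%R) by lra.
  assert (Hf0 : f t <> 0) by (apply Cmod_gt_0; lra).
  replace (/ f t - / l) with (- (f t - l) * (/ (f t * l))) by (field; auto).
  rewrite Cmod_mult, Cmod_opp, Cmod_inv, Cmod_mult by now apply Cmult_neq_0.
  apply Rmult_lt_reg_r with (Cmod (f t) * Cmod l)%R.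
  { apply Rmult_lt_0_compat; lra. }
  rewrite Rmult_assoc, Rinv_l, Rmult_1_r by (apply Rgt_not_eq, Rmult_lt_0_compat; lra).
  eapply Rlt_le_trans; [exact A|].
  eapply Rle_trans; [exact Hd2|].
  assert (Cmod l / 2 * Cmod l <= Cmod (f t) * Cmod l)%R by (apply Rmult_le_compat_r; lra).
  apply Rle_trans with (eps * (Cmod l / 2 * Cmod l))%R; [right; field|].
  apply Rmult_le_compat_l; lra.
Qed.

Lemma Clim_scal {T : Type} (F : (T -> Prop) -> Prop) (FF : Filter F)
  (f : T -> C) (c l : C) : Clim F f l -> Clim F (fun t => c * f t) (c * l).
Proof. intros H. apply Clim_mult; auto. now apply Clim_const. Qed.

Lemma Clim_dist_le {T : Type} (F : (T -> Prop) -> Prop) (FF : ProperFilter F)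
  (f : T -> C) (c l : C) (B : R) :
  Clim F f l -> F (fun t => (Cmod (f t - c) <= B)%R) -> (Cmod (l - c) <= B)%R.
Proof.
  intros H HB. apply Rnot_lt_le. intros HL.
  assert (He : (0 < Cmod (l - c) - B)%R) by lra.
  destruct (filter_ex _ (filter_and _ _ (H _ He) HB)) as [t [A A']].
  assert (Cmod (l - c) <= Cmod (f t - l) + Cmod (f t - c))%R; [|lra].
  replace (l - c) with (- (f t - l) + (f t - c)) by ring.
  eapply Rle_trans; [apply Cmod_triangle|]. rewrite Cmod_opp. lra.
Qed.

Lemma Cmod_le_1plus {T : Type} (F : (T -> Prop) -> Prop) (FF : Filter F) (f : T -> C) (l : C) :
  Clim F f l -> F (fun t => (Cmod (f t) <= Cmod l + 1)%R).
Proof.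
  intros H. generalize (H 1%R Rlt_0_1). apply filter_imp. intros t Ht.
  replace (f t) with (l + (f t - l)) by ring.
  eapply Rle_trans; [apply Cmod_triangle|]. lra.
Qed.

Lemma Clim_nz {T : Type} (F : (T -> Prop) -> Prop) (FF : Filter F) (f : T -> C) (l : C) :
  l <> 0 -> Clim F f l -> F (fun t => (Cmod l / 2 <= Cmod (f t))%R).
Proof.
  intros Hl H. assert (Hm : (0 < Cmod l / 2)%R) by (apply Cmod_gt_0 in Hl; lra).
  generalize (H _ Hm). apply filter_imp. intros t Ht.
  assert (Cmod l <= Cmod (f t) + Cmod (f t - l))%R; [|lra].
  replace l with (f t + - (f t - l)) at 1 by ring.
  eapply Rle_trans; [apply Cmod_triangle|]. rewrite Cmod_opp. lra.
Qed.

Lemma Clim_pow {T : Type} (F : (T -> Prop) -> Prop) (FF : Filter F) (f : T -> C) (l : C) n :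
  Clim F f l -> Clim F (fun t => f t ^ n) (l ^ n).
Proof.
  intros H. induction n as [|n IH]; simpl; [now apply Clim_const|]. now apply Clim_mult.
Qed.

Lemma Clim_opp {T : Type} (F : (T -> Prop) -> Prop) (FF : Filter F) (f : T -> C) (l : C) :
  Clim F f l -> Clim F (fun t => - f t) (- l).
Proof.
  intros H. apply (Clim_ext F FF (fun t => - (1) * f t)); [intros; ring|].
  replace (- l) with (- (1) * l) by ring. now apply Clim_scal.
Qed.

Lemma Clim_nat_comp (f : nat -> C) (g : nat -> nat) (l : C) :
  (forall n, (n <= g n)%nat) -> Clim eventually f l -> Clim eventually (fun n => f (g n)) l.
Proof.
  intros Hg H eps Heps. destruct (H eps Heps) as [N HN]. exists N. intros n Hn.
  apply HN. specialize (Hg n). lia.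
Qed.

Lemma Clim_nat_shift (f : nat -> C) (k : nat) (l : C) :
  Clim eventually f l -> Clim eventually (fun n => f (n - k)%nat) l.
Proof.
  intros H eps Heps. destruct (H eps Heps) as [N HN]. exists (N + k)%nat. intros n Hn.
  apply HN. lia.
Qed.

(** * Unordered summation over arbitrary index types *)

Definition lsum {I : Type} (u : I -> C) (l : list I) : C :=
  fold_right (fun i s => u i + s) 0 l.

Definition lnorm {I : Type} (u : I -> C) (l : list I) : R :=
  fold_right (fun i s => (Cmod (u i) + s)%R) 0%R l.

(** The directed set of finite subsets of [I], a finite subset being a list without
    repetition. *)
Definition fin_filter {I : Type} (A : list I -> Prop) : Prop :=
  exists l0, NoDup l0 /\ forall l, NoDup l -> incl l0 l -> A l.

Definition has_sum {I : Type} (u : I -> C) (s : C) : Prop :=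
  Clim fin_filter (lsum u) s.

Definition sum_le {I : Type} (u : I -> C) (B : R) : Prop :=
  forall l, NoDup l -> (lnorm u l <= B)%R.

Lemma incl_perm {I : Type} (l l' : list I) :
  NoDup l -> incl l l' -> exists r, Permutation l' (l ++ r).
Proof.
  intros H. revert l'. induction H as [|a l Ha Hl IH]; intros l' Hi.
  - now exists l'.
  - destruct (in_split a l') as [p [s ->]]; [apply Hi; now left|].
    destruct (IH (p ++ s)) as [r Hr].
    { intros x Hx. assert (In x (p ++ a :: s)) by (apply Hi; now right).
      apply in_app_or in H. apply in_or_app. destruct H as [|[->|]]; auto.
      contradiction. }
    exists r. rewrite <- Permutation_middle. simpl. now apply perm_skip.
Qed.

Lemma nodup_ex {I : Type} (l : list I) :
  exists l', NoDup l' /\ forall x, In x l' <-> In x l.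
Proof.
  induction l as [|a l [l' [H H']]].
  - exists nil. split; [constructor|tauto].
  - destruct (classic (In a l)) as [Ha|Ha].
    + exists l'. split; auto. intros x. rewrite H'. simpl.
      split; [tauto|]. intros [<-|]; auto.
    + exists (a :: l'). split.
      * constructor; auto. now rewrite H'.
      * intros x. simpl. now rewrite H'.
Qed.

Lemma NoDup_union {I : Type} (l1 l2 : list I) :
  exists l, NoDup l /\ incl l1 l /\ incl l2 l.
Proof.
  destruct (nodup_ex (l1 ++ l2)) as [l [H H']].
  exists l. repeat split; auto; intros x Hx; apply H', in_or_app; auto.
Qed.

#[global] Instance fin_filter_proper {I : Type} : ProperFilter (@fin_filter I).
Proof.
  constructor.
  - intros P [l0 [H H']]. exists l0. apply H'; auto. apply incl_refl.
  - constructor.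
    + exists nil. split; [constructor|auto].
    + intros P Q [l1 [H1 H1']] [l2 [H2 H2']].
      destruct (NoDup_union l1 l2) as [l [H [Hi Hj]]].
      exists l. split; auto. intros l' Hl' Hll'.
      split; [apply H1'|apply H2']; auto; eapply incl_tran; eauto.
    + intros P Q HPQ [l0 [H H']]. exists l0. split; auto.
Qed.

Lemma fin_filter_intro {I : Type} (l0 : list I) (A : list I -> Prop) :
  (forall l, NoDup l -> incl l0 l -> A l) -> fin_filter A.
Proof.
  intros H. destruct (nodup_ex l0) as [l [Hl Hl']].
  exists l. split; auto. intros l1 H1 H1'. apply H; auto.
  intros x Hx. apply H1', Hl', Hx.
Qed.

Lemma lsum_app {I : Type} (u : I -> C) l l' :
  lsum u (l ++ l') = lsum u l + lsum u l'.
Proof. induction l as [|a l IH]; simpl; [ring|]. rewrite IH. ring. Qed.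

Lemma lnorm_app {I : Type} (u : I -> C) l l' :
  lnorm u (l ++ l') = (lnorm u l + lnorm u l')%R.
Proof. induction l as [|a l IH]; simpl; [ring|]. rewrite IH. ring. Qed.

Lemma lsum_perm {I : Type} (u : I -> C) l l' :
  Permutation l l' -> lsum u l = lsum u l'.
Proof. induction 1; simpl; try congruence. ring. Qed.

Lemma lnorm_perm {I : Type} (u : I -> C) l l' :
  Permutation l l' -> lnorm u l = lnorm u l'.
Proof. induction 1; simpl; try congruence. ring. Qed.

Lemma lnorm_ge_0 {I : Type} (u : I -> C) l : (0 <= lnorm u l)%R.
Proof.
  induction l as [|a l IH]; simpl; [lra|]. pose proof (Cmod_ge_0 (u a)). lra.
Qed.

Lemma lsum_lnorm {I : Type} (u : I -> C) l : (Cmod (lsum u l) <= lnorm u l)%R.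
Proof.
  induction l as [|a l IH]; simpl; [rewrite Cmod_0; lra|].
  eapply Rle_trans; [apply Cmod_triangle|]. lra.
Qed.

Lemma lnorm_incl {I : Type} (u : I -> C) l l' :
  NoDup l -> incl l l' -> (lnorm u l <= lnorm u l')%R.
Proof.
  intros H H'. destruct (incl_perm _ _ H H') as [r Hr].
  rewrite (lnorm_perm _ _ _ Hr), lnorm_app. pose proof (lnorm_ge_0 u r). lra.
Qed.

Lemma lsum_ext {I : Type} (u v : I -> C) l :
  (forall i, u i = v i) -> lsum u l = lsum v l.
Proof. intros H. induction l as [|a l IH]; simpl; congruence. Qed.

Lemma lsum_map {I J : Type} (g : I -> J) (u : J -> C) l :
  lsum u (map g l) = lsum (fun i => u (g i)) l.
Proof. induction l as [|a l IH]; simpl; congruence. Qed.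

Lemma lsum_plus {I : Type} (u v : I -> C) l :
  lsum (fun i => u i + v i) l = lsum u l + lsum v l.
Proof. induction l as [|a l IH]; simpl; [ring|]. rewrite IH. ring. Qed.

Lemma lsum_scal {I : Type} (c : C) (u : I -> C) l :
  lsum (fun i => c * u i) l = c * lsum u l.
Proof. induction l as [|a l IH]; simpl; [ring|]. rewrite IH. ring. Qed.

Lemma sum_le_ge_0 {I : Type} (u : I -> C) B : sum_le u B -> (0 <= B)%R.
Proof. intros H. exact (H nil (NoDup_nil _)). Qed.

Lemma sum_le_mono {I : Type} (u v : I -> C) (c B : R) :
  (0 <= c)%R -> (forall i, (Cmod (v i) <= c * Cmod (u i))%R) ->
  sum_le u B -> sum_le v (c * B).
Proof.
  intros Hc H HB l Hl.
  apply Rle_trans with (c * lnorm u l)%R.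
  - clear Hl. induction l as [|a l IH]; simpl; [lra|]. specialize (H a). lra.
  - apply Rmult_le_compat_l; auto.
Qed.

Lemma sum_le_weaken {I : Type} (u : I -> C) (B B' : R) :
  (B <= B')%R -> sum_le u B -> sum_le u B'.
Proof. intros H HB l Hl. specialize (HB l Hl). lra. Qed.

Lemma sum_le_dom {I : Type} (u v : I -> C) (B : R) :
  (forall i, (Cmod (v i) <= Cmod (u i))%R) -> sum_le u B -> sum_le v B.
Proof.
  intros H HB. replace B with (1 * B)%R by ring.
  apply sum_le_mono with u; auto; [lra|]. intros i. rewrite Rmult_1_l. auto.
Qed.

Lemma sum_le_plus {I : Type} (u v : I -> C) (A B : R) :
  sum_le u A -> sum_le v B -> sum_le (fun i => u i + v i) (A + B).
Proof.
  intros HA HB l Hl. apply Rle_trans with (lnorm u l + lnorm v l)%R.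
  - clear. induction l as [|a l IH]; simpl; [lra|].
    pose proof (Cmod_triangle (u a) (v a)). lra.
  - specialize (HA l Hl). specialize (HB l Hl). lra.
Qed.

(** A finite set whose norm sum is within [eps] of the supremum leaves no room outside. *)
Lemma sum_le_tail {I : Type} (u : I -> C) (B eps : R) : sum_le u B -> (0 < eps)%R ->
  exists l0, NoDup l0 /\ forall r, NoDup (l0 ++ r) -> (lnorm u r <= eps)%R.
Proof.
  intros HB Heps.
  destruct (completeness (fun r => exists l, NoDup l /\ r = lnorm u l)) as [S [HS1 HS2]].
  { exists B. intros r [l [Hl ->]]. auto. }
  { exists 0%R. exists nil. split; [constructor|reflexivity]. }
  destruct (classic (exists l, NoDup l /\ (S - eps < lnorm u l)%R)) as [[l0 [H0 H0']]|Hn].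
  2:{ exfalso. assert (S <= S - eps)%R; [|lra]. apply HS2.
      intros r [l [Hl ->]]. apply Rnot_lt_le. intros HL. apply Hn. now exists l. }
  exists l0. split; auto. intros r Hr.
  assert (lnorm u (l0 ++ r) <= S)%R by (apply HS1; now exists (l0 ++ r)).
  rewrite lnorm_app in H. lra.
Qed.

(** The finite sums form a Cauchy net, since by [sum_le_tail] all of them that contain a
    suitable finite set are close to each other. *)
Lemma sum_le_has_sum {I : Type} (u : I -> C) (B : R) :
  sum_le u B -> exists s, has_sum u s.
Proof.
  intros HB.
  destruct (proj1 (@filterlim_locally_cauchy (list I) C_CompleteNormedModule
                     (@fin_filter I) _ (lsum u))) as [s Hs].
  - intros eps.
    assert (He : (0 < eps)%R) by apply cond_pos.
    destruct (sum_le_tail u B (eps / 4) HB ltac:(lra)) as [l0 [H0 H0']].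
    exists (fun l => NoDup l /\ incl l0 l). split.
    { exists l0. split; auto. }
    assert (K : forall l, NoDup l -> incl l0 l -> (Cmod (lsum u l - lsum u l0) <= eps / 4)%R).
    { intros l Hl Hi. destruct (incl_perm _ _ H0 Hi) as [r Hr].
      rewrite (lsum_perm _ _ _ Hr), lsum_app.
      replace (lsum u l0 + lsum u r - lsum u l0) with (lsum u r) by ring.
      eapply Rle_trans; [apply lsum_lnorm|]. apply H0'. now apply (Permutation_NoDup Hr). }
    intros l l' [Hl Hi] [Hl' Hi'].
    apply C_NormedModule_mixin_compat1. change (Cmod (lsum u l' - lsum u l) < eps)%R.
    replace (lsum u l' - lsum u l)
      with ((lsum u l' - lsum u l0) + - (lsum u l - lsum u l0)) by ring.
    eapply Rle_lt_trans; [apply Cmod_triangle|]. rewrite Cmod_opp.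
    pose proof (K l Hl Hi). pose proof (K l' Hl' Hi'). lra.
  - exists s. apply Clim_filterlim; [apply fin_filter_proper|]. exact Hs.
Qed.

Lemma has_sum_unique {I : Type} (u : I -> C) s s' :
  has_sum u s -> has_sum u s' -> s = s'.
Proof. apply Clim_unique, fin_filter_proper. Qed.

Lemma has_sum_ext {I : Type} (u v : I -> C) s :
  (forall i, u i = v i) -> has_sum u s -> has_sum v s.
Proof.
  intros H. apply Clim_ext; [apply fin_filter_proper|].
  intros l. now apply lsum_ext.
Qed.

Lemma has_sum_plus {I : Type} (u v : I -> C) s t :
  has_sum u s -> has_sum v t -> has_sum (fun i => u i + v i) (s + t).
Proof.
  intros H H'. eapply Clim_ext; [apply fin_filter_proper| |].
  2: apply Clim_plus; [apply fin_filter_proper|exact H|exact H'].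
  intros l. simpl. now rewrite lsum_plus.
Qed.

Lemma has_sum_scal {I : Type} (c : C) (u : I -> C) s :
  has_sum u s -> has_sum (fun i => c * u i) (c * s).
Proof.
  intros H. eapply Clim_ext; [apply fin_filter_proper| |].
  2: apply Clim_scal; [apply fin_filter_proper|exact H].
  intros l. simpl. now rewrite lsum_scal.
Qed.

Lemma has_sum_bound {I : Type} (u : I -> C) s B :
  has_sum u s -> sum_le u B -> (Cmod s <= B)%R.
Proof.
  intros H HB. replace s with (s - 0) by ring.
  apply (Clim_dist_le _ _ _ _ _ _ H).
  exists nil. split; [constructor|]. intros l Hl _.
  replace (lsum u l - 0) with (lsum u l) by ring.
  eapply Rle_trans; [apply lsum_lnorm|]. auto.
Qed.

Lemma lnorm_mono {I : Type} (u v : I -> C) l :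
  (forall i, (Cmod (u i) <= Cmod (v i))%R) -> (lnorm u l <= lnorm v l)%R.
Proof. intros H. induction l as [|a l IH]; simpl; [lra|]. specialize (H a). lra. Qed.

Lemma Clim_lsum {T I : Type} (F : (T -> Prop) -> Prop) (FF : Filter F)
  (u : T -> I -> C) (v : I -> C) l : (forall i, Clim F (fun t => u t i) (v i)) ->
  Clim F (fun t => lsum (u t) l) (lsum v l).
Proof.
  intros H. induction l as [|a l IH]; simpl; [now apply Clim_const|].
  now apply Clim_plus.
Qed.

Lemma has_sum_tail {I : Type} (u M : I -> C) (s : C) (eps : R) l0 :
  NoDup l0 -> (forall r, NoDup (l0 ++ r) -> (lnorm M r <= eps)%R) ->
  (forall i, (Cmod (u i) <= Cmod (M i))%R) -> has_sum u s ->
  (Cmod (s - lsum u l0) <= eps)%R.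
Proof.
  intros H0 HM Hu Hs. apply (Clim_dist_le _ _ _ _ _ _ Hs).
  exists l0. split; auto. intros l Hl Hi.
  destruct (incl_perm _ _ H0 Hi) as [r Hr].
  rewrite (lsum_perm _ _ _ Hr), lsum_app.
  replace (lsum u l0 + lsum u r - lsum u l0) with (lsum u r) by ring.
  eapply Rle_trans; [apply lsum_lnorm|]. eapply Rle_trans; [now apply lnorm_mono|].
  apply HM. now apply (Permutation_NoDup Hr).
Qed.

(** The common majorant [M] makes the parts of all sums outside one finite set small; on
    that set the convergence is termwise. *)
Lemma tannery {T I : Type} (F : (T -> Prop) -> Prop) (FF : Filter F)
  (u : T -> I -> C) (v M : I -> C) (s : T -> C) (t : C) (B : R) :
  sum_le M B -> (forall i, (Cmod (v i) <= Cmod (M i))%R) ->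
  F (fun a => forall i, (Cmod (u a i) <= Cmod (M i))%R) ->
  F (fun a => has_sum (u a) (s a)) -> has_sum v t ->
  (forall i, Clim F (fun a => u a i) (v i)) -> Clim F s t.
Proof.
  intros HM Hv Hu Hs Ht HL eps Heps.
  assert (He : (0 < eps / 4)%R) by lra.
  destruct (sum_le_tail M B (eps / 4) HM He) as [l0 [H0 H0']].
  pose proof (has_sum_tail v M t _ l0 H0 H0' Hv Ht) as Kt.
  generalize (filter_and _ _ (filter_and _ _ Hu Hs) (Clim_lsum F FF u v l0 HL _ He)).
  apply filter_imp. intros a [[A1 A2] A3].
  pose proof (has_sum_tail (u a) M (s a) _ l0 H0 H0' A1 A2) as Ks.
  replace (s a - t) with ((s a - lsum (u a) l0) + ((lsum (u a) l0 - lsum v l0) + - (t - lsum v l0))) by ring.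
  eapply Rle_lt_trans; [apply Cmod_triangle|].
  eapply Rle_lt_trans; [apply Rplus_le_compat_l, Cmod_triangle|]. rewrite Cmod_opp. lra.
Qed.

(** A finite set of indices outside the image of [g] contributes nothing, so it
    may be replaced by its trace on the image. *)
Lemma trace_ex {I J : Type} (g : I -> J) (u : J -> C) (l : list J) :
  (forall i i', g i = g i' -> i = i') ->
  (forall j, (exists i, g i = j) \/ u j = 0) -> NoDup l ->
  exists l', NoDup l' /\ lsum u l = lsum (fun i => u (g i)) l'
    /\ lnorm u l = lnorm (fun i => u (g i)) l' /\ forall i, In i l' <-> In (g i) l.
Proof.
  intros Hg Hu. induction 1 as [|j l Hj Hl [l' [H1 [H2 [H2' H3]]]]].
  - exists nil. repeat split; simpl; try tauto. constructor.
  - destruct (classic (exists i, g i = j)) as [[i Ei]|Hn]; [subst j|].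
    + exists (i :: l'). split; [|split; [|split]].
      * constructor; auto. now rewrite H3.
      * simpl. now rewrite H2.
      * simpl. now rewrite H2'.
      * intros i'. simpl. rewrite H3. split; intros [E|E]; auto.
        left. congruence.
    + assert (E : u j = 0) by (destruct (Hu j); tauto).
      exists l'. split; [|split; [|split]]; auto.
      * simpl. rewrite E, H2. ring.
      * simpl. rewrite E, H2', Cmod_0. ring.
      * intros i'. simpl. rewrite H3. split; auto.
        intros [E'|]; auto. exfalso. apply Hn. now exists i'.
Qed.

Lemma has_sum_inj {I J : Type} (g : I -> J) (u : J -> C) s :
  (forall i i', g i = g i' -> i = i') ->
  (forall j, (exists i, g i = j) \/ u j = 0) ->
  has_sum (fun i => u (g i)) s -> has_sum u s.
Proof.
  intros Hg Hu H eps Heps. destruct (H eps Heps) as [l0 [H0 H0']].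
  apply (fin_filter_intro (map g l0)). intros l Hl Hi.
  destruct (trace_ex g u l Hg Hu Hl) as [l' [H1 [-> [_ H3]]]].
  apply H0'; auto. intros i Hin. apply H3, Hi. now apply in_map.
Qed.

Lemma sum_le_inj {I J : Type} (g : I -> J) (u : J -> C) B :
  (forall i i', g i = g i' -> i = i') ->
  (forall j, (exists i, g i = j) \/ u j = 0) ->
  sum_le (fun i => u (g i)) B -> sum_le u B.
Proof.
  intros Hg Hu H l Hl.
  destruct (trace_ex g u l Hg Hu Hl) as [l' [H1 [_ [-> _]]]]. auto.
Qed.

Lemma sum_le_comp {I J : Type} (g : I -> J) (u : J -> C) B :
  (forall i i', g i = g i' -> i = i') -> sum_le u B -> sum_le (fun i => u (g i)) B.
Proof.
  intros Hg H l Hl. replace (lnorm (fun i => u (g i)) l) with (lnorm u (map g l)).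
  - apply H. clear H. induction Hl as [|a l Ha Hl IH]; simpl; constructor; auto.
    intros Hin. apply in_map_iff in Hin. destruct Hin as [x [E Hx]].
    apply Hg in E. now subst.
  - clear. induction l as [|a l IH]; simpl; congruence.
Qed.

Lemma has_sum_bij {I J : Type} (g : I -> J) (h : J -> I) (u : J -> C) s :
  (forall i, h (g i) = i) -> (forall j, g (h j) = j) ->
  has_sum u s -> has_sum (fun i => u (g i)) s.
Proof.
  intros Hhg Hgh H. apply (has_sum_inj h).
  - intros j j' E. rewrite <- (Hgh j), <- (Hgh j'). congruence.
  - intros i. left. exists (g i). apply Hhg.
  - revert H. apply has_sum_ext. intros j. now rewrite Hgh.
Qed.

Lemma lsum_prod {I J : Type} (u : I * J -> C) l m :
  lsum u (list_prod l m) = lsum (fun i => lsum (fun j => u (i, j)) m) l.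
Proof.
  induction l as [|a l IH]; simpl; auto. rewrite lsum_app, lsum_map. now rewrite IH.
Qed.

Lemma lnorm_prod {I J : Type} (u : I * J -> C) l m :
  lnorm u (list_prod l m) =
  fold_right (fun i s => (lnorm (fun j => u (i, j)) m + s)%R) 0%R l.
Proof.
  induction l as [|a l IH]; simpl; auto. rewrite lnorm_app, IH. f_equal.
  clear. induction m as [|b m IH]; simpl; congruence.
Qed.

Lemma NoDup_prod {I J : Type} (l : list I) (m : list J) :
  NoDup l -> NoDup m -> NoDup (list_prod l m).
Proof.
  intros Hl Hm. induction Hl as [|a l Ha Hl IH]; simpl; [constructor|].
  apply NoDup_app; auto.
  - clear - Hm. induction Hm as [|b m Hb Hm IH]; simpl; constructor; auto.
    intros Hin. apply in_map_iff in Hin. destruct Hin as [x [E Hx]].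
    injection E as ->. contradiction.
  - intros [x y] Hin Hin'. apply in_map_iff in Hin. destruct Hin as [z [E _]].
    injection E as -> ->. apply in_prod_iff in Hin'. tauto.
Qed.

(** Both conclusions come from the sums of [u] over rectangles [l x m], with [m] growing for a
    fixed finite [l]. *)
Lemma fubini {I J : Type} (u : I * J -> C) (B : R) (r : I -> C) (s : C) :
  sum_le u B -> (forall i, has_sum (fun j => u (i, j)) (r i)) -> has_sum u s ->
  has_sum r s /\ sum_le r B.
Proof.
  intros HB Hr Hs.
  assert (L : forall l, Clim fin_filter
                          (fun m => lsum (fun i => lsum (fun j => u (i, j)) m) l) (lsum r l)).
  { induction l as [|a l IH]; simpl.
    - apply Clim_const. apply fin_filter_proper.
    - apply Clim_plus; auto; [apply fin_filter_proper|apply Hr]. }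
  split.
  - intros eps Heps.
    assert (He : (0 < eps / 2)%R) by lra.
    destruct (Hs _ He) as [l0 [H0 H0']].
    apply (fin_filter_intro (map fst l0)). intros l Hl Hi.
    apply Rle_lt_trans with (eps / 2)%R; [|lra].
    apply (Clim_dist_le _ _ _ _ _ _ (L l)).
    apply (fin_filter_intro (map snd l0)). intros m Hm Hi'.
    rewrite <- lsum_prod. apply Rlt_le, H0'; [now apply NoDup_prod|].
    intros [i j] Hij. apply in_prod.
    + apply Hi. apply in_map_iff. now exists (i, j).
    + apply Hi'. apply in_map_iff. now exists (i, j).
  - intros l Hl. apply Rnot_lt_le. intros HL.
    set (d := (lnorm r l - B)%R) in *. assert (Hd : (0 < d)%R) by (unfold d; lra).
    assert (A : forall l', fin_filter (fun m => (lnorm r l' <=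
      fold_right (fun i s => (lnorm (fun j => u (i, j)) m + s)%R) 0%R l'
        + INR (length l') * (d / (INR (length l) + 1)))%R)).
    { intros l'. pose proof (pos_INR (length l)) as Hp.
      set (e := (d / (INR (length l) + 1))%R).
      assert (Hepos : (0 < e)%R) by (apply Rdiv_lt_0_compat; lra).
      induction l' as [|a l' IH].
      - simpl. apply filter_forall. intros. lra.
      - generalize (filter_and _ _ (Hr a e Hepos) IH). apply filter_imp.
        intros m [H1 H2]. cbn [lnorm fold_right]. fold (lnorm r l').
        replace (INR (length (a :: l'))) with (INR (length l') + 1)%R
          by (simpl length; rewrite S_INR; ring).
        assert (Cmod (r a) <= lnorm (fun j => u (a, j)) m + e)%R; [|lra].
        replace (r a) with (lsum (fun j => u (a, j)) m + - (lsum (fun j => u (a, j)) m - r a)) by ring.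
        eapply Rle_trans; [apply Cmod_triangle|]. rewrite Cmod_opp.
        pose proof (lsum_lnorm (fun j => u (a, j)) m). lra. }
    destruct (A l) as [m [Hm Hm']]. specialize (Hm' m Hm (incl_refl m)).
    rewrite <- lnorm_prod in Hm'.
    specialize (HB _ (NoDup_prod l m Hl Hm)).
    pose proof (pos_INR (length l)) as Hp.
    assert (INR (length l) * (d / (INR (length l) + 1)) < d)%R.
    { apply Rmult_lt_reg_r with (INR (length l) + 1)%R; [lra|].
      replace (INR (length l) * (d / (INR (length l) + 1)) * (INR (length l) + 1))%R
        with (INR (length l) * d)%R by (field; lra). nra. }
    unfold d in *. lra.
Qed.

Lemma tonelli {I J : Type} (u : I * J -> C) (r : I -> R) (B : R) :
  (forall i, sum_le (fun j => u (i, j)) (r i)) -> sum_le (fun i => RtoC (r i)) B ->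
  sum_le u B.
Proof.
  intros Hr HB l Hl.
  destruct (nodup_ex (map fst l)) as [l1 [N1 E1]].
  destruct (nodup_ex (map snd l)) as [l2 [N2 E2]].
  apply Rle_trans with (lnorm u (list_prod l1 l2)).
  { apply lnorm_incl; auto. intros [i j] Hij. apply in_prod.
    - apply E1, in_map_iff. now exists (i, j).
    - apply E2, in_map_iff. now exists (i, j). }
  rewrite lnorm_prod. eapply Rle_trans; [|apply (HB l1 N1)].
  clear E1. induction l1 as [|a l1 IH]; simpl; [lra|].
  apply Rplus_le_compat.
  - rewrite Cmod_R. eapply Rle_trans; [|apply Rle_abs]. now apply Hr.
  - apply IH. now inversion N1.
Qed.

Lemma sum_le_prod {I J : Type} (u : I -> C) (v : J -> C) (A B : R) :
  sum_le u A -> sum_le v B -> sum_le (fun p => u (fst p) * v (snd p)) (A * B).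
Proof.
  intros HA HB l Hl.
  destruct (nodup_ex (map fst l)) as [l1 [N1 E1]].
  destruct (nodup_ex (map snd l)) as [l2 [N2 E2]].
  apply Rle_trans with (lnorm (fun p => u (fst p) * v (snd p)) (list_prod l1 l2)).
  - apply lnorm_incl; auto. intros [i j] Hij. apply in_prod.
    + apply E1, in_map_iff. now exists (i, j).
    + apply E2, in_map_iff. now exists (i, j).
  - rewrite lnorm_prod. simpl.
    replace (fold_right _ 0%R l1) with (lnorm u l1 * lnorm v l2)%R.
    + apply Rmult_le_compat; auto using lnorm_ge_0.
    + clear. induction l1 as [|a l IH]; simpl; [ring|].
      rewrite <- IH. replace (lnorm (fun j => u a * v j) l2) with (Cmod (u a) * lnorm v l2)%R; [ring|].
      clear. induction l2 as [|b m IH]; simpl; [ring|]. rewrite <- IH, Cmod_mult. ring.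
Qed.

Lemma has_sum_prod {I J : Type} (u : I -> C) (v : J -> C) (A B : R) (s t : C) :
  sum_le u A -> sum_le v B -> has_sum u s -> has_sum v t ->
  has_sum (fun p => u (fst p) * v (snd p)) (s * t).
Proof.
  intros HA HB Hs Ht.
  pose proof (sum_le_prod _ _ _ _ HA HB) as HP.
  destruct (sum_le_has_sum _ _ HP) as [w Hw].
  destruct (fubini _ _ (fun i => u i * t) w HP) as [H _]; auto.
  - intros i. simpl. now apply has_sum_scal.
  - replace (s * t) with w; auto. apply (has_sum_unique _ _ _ H).
    rewrite Cmult_comm. eapply has_sum_ext; [|apply has_sum_scal, Hs].
    intros i. simpl. ring.
Qed.

(** Meaningful as soon as a sum exists, in particular under a bound [sum_le]. *)
Definition usum {I : Type} (u : I -> C) : C :=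
  iota (T := C_CompleteNormedModule) (fun s : C => has_sum u s).

Lemma usum_eq {I : Type} (u : I -> C) s : has_sum u s -> usum u = s.
Proof.
  intros H. apply (@iota_unique C_AbsRing C_CompleteNormedModule); auto.
  intros t Ht. now apply (has_sum_unique u).
Qed.

Lemma usum_correct {I : Type} (u : I -> C) B : sum_le u B -> has_sum u (usum u).
Proof.
  intros H. destruct (sum_le_has_sum u B H) as [s Hs]. now rewrite (usum_eq u s Hs).
Qed.

Lemma has_sum_single {I : Type} (i0 : I) (u : I -> C) :
  (forall i, i <> i0 -> u i = 0) -> has_sum u (u i0).
Proof.
  intros H. apply (has_sum_inj (fun _ : unit => i0)).
  - intros [] []; auto.
  - intros j. destruct (classic (j = i0)) as [->|Hj]; auto. left. now exists tt.
  - intros eps Heps. exists (tt :: nil). split.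
    + constructor; [intros []|constructor].
    + intros [|[] l] Hl Hi.
      * destruct (Hi tt). now left.
      * assert (l = nil) as ->.
        { destruct l as [|[] l]; auto. inversion Hl. exfalso. apply H2. now left. }
        simpl. replace (u i0 + 0 - u i0) with (RtoC 0) by ring. now rewrite Cmod_0.
Qed.

Lemma has_sum_minus {I : Type} (u v : I -> C) s t :
  has_sum u s -> has_sum v t -> has_sum (fun i => u i - v i) (s - t).
Proof.
  intros H H'. replace (s - t) with (s + (-(1)) * t) by ring.
  apply has_sum_ext with (fun i => u i + (-(1)) * v i).
  { intros i. ring. }
  apply has_sum_plus; auto. now apply has_sum_scal.
Qed.

Lemma has_sum_lsum {I K : Type} (u : K -> I -> C) (s : K -> C) (l : list K) :
  (forall r, has_sum (u r) (s r)) ->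
  has_sum (fun i => lsum (fun r => u r i) l) (lsum s l).
Proof.
  intros H. induction l as [|a l IH]; simpl.
  - intros eps Heps. exists nil. split; [constructor|]. intros l _ _.
    replace (lsum (fun _ : I => 0) l) with (RtoC 0).
    + replace (0 - 0) with (RtoC 0) by ring. now rewrite Cmod_0.
    + induction l as [|b l IH]; simpl; auto. rewrite <- IH. ring.
  - now apply has_sum_plus.
Qed.

Lemma has_sum_bool (u : bool -> C) : has_sum u (u true + u false).
Proof.
  apply has_sum_ext with (fun b : bool => (if b then u true else 0) + (if b then 0 else u false)).
  { intros [|]; ring. }
  apply has_sum_plus.
  - apply (has_sum_single true (fun b : bool => if b then u true else 0)). intros [|]; congruence.
  - apply (has_sum_single false (fun b : bool => if b then 0 else u false)). intros [|]; congruence.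
Qed.

Lemma sum_le_bool (u : bool -> C) : sum_le u (Cmod (u true) + Cmod (u false)).
Proof.
  intros l Hl. eapply Rle_trans; [apply (lnorm_incl u l (true :: false :: nil) Hl)|].
  - intros [|]; simpl; auto.
  - simpl. lra.
Qed.

(** * Series as unordered sums *)

Lemma sum_n_lsum (u : nat -> C) n : sum_n u n = lsum u (seq 0 (S n)).
Proof.
  induction n as [|n IH].
  - rewrite sum_O. simpl. symmetry. apply Cplus_0_r.
  - rewrite sum_Sn, IH, (seq_S (S n)), lsum_app. simpl. change plus with Cplus.
    now rewrite Cplus_0_r.
Qed.

Lemma seq_incl (l : list nat) : exists N, forall n, (N <= n)%nat -> incl l (seq 0 n).
Proof.
  induction l as [|a l [N H]].
  - exists O. intros n _ x [].
  - exists (Nat.max N (S a)). intros n Hn x [<-|Hx].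
    + apply in_seq. lia.
    + apply (H n); auto. lia.
Qed.

Lemma has_sum_series (u : nat -> C) s : has_sum u s -> is_series u s.
Proof.
  intros H. apply (Clim_filterlim eventually _). intros eps Heps.
  destruct (H eps Heps) as [l0 [H0 H0']].
  destruct (seq_incl l0) as [N HN]. exists N. intros n Hn.
  rewrite sum_n_lsum. apply H0'; [apply seq_NoDup|]. apply HN. lia.
Qed.

Lemma series_sum_le (u : nat -> C) :
  ex_series (fun n => Cmod (u n)) -> sum_le u (Series (fun n => Cmod (u n))).
Proof.
  intros H l Hl.
  destruct (seq_incl l) as [N HN].
  apply Rle_trans with (lnorm u (seq 0 (S N))).
  { apply lnorm_incl; auto. }
  replace (lnorm u (seq 0 (S N))) with (sum_n (fun n => Cmod (u n)) N).
  - apply Series_correct in H.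
    apply (is_lim_seq_le_loc (fun _ => sum_n (fun n => Cmod (u n)) N)
             (sum_n (fun n => Cmod (u n))) (sum_n (fun n => Cmod (u n)) N)
             (Series (fun n => Cmod (u n)))).
    + exists N. intros n Hn.
      induction Hn as [|n Hn IH]; [lra|]. rewrite sum_Sn. change plus with Rplus.
      simpl. pose proof (Cmod_ge_0 (u (S n))). lra.
    + apply is_lim_seq_const.
    + exact H.
  - clear. induction N as [|n IH].
    + rewrite sum_O. simpl. ring.
    + rewrite sum_Sn, IH, (seq_S (S n)), lnorm_app. change plus with Rplus. simpl. ring.
Qed.

Lemma sum_le_geom (u : nat -> C) (M r : R) :
  (0 <= r < 1)%R -> (forall n, (Cmod (u n) <= M * r ^ n)%R) -> exists B, sum_le u B.
Proof.
  intros Hr Hu. exists (Series (fun n => Cmod (u n))). apply series_sum_le.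
  apply (@ex_series_le R_AbsRing R_CompleteNormedModule _ (fun n => (M * r ^ n)%R)).
  - intros n. change norm with Rabs. rewrite Rabs_pos_eq; auto. apply Cmod_ge_0.
  - apply (@ex_series_scal_l R_AbsRing). apply ex_series_geom.
    rewrite Rabs_pos_eq; lra.
Qed.

Lemma has_sum_nat_S (u : nat -> C) s : has_sum (fun n => u (S n)) s -> has_sum u (u O + s).
Proof.
  intros H. apply has_sum_ext with (fun n => (match n with O => u O | S _ => 0 end)
                                             + (match n with O => 0 | S m => u n end)).
  { intros [|n]; ring. }
  apply has_sum_plus.
  - apply (has_sum_single O (fun n => match n with O => u O | S _ => 0 end)).
    intros [|n]; congruence.
  - apply (has_sum_inj S); [congruence| |exact H].
    intros [|n]; auto. left. now exists n.
Qed.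

Lemma has_sum_S (u : nat -> C) s : has_sum u s -> has_sum (fun n => u (S n)) (s - u O).
Proof.
  intros H eps Heps. destruct (H eps Heps) as [l0 [H0 H0']].
  apply (fin_filter_intro (map pred l0)). intros l Hl Hi.
  replace (lsum (fun n => u (S n)) l - (s - u O)) with (lsum u (O :: map S l) - s).
  - apply H0'.
    + constructor.
      * intros Hin. apply in_map_iff in Hin. destruct Hin as [x [E _]]. discriminate.
      * apply FinFun.Injective_map_NoDup; auto. intros x y E. now injection E.
    + intros [|n] Hn; [now left|]. right. apply in_map, Hi. now apply (in_map pred) in Hn.
  - simpl. rewrite lsum_map. ring.
Qed.

Lemma has_sum_finite (u : nat -> C) N : (forall j, (N <= j)%nat -> u j = 0) ->
  has_sum u (lsum u (seq 0 N)).
Proof.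
  intros H eps Heps. exists (seq 0 N). split; [apply seq_NoDup|]. intros l Hl Hi.
  destruct (incl_perm _ _ (seq_NoDup N 0) Hi) as [r Hr].
  rewrite (lsum_perm _ _ _ Hr), lsum_app.
  assert (E : lsum u r = 0).
  { assert (Hr' : forall j, In j r -> (N <= j)%nat).
    { intros j Hj. apply Nat.nlt_ge. intros HjN.
      apply (Permutation_NoDup Hr) in Hl. apply NoDup_app_remove_l in Hl as Hl'.
      apply in_split in Hj. destruct Hj as [r1 [r2 ->]].
      rewrite app_assoc in Hl. apply NoDup_remove_2 in Hl. apply Hl.
      rewrite <- app_assoc. apply in_or_app. left. apply in_seq. lia. }
    clear - H Hr'. induction r as [|a r IH]; simpl; auto.
    rewrite IH, H; [ring|apply Hr'; now left|]. intros j Hj. apply Hr'. now right. }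
  rewrite E. replace (lsum u (seq 0 N) + 0 - lsum u (seq 0 N)) with (RtoC 0) by ring.
  now rewrite Cmod_0.
Qed.

Lemma sum_le_ratio (u : nat -> C) (k : R) : (k < 1)%R -> (forall n, u n <> 0) ->
  is_lim_seq (fun n => Cmod (u (S n)) / Cmod (u n))%R k -> exists B, sum_le u B.
Proof.
  intros Hk Hu HL. exists (Series (fun n => Cmod (u n))). apply series_sum_le.
  assert (P : forall n, (0 < Cmod (u n))%R) by (intros n; now apply Cmod_gt_0).
  apply ex_series_ext with (fun n => Rabs (Cmod (u n))).
  { intros n. apply Rabs_pos_eq, Cmod_ge_0. }
  apply ex_series_DAlembert with k; auto.
  - intros n. specialize (P n). lra.
  - revert HL. apply is_lim_seq_ext. intros n. rewrite Rabs_pos_eq; auto.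
    apply Rlt_le, Rdiv_lt_0_compat; auto.
Qed.

(** * Bilateral sums *)

Lemma bilateral_sum_le (u : Z -> C) (A B : R) :
  sum_le (fun n : nat => u (Z.of_nat n)) A ->
  sum_le (fun n : nat => u (- Z.of_nat (S n))%Z) B ->
  sum_le u (A + B).
Proof.
  intros HA HB.
  intros l Hl. eapply Rle_trans; [|apply (sum_le_plus
    (fun k => if Z_le_dec 0 k then u k else 0)
    (fun k => if Z_le_dec 0 k then 0 else u k) A B); [| |exact Hl]].
  - right. clear. induction l as [|a l IH]; cbn [lnorm fold_right]; auto.
    fold (lnorm u l) in *. rewrite IH. unfold lnorm. f_equal. f_equal.
    destruct (Z_le_dec 0 a); ring.
  - apply (sum_le_inj Z.of_nat).
    + intros; lia.
    + intros j. destruct (Z_le_dec 0 j); auto. left. exists (Z.to_nat j). lia.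
    + revert HA. apply sum_le_dom. intros i. destruct (Z_le_dec 0 (Z.of_nat i)); [lra|lia].
  - apply (sum_le_inj (fun n => (- Z.of_nat (S n))%Z)).
    + intros; lia.
    + intros j. destruct (Z_le_dec 0 j); auto. left. exists (Z.to_nat (- j - 1)). lia.
    + revert HB. apply sum_le_dom. intros i.
      destruct (Z_le_dec 0 (- Z.of_nat (S i))); [lia|lra].
Qed.

Lemma bilateral_has_sum (u : Z -> C) (s t : C) :
  has_sum (fun n : nat => u (Z.of_nat n)) s ->
  has_sum (fun n : nat => u (- Z.of_nat (S n))%Z) t ->
  has_sum u (s + t).
Proof.
  intros Hs Ht.
  apply has_sum_ext with (fun k => (if Z_le_dec 0 k then u k else 0)
                                   + (if Z_le_dec 0 k then 0 else u k)).
  { intros k. destruct (Z_le_dec 0 k); ring. }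
  apply has_sum_plus.
  - apply (has_sum_inj Z.of_nat).
    + intros; lia.
    + intros j. destruct (Z_le_dec 0 j); auto. left. exists (Z.to_nat j). lia.
    + revert Hs. apply has_sum_ext. intros i. destruct (Z_le_dec 0 (Z.of_nat i)); auto; lia.
  - apply (has_sum_inj (fun n => (- Z.of_nat (S n))%Z)).
    + intros; lia.
    + intros j. destruct (Z_le_dec 0 j); auto. left. exists (Z.to_nat (- j - 1)). lia.
    + revert Ht. apply has_sum_ext. intros i.
      destruct (Z_le_dec 0 (- Z.of_nat (S i))); auto; lia.
Qed.

Lemma has_sum_pairs (u : Z -> C) (s B : _) : sum_le u B -> has_sum u s ->
  has_sum (fun k => u (2 * k)%Z + u (2 * k + 1)%Z) s.
Proof.
  intros HB Hs.
  set (g := fun p : Z * bool => (2 * fst p + if snd p then 0 else 1)%Z).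
  set (h := fun n : Z => ((n / 2)%Z, Z.even n)).
  assert (Hgh : forall n, g (h n) = n).
  { intros n. unfold g, h. cbn [fst snd]. pose proof (Z.div_mod n 2 ltac:(lia)) as E.
    rewrite Zmod_even in E. destruct (Z.even n); lia. }
  assert (Hg : forall p p', g p = g p' -> p = p').
  { intros [k b] [k' b']. unfold g. cbn [fst snd]. intros E.
    assert (b = b') by (destruct b, b'; auto; lia). subst b'.
    f_equal. destruct b; lia. }
  assert (Hhg : forall p, h (g p) = p) by (intros p; apply Hg, Hgh).
  apply (has_sum_bij g h) in Hs; auto.
  apply (sum_le_comp g) in HB; auto.
  apply (fubini (fun p => u (g p)) B (fun k => u (2 * k)%Z + u (2 * k + 1)%Z) s HB); auto.
  intros k. replace (u (2 * k)%Z) with (u (g (k, true))) by (unfold g; cbn [fst snd]; f_equal; lia).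
  apply (has_sum_bool (fun b => u (g (k, b)))).
Qed.

(** * Integer powers *)

Lemma Czpow_nat (x : C) (n : nat) : Czpow x (Z.of_nat n) = x ^ n.
Proof. destruct n; simpl; auto. now rewrite SuccNat2Pos.id_succ. Qed.

Lemma Cinv_0 : / RtoC 0 = 0.
Proof.
  apply injective_projections; simpl; unfold Rdiv; rewrite ?Ropp_0; apply Rmult_0_l.
Qed.

Lemma Cinv_nz (x : C) : x <> 0 -> / x <> 0.
Proof.
  intros H E. apply C1_nz. rewrite <- (Cinv_r x H), E. ring.
Qed.

Lemma Cinv_mult (x y : C) : / (x * y) = / x * / y.
Proof.
  destruct (classic (x = 0)) as [->|Hx].
  { rewrite Cmult_0_l, Cinv_0. ring. }
  destruct (classic (y = 0)) as [->|Hy].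
  { rewrite Cmult_0_r, Cinv_0. ring. }
  field. auto.
Qed.

Lemma Cinv_inv (x : C) : / / x = x.
Proof.
  destruct (classic (x = 0)) as [->|Hx]; [now rewrite !Cinv_0|]. field. auto.
Qed.

Lemma Copp_nz (z : C) : z <> 0 -> - z <> 0.
Proof. intros Hz E. apply Hz. replace z with (- - z) by ring. rewrite E. ring. Qed.

Lemma Czpow_opp (x : C) (n : Z) : Czpow x (- n) = / Czpow x n.
Proof.
  destruct n as [|p|p]; simpl.
  - field.
  - reflexivity.
  - destruct (classic (x ^ Pos.to_nat p = 0)) as [->|H].
    + now rewrite !Cinv_0.
    + field. exact H.
Qed.

Lemma Czpow_succ (x : C) (n : Z) : x <> 0 -> Czpow x (Z.succ n) = Czpow x n * x.
Proof.
  intros Hx. destruct (Z_le_dec 0 n) as [H|H].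
  - replace n with (Z.of_nat (Z.to_nat n)) by lia.
    rewrite <- Nat2Z.inj_succ, !Czpow_nat. simpl. ring.
  - replace n with (- Z.of_nat (S (Z.to_nat (- n - 1))))%Z by lia.
    replace (Z.succ (- Z.of_nat (S (Z.to_nat (- n - 1)))))
      with (- Z.of_nat (Z.to_nat (- n - 1)))%Z by lia.
    rewrite !Czpow_opp, !Czpow_nat. simpl. field. split; auto. now apply Cpow_nz.
Qed.

Lemma Czpow_nz (x : C) (n : Z) : x <> 0 -> Czpow x n <> 0.
Proof.
  intros Hx. destruct n; simpl; [exact C1_nz|now apply Cpow_nz|].
  apply Cinv_nz. now apply Cpow_nz.
Qed.

Lemma Czpow_add (x : C) (m n : Z) : x <> 0 -> Czpow x (m + n) = Czpow x m * Czpow x n.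
Proof.
  intros Hx. revert n. apply Z.bi_induction.
  - intros a b ->. tauto.
  - rewrite Z.add_0_r. simpl. ring.
  - intros n. replace (m + Z.succ n)%Z with (Z.succ (m + n)) by lia.
    rewrite !Czpow_succ by auto. split; intros H.
    + rewrite H. ring.
    + apply (f_equal (fun t => t * / x)) in H.
      replace (Czpow x (m + n) * x * / x) with (Czpow x (m + n)) in H by (field; auto).
      rewrite H. field. auto.
Qed.

Lemma Czpow_mult_l (x y : C) (n : Z) :
  x <> 0 -> y <> 0 -> Czpow (x * y) n = Czpow x n * Czpow y n.
Proof.
  intros Hx Hy. destruct n; simpl; [ring|apply Cpow_mult_l|].
  rewrite Cpow_mult_l. field. split; now apply Cpow_nz.
Qed.

Lemma Czpow_mult_r (x : C) (m n : Z) : x <> 0 -> Czpow x (m * n) = Czpow (Czpow x m) n.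
Proof.
  intros Hx. pose proof (Czpow_nz x m Hx). revert n. apply Z.bi_induction.
  - intros a b ->. tauto.
  - rewrite Z.mul_0_r. reflexivity.
  - intros n. replace (m * Z.succ n)%Z with (m * n + m)%Z by lia.
    rewrite Czpow_add, Czpow_succ by auto. split; intros E.
    + now rewrite E.
    + apply (f_equal (fun t => t * / Czpow x m)) in E.
      replace (Czpow x (m * n)) with (Czpow x (m * n) * Czpow x m * / Czpow x m) by (field; auto).
      rewrite E. field. auto.
Qed.

Lemma Czpow_inv (x : C) (n : Z) : x <> 0 -> Czpow (/ x) n = Czpow x (- n).
Proof.
  intros Hx. replace (- n)%Z with ((-1) * n)%Z by lia. rewrite Czpow_mult_r by auto.
  f_equal. simpl. field. auto.
Qed.

Lemma Czpow_1_r (x : C) : Czpow x 1 = x.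
Proof. simpl. ring. Qed.

Lemma Czpow_1_l (n : Z) : Czpow 1 n = 1.
Proof. destruct n; simpl; rewrite ?Cpow_1_l; auto. field. Qed.

(** * The infinite q-shifted factorial and its Euler expansion *)

Definition qp (x q : C) (n : nat) : C := Cprod (fun i => 1 - x * q ^ i) n.

Lemma qpoch_nat (x q : C) (n : nat) : qpoch x q (Z.of_nat n) = qp x q n.
Proof. destruct n; simpl; auto. now rewrite SuccNat2Pos.id_succ. Qed.

Lemma qp_S (x q : C) n : qp x q (S n) = qp x q n * (1 - x * q ^ n).
Proof. reflexivity. Qed.

Lemma qp_add (x q : C) m n : qp x q (m + n) = qp x q m * qp (x * q ^ m) q n.
Proof.
  induction n as [|n IH].
  - rewrite Nat.add_0_r. unfold qp at 3. simpl. ring.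
  - rewrite Nat.add_succ_r, !qp_S, IH, Cpow_add_r. ring.
Qed.

Lemma qp_S_l (x q : C) n : qp x q (S n) = (1 - x) * qp (x * q) q n.
Proof.
  change (S n) with (1 + n)%nat. rewrite qp_add. unfold qp at 1. simpl.
  replace (x * (q * 1)) with (x * q) by ring. ring.
Qed.

Lemma qp_nz (x q : C) n : nonzero_factors q x -> qp x q n <> 0.
Proof.
  intros H. induction n as [|n IH]; [exact C1_nz|].
  rewrite qp_S. apply Cmult_neq_0; auto.
Qed.

Lemma Cmod_q_nz (q : C) : (0 < Cmod q < 1)%R -> q <> 0.
Proof. intros Hq. apply Cmod_gt_0. lra. Qed.

Lemma Clim_qp {T : Type} (F : (T -> Prop) -> Prop) (FF : Filter F) (q : C) (f : T -> C) (l : C) n :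
  Clim F f l -> Clim F (fun t => qp (f t) q n) (qp l q n).
Proof.
  intros H. induction n as [|n IH].
  - change (Clim F (fun _ => RtoC 1) 1). now apply Clim_const.
  - rewrite qp_S. apply (Clim_ext F FF (fun t => qp (f t) q n * (1 + (- q ^ n) * f t))).
    + intros t. rewrite qp_S. ring.
    + apply Clim_mult; auto. replace (1 - l * q ^ n) with (1 + (- q ^ n) * l) by ring.
      apply Clim_plus; auto; [now apply Clim_const|now apply Clim_scal].
Qed.

Lemma qp_0 (q : C) n : qp 0 q n = 1.
Proof. induction n as [|n IH]; [reflexivity|]. rewrite qp_S, IH. ring. Qed.

Definition lprod {X : Type} (f : X -> C) (l : list X) : C := fold_right (fun x r => f x * r) 1 l.

Lemma lprod_cons {X : Type} (G : X -> C) (x : X) l : lprod G (x :: l) = G x * lprod G l.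
Proof. reflexivity. Qed.

Lemma Cmod_1_minus (x : C) : (1 - Cmod x <= Cmod (1 - x))%R.
Proof.
  assert (Cmod 1 <= Cmod (1 - x) + Cmod x)%R.
  { replace (RtoC 1) with ((1 - x) + x) at 1 by ring. apply Cmod_triangle. }
  rewrite Cmod_1 in H. lra.
Qed.

Lemma pow_lt_1 (r : R) n : (0 <= r < 1)%R -> (r ^ S n < 1)%R.
Proof.
  intros H. simpl. assert (r ^ n <= 1)%R.
  { rewrite <- (pow1 n). apply pow_incr. lra. }
  assert (0 <= r ^ n)%R by (apply pow_le; lra). nra.
Qed.

Lemma one_minus_nz (x : C) : (Cmod x < 1)%R -> 1 - x <> 0.
Proof.
  intros H E. pose proof (Cmod_1_minus x) as K. rewrite E, Cmod_0 in K. lra.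
Qed.

Lemma one_minus_pow_nz (q : C) n : (Cmod q < 1)%R -> 1 - q ^ S n <> 0.
Proof.
  intros H. apply one_minus_nz. rewrite Cmod_pow. apply pow_lt_1.
  split; auto. apply Cmod_ge_0.
Qed.

(** The coefficients [(-1)^n q^(n (n-1) / 2) / (q; q)_n] of [(x; q)_oo], given by the
    recursion that its functional equation imposes. *)
Fixpoint euler (q : C) (n : nat) : C :=
  match n with O => 1 | S m => - q ^ m / (1 - q ^ S m) * euler q m end.

(** Coefficients of [(-r; Q)_oo], which dominate those of [(x; q)_oo] when
    [Q] is the modulus of [q]. *)
Fixpoint reuler (Q : R) (n : nat) : R :=
  match n with O => 1%R | S m => (Q ^ m / (1 - Q ^ S m) * reuler Q m)%R end.

Definition rqinf (Q r : R) : R := Series (fun n => (reuler Q n * r ^ n)%R).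

Lemma reuler_pos Q n : (0 < Q < 1)%R -> (0 < reuler Q n)%R.
Proof.
  intros HQ. induction n as [|n IH]; cbn [reuler]; [lra|].
  apply Rmult_lt_0_compat; auto. apply Rdiv_lt_0_compat.
  - apply pow_lt. lra.
  - pose proof (pow_lt_1 Q n). lra.
Qed.

Lemma euler_reuler (q : C) n : (0 < Cmod q < 1)%R -> (Cmod (euler q n) <= reuler (Cmod q) n)%R.
Proof.
  intros Hq. induction n as [|n IH]; cbn [euler reuler]; [rewrite Cmod_1; lra|].
  pose proof (pow_lt_1 (Cmod q) n ltac:(lra)) as H.
  rewrite Cmod_mult, Cmod_div, Cmod_opp, Cmod_pow by (apply one_minus_pow_nz; lra).
  apply Rmult_le_compat; auto using Cmod_ge_0.
  - apply Rdiv_le_0_compat; [apply pow_le, Cmod_ge_0|].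
    pose proof (Cmod_1_minus (q ^ S n)). rewrite Cmod_pow in H0. lra.
  - apply Rmult_le_compat_l; [apply pow_le, Cmod_ge_0|].
    apply Rinv_le_contravar; [lra|]. rewrite <- Cmod_pow. apply Cmod_1_minus.
Qed.

Lemma is_lim_seq_pow0 (Q : R) : (0 <= Q < 1)%R -> is_lim_seq (fun n => Q ^ n)%R 0%R.
Proof. intros H. apply is_lim_seq_geom. rewrite Rabs_pos_eq; lra. Qed.

Lemma reuler_ex Q r : (0 < Q < 1)%R -> (0 <= r)%R -> ex_series (fun n => (reuler Q n * r ^ n)%R).
Proof.
  intros HQ Hr.
  apply (@ex_series_le R_AbsRing R_CompleteNormedModule _ (fun n => Rabs (reuler Q n * (r + 1) ^ n)%R)).
  - intros n. change norm with Rabs. pose proof (reuler_pos Q n HQ).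
    rewrite !Rabs_pos_eq.
    + apply Rmult_le_compat_l; [lra|]. apply pow_incr. lra.
    + apply Rmult_le_pos; [lra|]. apply pow_le. lra.
    + apply Rmult_le_pos; [lra|]. apply pow_le. lra.
  - assert (P : forall n, (0 < reuler Q n * (r + 1) ^ n)%R).
    { intros n. apply Rmult_lt_0_compat; [now apply reuler_pos|apply pow_lt; lra]. }
    apply ex_series_DAlembert with 0%R; [lra| |].
    + intros n. specialize (P n). lra.
    + apply is_lim_seq_ext with (fun n => (Q ^ n * ((r + 1) / (1 - Q ^ S n)))%R).
      * intros n. rewrite Rabs_pos_eq.
        2:{ apply Rlt_le, Rdiv_lt_0_compat; apply P. }
        cbn [reuler pow]. pose proof (reuler_pos Q n HQ).
        pose proof (pow_lt_1 Q n ltac:(lra)). simpl in H0.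
        assert (0 < (r + 1) ^ n)%R by (apply pow_lt; lra).
        field. repeat split; lra.
      * replace (Finite 0) with (Finite (0 * ((r + 1) / (1 - 0)))) by (f_equal; ring).
        apply is_lim_seq_mult'.
        -- apply is_lim_seq_pow0. lra.
        -- apply is_lim_seq_div'; [apply is_lim_seq_const| |lra].
           apply is_lim_seq_minus'; [apply is_lim_seq_const|].
           apply -> (is_lim_seq_incr_1 (fun n => Q ^ n)%R). apply is_lim_seq_pow0. lra.
Qed.

Lemma rqinf_rec Q r : (0 < Q < 1)%R -> (0 <= r)%R ->
  rqinf Q r = ((1 + r) * rqinf Q (Q * r))%R.
Proof.
  intros HQ Hr. unfold rqinf.
  pose proof (reuler_ex Q r HQ Hr) as H.
  assert (Hr' : (0 <= Q * r)%R) by nra.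
  pose proof (reuler_ex Q _ HQ Hr') as H'.
  assert (E : Series (fun n => (reuler Q n * r ^ n - reuler Q n * (Q * r) ^ n)%R)
          = (r * Series (fun n => (reuler Q n * (Q * r) ^ n)%R))%R).
  { rewrite Series_incr_1 by (apply (@ex_series_minus R_AbsRing R_NormedModule); auto).
    rewrite <- Series_scal_l. cbn [reuler pow].
    replace (1 * 1 - 1 * 1)%R with 0%R by ring. rewrite Rplus_0_l.
    apply Series_ext. intros n. rewrite Rpow_mult_distr.
    pose proof (pow_lt_1 Q n ltac:(lra)). simpl in H0. field. lra. }
  rewrite Series_minus in E by auto. lra.
Qed.

Lemma rqinf_ge_1 Q r : (0 < Q < 1)%R -> (0 <= r)%R -> (1 <= rqinf Q r)%R.
Proof.
  intros HQ Hr. unfold rqinf. rewrite Series_incr_1 by now apply reuler_ex. simpl.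
  assert (0 <= Series (fun n => (Q ^ n / (1 - Q * Q ^ n) * reuler Q n * (r * r ^ n))%R))%R; [|lra].
  pose proof (reuler_ex Q r HQ Hr) as H. apply ex_series_incr_1 in H.
  match goal with |- (0 <= Series ?u)%R =>
    replace 0%R with (Series (fun n => 0 * u n)%R) by (rewrite Series_scal_l; ring)
  end.
  apply Series_le; auto. intros n.
  assert (0 <= Q ^ n / (1 - Q * Q ^ n) * reuler Q n * (r * r ^ n))%R; [|lra].
  change (0 <= reuler Q (S n) * r ^ S n)%R.
  apply Rmult_le_pos; [apply Rlt_le; now apply reuler_pos|now apply pow_le].
Qed.

Lemma euler_sum_le (q x : C) : (0 < Cmod q < 1)%R ->
  sum_le (fun n => euler q n * x ^ n) (rqinf (Cmod q) (Cmod x)).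
Proof.
  intros Hq.
  pose proof (reuler_ex (Cmod q) (Cmod x) Hq (Cmod_ge_0 x)) as H.
  assert (K : forall n, (0 <= Cmod (euler q n * x ^ n) <= reuler (Cmod q) n * Cmod x ^ n)%R).
  { intros n. split; [apply Cmod_ge_0|]. rewrite Cmod_mult, Cmod_pow.
    apply Rmult_le_compat_r; [apply pow_le, Cmod_ge_0|now apply euler_reuler]. }
  assert (H' : ex_series (fun n => Cmod (euler q n * x ^ n))).
  { apply (@ex_series_le R_AbsRing R_CompleteNormedModule _ (fun n => (reuler (Cmod q) n * Cmod x ^ n)%R)); auto.
    intros n. change norm with Rabs. rewrite Rabs_pos_eq; apply K. }
  eapply sum_le_weaken; [|now apply series_sum_le].
  now apply Series_le.
Qed.

Lemma euler_rec (q x s t : C) : (0 < Cmod q < 1)%R ->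
  has_sum (fun n => euler q n * x ^ n) s ->
  has_sum (fun n => euler q n * (x * q) ^ n) t -> s = (1 - x) * t.
Proof.
  intros Hq Hs Ht.
  assert (H : has_sum (fun n => euler q n * x ^ n - euler q n * (x * q) ^ n) (- x * t)).
  { replace (- x * t) with ((euler q 0 * x ^ 0 - euler q 0 * (x * q) ^ 0) + - x * t) by (simpl; ring).
    apply (has_sum_nat_S (fun n => euler q n * x ^ n - euler q n * (x * q) ^ n)).
    apply has_sum_ext with (fun n => - x * (euler q n * (x * q) ^ n)).
    - intros n. cbn [euler]. rewrite !Cpow_mult_l.
      pose proof (one_minus_pow_nz q n ltac:(lra)).
      rewrite !Cpow_S in *. field. auto.
    - now apply has_sum_scal. }
  assert (E : s - t = - x * t).
  { eapply has_sum_unique; [|exact H]. now apply has_sum_minus. }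
  replace s with (s - t + t) by ring. rewrite E. ring.
Qed.

Lemma pow_diff_le (x y : C) (r : R) n :
  (1 <= r)%R -> (Cmod x <= r)%R -> (Cmod y <= r)%R ->
  (Cmod (x ^ n - y ^ n) <= Cmod (x - y) * (2 * r) ^ n)%R.
Proof.
  intros Hr Hx Hy. induction n as [|n IH].
  - simpl. replace (1 - 1) with (RtoC 0) by ring. rewrite Cmod_0, Rmult_1_r. apply Cmod_ge_0.
  - rewrite !Cpow_S.
    replace (x * x ^ n - y * y ^ n) with (x * (x ^ n - y ^ n) + (x - y) * y ^ n) by ring.
    eapply Rle_trans; [apply Cmod_triangle|]. rewrite !Cmod_mult.
    assert (Cmod (y ^ n) <= (2 * r) ^ n)%R.
    { rewrite Cmod_pow. apply pow_incr. pose proof (Cmod_ge_0 y). lra. }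
    pose proof (Cmod_ge_0 (x - y)). pose proof (Cmod_ge_0 x).
    pose proof (Cmod_ge_0 (x ^ n - y ^ n)).
    assert (0 <= (2 * r) ^ n)%R by (apply pow_le; lra).
    apply Rle_trans with (r * (Cmod (x - y) * (2 * r) ^ n) + Cmod (x - y) * (2 * r) ^ n)%R.
    + apply Rplus_le_compat.
      * apply Rmult_le_compat; auto.
      * apply Rmult_le_compat_l; auto.
    + simpl. set (A := (Cmod (x - y) * (2 * r) ^ n)%R).
      assert (0 <= A)%R by (apply Rmult_le_pos; auto).
      replace (Cmod (x - y) * (2 * r * (2 * r) ^ n))%R with (2 * r * A)%R by (unfold A; ring). nra.
Qed.

(** The Lipschitz constant comes from the same majorant series at twice the radius, the factor
    [n] of the derivative of [x^n] being absorbed in [2^n]. *)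
Lemma euler_lipschitz (q x y s t : C) (r : R) : (0 < Cmod q < 1)%R ->
  (1 <= r)%R -> (Cmod x <= r)%R -> (Cmod y <= r)%R ->
  has_sum (fun n => euler q n * x ^ n) s ->
  has_sum (fun n => euler q n * y ^ n) t ->
  (Cmod (s - t) <= Cmod (x - y) * rqinf (Cmod q) (2 * r))%R.
Proof.
  intros Hq Hr Hx Hy Hs Ht.
  eapply has_sum_bound; [apply has_sum_minus; [exact Hs|exact Ht]|].
  apply sum_le_mono with (fun n => RtoC (reuler (Cmod q) n * (2 * r) ^ n)).
  - apply Cmod_ge_0.
  - intros n. replace (euler q n * x ^ n - euler q n * y ^ n)
      with (euler q n * (x ^ n - y ^ n)) by ring.
    rewrite Cmod_mult, Cmod_R. pose proof (reuler_pos (Cmod q) n Hq).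
    assert (0 <= (2 * r) ^ n)%R by (apply pow_le; lra).
    rewrite Rabs_pos_eq by (apply Rmult_le_pos; lra).
    replace (Cmod (x - y) * (reuler (Cmod q) n * (2 * r) ^ n))%R
      with (reuler (Cmod q) n * (Cmod (x - y) * (2 * r) ^ n))%R by ring.
    apply Rmult_le_compat; auto using Cmod_ge_0, euler_reuler, pow_diff_le.
  - assert (P : forall n, Cmod (RtoC (reuler (Cmod q) n * (2 * r) ^ n)) = (reuler (Cmod q) n * (2 * r) ^ n)%R).
    { intros n. rewrite Cmod_R, Rabs_pos_eq; auto. apply Rmult_le_pos.
      - apply Rlt_le. now apply reuler_pos.
      - apply pow_le. lra. }
    unfold rqinf. rewrite <- (Series_ext _ _ P). apply series_sum_le.
    eapply ex_series_ext; [intros n; symmetry; apply P|].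
    apply reuler_ex; auto. lra.
Qed.

Lemma euler_at_0 (q : C) : has_sum (fun n => euler q n * 0 ^ n) 1.
Proof.
  replace (RtoC 1) with (euler q 0 * 0 ^ 0) by (simpl; ring).
  apply (has_sum_single O (fun n => euler q n * 0 ^ n)).
  intros [|n] H; [congruence|]. simpl. ring.
Qed.

Lemma Clim_pow0 (q x : C) : (Cmod q < 1)%R -> Clim eventually (fun n => x * q ^ n) 0.
Proof.
  intros Hq eps Heps.
  assert (L : is_lim_seq (fun n => (Cmod x * Cmod q ^ n)%R) 0%R).
  { replace (Finite 0) with (Rbar_mult (Cmod x) 0) by (simpl; f_equal; ring).
    apply is_lim_seq_scal_l. apply is_lim_seq_pow0. split; auto. apply Cmod_ge_0. }
  apply is_lim_seq_spec in L. destruct (L (mkposreal eps Heps)) as [N HN].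
  exists N. intros n Hn. specialize (HN n Hn). simpl in HN.
  replace (x * q ^ n - 0) with (x * q ^ n) by ring.
  rewrite Cmod_mult, Cmod_pow. rewrite Rminus_0_r, Rabs_pos_eq in HN; auto.
  apply Rmult_le_pos; [apply Cmod_ge_0|apply pow_le, Cmod_ge_0].
Qed.

(** The functional equation [s(x) = (1 - x) s(x q)] of the Euler series iterates
    to [s(x) = (x; q)_n s(x q^n)], and [s] is continuous at [0] with [s(0) = 1]. *)
Lemma qp_cvg (q x s : C) : (0 < Cmod q < 1)%R ->
  has_sum (fun n => euler q n * x ^ n) s -> Clim eventually (qp x q) s.
Proof.
  intros Hq Hs.
  assert (HE : forall y, exists t, has_sum (fun n => euler q n * y ^ n) t).
  { intros y. eapply sum_le_has_sum. now apply euler_sum_le. }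
  assert (HN : forall n t, has_sum (fun m => euler q m * (x * q ^ n) ^ m) t -> s = qp x q n * t).
  { induction n as [|n IH]; intros t Ht.
    - unfold qp. simpl in *. rewrite Cmult_1_l. apply (has_sum_unique _ _ _ Hs).
      revert Ht. apply has_sum_ext. intros i. now rewrite Cmult_1_r.
    - destruct (HE (x * q ^ n)) as [t' Ht'].
      rewrite (IH _ Ht'), qp_S, <- Cmult_assoc. f_equal.
      apply euler_rec with q; auto. revert Ht. apply has_sum_ext. intros i.
      rewrite Cpow_S. do 2 f_equal. ring. }
  intros eps Heps.
  set (K := rqinf (Cmod q) (2 * 1)).
  assert (HK : (1 <= K)%R) by (apply rqinf_ge_1; auto; lra).
  set (M := (Cmod s + 1)%R). pose proof (Cmod_ge_0 s).
  set (d := Rmin (/ (2 * K)) (eps / (4 * K * M))).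
  assert (Hd : (0 < d)%R).
  { apply Rmin_pos; [apply Rinv_0_lt_compat; lra|].
    apply Rdiv_lt_0_compat; auto. unfold M. apply Rmult_lt_0_compat; lra. }
  generalize (Clim_pow0 q x ltac:(lra) d Hd). apply filter_imp. intros n Hn.
  replace (x * q ^ n - 0) with (x * q ^ n) in Hn by ring.
  destruct (HE (x * q ^ n)) as [t Ht].
  assert (Hd1 : (d * K <= / 2)%R).
  { apply Rle_trans with (/ (2 * K) * K)%R.
    - apply Rmult_le_compat_r; [lra|apply Rmin_l].
    - right. field. lra. }
  assert (Hd2 : (d * K * M <= eps / 4)%R).
  { apply Rle_trans with (eps / (4 * K * M) * K * M)%R.
    - apply Rmult_le_compat_r; [unfold M; lra|]. apply Rmult_le_compat_r; [lra|apply Rmin_r].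
    - right. field. unfold M. lra. }
  assert (HL : (Cmod (t - 1) <= Cmod (x * q ^ n) * K)%R).
  { replace (Cmod (x * q ^ n)) with (Cmod (x * q ^ n - 0)) by (f_equal; ring).
    apply euler_lipschitz; auto; try lra.
    - assert (d <= 1)%R; [|lra]. nra.
    - rewrite Cmod_0. lra.
    - apply euler_at_0. }
  assert (HL' : (Cmod (t - 1) < d * K)%R).
  { eapply Rle_lt_trans; [exact HL|]. apply Rmult_lt_compat_r; lra. }
  assert (Ht1 : (/ 2 < Cmod t)%R).
  { pose proof (Cmod_1_minus (1 - t)). replace (1 - (1 - t)) with t in H0 by ring.
    replace (1 - t) with (- (t - 1)) in H0 by ring. rewrite Cmod_opp in H0. lra. }
  assert (Ht0 : t <> 0) by (apply Cmod_gt_0; lra).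
  specialize (HN n t Ht).
  replace (qp x q n - s) with (- (t - 1) * s * / t).
  2:{ rewrite HN. field. auto. }
  rewrite !Cmod_mult, Cmod_opp, Cmod_inv by auto.
  apply Rle_lt_trans with (d * K * M * 2)%R; [|lra].
  apply Rmult_le_compat.
  - apply Rmult_le_pos; apply Cmod_ge_0.
  - apply Rlt_le, Rinv_0_lt_compat. lra.
  - apply Rmult_le_compat; auto using Cmod_ge_0; unfold M; lra.
  - replace 2%R with (/ / 2)%R by field. apply Rinv_le_contravar; lra.
Qed.

Lemma qpoch_inf_lim (q x s : C) : Clim eventually (qp x q) s -> qpoch_inf x q = s.
Proof.
  intros H. apply (@iota_filterlim_locally C_AbsRing C_CompleteNormedModule nat eventually _).
  now apply (Clim_filterlim eventually _).
Qed.

Lemma qinf_euler (q x : C) : (0 < Cmod q < 1)%R ->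
  has_sum (fun n => euler q n * x ^ n) (qpoch_inf x q).
Proof.
  intros Hq. destruct (sum_le_has_sum _ _ (euler_sum_le q x Hq)) as [s Hs].
  now rewrite (qpoch_inf_lim q x s (qp_cvg q x s Hq Hs)).
Qed.

Lemma qinf_cvg (q x : C) : (0 < Cmod q < 1)%R -> Clim eventually (qp x q) (qpoch_inf x q).
Proof. intros Hq. apply qp_cvg; auto. now apply qinf_euler. Qed.

Lemma qinf_rec (q x : C) : (0 < Cmod q < 1)%R ->
  qpoch_inf x q = (1 - x) * qpoch_inf (x * q) q.
Proof. intros Hq. apply euler_rec with q; auto; now apply qinf_euler. Qed.

Lemma qinf_split (q x : C) n : (0 < Cmod q < 1)%R ->
  qpoch_inf x q = qp x q n * qpoch_inf (x * q ^ n) q.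
Proof.
  intros Hq. induction n as [|n IH].
  - unfold qp. simpl. rewrite Cmult_1_r. ring.
  - rewrite IH, qp_S, (qinf_rec q (x * q ^ n)) by auto. rewrite Cpow_S.
    replace (x * q ^ n * q) with (x * (q * q ^ n)) by ring. ring.
Qed.

Lemma qinf_lipschitz (q x y : C) (r : R) : (0 < Cmod q < 1)%R ->
  (1 <= r)%R -> (Cmod x <= r)%R -> (Cmod y <= r)%R ->
  (Cmod (qpoch_inf x q - qpoch_inf y q) <= Cmod (x - y) * rqinf (Cmod q) (2 * r))%R.
Proof. intros. apply euler_lipschitz; auto; now apply qinf_euler. Qed.

Lemma qinf_0 (q : C) : (0 < Cmod q < 1)%R -> qpoch_inf 0 q = 1.
Proof.
  intros Hq. eapply has_sum_unique; [now apply qinf_euler|apply euler_at_0].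
Qed.

Lemma qinf_continuous {T : Type} (F : (T -> Prop) -> Prop) (FF : Filter F)
  (q : C) (f : T -> C) (l : C) : (0 < Cmod q < 1)%R ->
  Clim F f l -> Clim F (fun t => qpoch_inf (f t) q) (qpoch_inf l q).
Proof.
  intros Hq H eps Heps.
  pose proof (Cmod_ge_0 l).
  set (K := rqinf (Cmod q) (2 * (Cmod l + 1))).
  assert (HK : (1 <= K)%R) by (apply rqinf_ge_1; auto; lra).
  assert (Hd : (0 < eps / K)%R) by (apply Rdiv_lt_0_compat; lra).
  generalize (filter_and _ _ (H _ Hd) (Cmod_le_1plus F FF f l H)). apply filter_imp.
  intros t [A B]. eapply Rle_lt_trans.
  - apply (qinf_lipschitz q _ _ (Cmod l + 1)); auto; lra.
  - fold K. apply Rlt_le_trans with (eps / K * K)%R.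
    + apply Rmult_lt_compat_r; lra.
    + right. field. lra.
Qed.

Lemma qinf_nz (q x : C) : (0 < Cmod q < 1)%R -> nonzero_factors q x -> qpoch_inf x q <> 0.
Proof.
  intros Hq H.
  assert (L : Clim eventually (fun n => qpoch_inf (x * q ^ n) q) 1).
  { rewrite <- (qinf_0 q Hq). apply qinf_continuous; auto; [apply eventually_filter|].
    apply Clim_pow0. lra. }
  destruct (L 1%R Rlt_0_1) as [N HN]. specialize (HN N (le_n N)).
  rewrite (qinf_split q x N Hq). apply Cmult_neq_0; [now apply qp_nz|].
  intros E. rewrite E in HN. replace (0 - 1) with (- (1)) in HN by ring.
  rewrite Cmod_m1 in HN. lra.
Qed.

Lemma qinf_zero (q x : C) n : (0 < Cmod q < 1)%R -> 1 - x * q ^ n = 0 -> qpoch_inf x q = 0.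
Proof.
  intros Hq H. rewrite (qinf_split q x (S n) Hq), qp_S, H. ring.
Qed.

Lemma qinf_bound (q x : C) : (0 < Cmod q < 1)%R ->
  (Cmod (qpoch_inf x q) <= rqinf (Cmod q) (Cmod x))%R.
Proof.
  intros Hq. eapply has_sum_bound; [now apply qinf_euler|now apply euler_sum_le].
Qed.

Lemma rqinf_pow (Q r : R) n : (0 < Q < 1)%R -> (0 <= r)%R -> (rqinf Q (Q ^ n * r) <= rqinf Q r)%R.
Proof.
  intros HQ Hr. induction n as [|n IH]; [simpl; rewrite Rmult_1_l; lra|].
  eapply Rle_trans; [|exact IH].
  assert (P : (0 <= Q ^ n * r)%R) by (apply Rmult_le_pos; auto; apply pow_le; lra).
  rewrite (rqinf_rec Q (Q ^ n * r)) by auto.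
  replace (Q ^ S n * r)%R with (Q * (Q ^ n * r))%R by (simpl; ring).
  assert (P' : (0 <= Q * (Q ^ n * r))%R) by (apply Rmult_le_pos; lra).
  pose proof (rqinf_ge_1 Q _ HQ P'). nra.
Qed.

Lemma qp_bound (q x : C) n : (0 < Cmod q < 1)%R -> (Cmod (qp x q n) <= rqinf (Cmod q) (Cmod x))%R.
Proof.
  intros Hq. pose proof (Cmod_ge_0 x) as Hx.
  assert (H : (Cmod (qp x q n) * rqinf (Cmod q) (Cmod q ^ n * Cmod x) <= rqinf (Cmod q) (Cmod x))%R).
  { induction n as [|n IH].
    - unfold qp. simpl. rewrite Cmod_1, !Rmult_1_l. lra.
    - eapply Rle_trans; [|exact IH]. rewrite qp_S, Cmod_mult.
      assert (P : (0 <= Cmod q ^ n * Cmod x)%R) by (apply Rmult_le_pos; auto; apply pow_le; lra).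
      rewrite (rqinf_rec (Cmod q) (Cmod q ^ n * Cmod x)) by auto.
      replace (Cmod q ^ S n * Cmod x)%R with (Cmod q * (Cmod q ^ n * Cmod x))%R by (simpl; ring).
      rewrite Rmult_assoc. apply Rmult_le_compat_l; [apply Cmod_ge_0|].
      apply Rmult_le_compat_r.
      + pose proof (rqinf_ge_1 (Cmod q) (Cmod q * (Cmod q ^ n * Cmod x)) Hq).
        assert (0 <= Cmod q * (Cmod q ^ n * Cmod x))%R by (apply Rmult_le_pos; lra). lra.
      + eapply Rle_trans; [apply (Cmod_triangle 1 (- (x * q ^ n)))|].
        rewrite Cmod_opp, Cmod_mult, Cmod_1, Cmod_pow. lra. }
  eapply Rle_trans; [|exact H].
  assert (P : (0 <= Cmod q ^ n * Cmod x)%R) by (apply Rmult_le_pos; auto; apply pow_le; lra).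
  pose proof (rqinf_ge_1 (Cmod q) _ Hq P). pose proof (Cmod_ge_0 (qp x q n)). nra.
Qed.

(** The reciprocal of [(x; q)_n] is [(x q^n; q)_oo / (x; q)_oo], with a numerator bounded in [n]. *)
Lemma qp_inv_bound (q x : C) n : (0 < Cmod q < 1)%R -> nonzero_factors q x ->
  (Cmod (/ qp x q n) <= rqinf (Cmod q) (Cmod x) / Cmod (qpoch_inf x q))%R.
Proof.
  intros Hq Hx. pose proof (qinf_nz q x Hq Hx) as H1. pose proof (qp_nz x q n Hx) as H2.
  assert (P : (0 < Cmod (qpoch_inf x q))%R) by now apply Cmod_gt_0.
  replace (/ qp x q n) with (qpoch_inf (x * q ^ n) q * / qpoch_inf x q).
  2:{ rewrite (qinf_split q x n Hq) in H1 |- *. field. split; auto.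
      intros E. apply H1. rewrite E. ring. }
  rewrite Cmod_mult, Cmod_inv by auto.
  apply Rmult_le_compat_r; [apply Rlt_le, Rinv_0_lt_compat; auto|].
  eapply Rle_trans; [now apply qinf_bound|].
  rewrite Cmod_mult, Cmod_pow, Rmult_comm. apply rqinf_pow; auto. apply Cmod_ge_0.
Qed.

Lemma nonzero_factors_q (q : C) : (0 < Cmod q < 1)%R -> nonzero_factors q q.
Proof. intros Hq i. apply (one_minus_pow_nz q i). lra. Qed.

(** * Jacobi's triple product *)

(** Triangular numbers for integer index, the exponents of the theta series. *)
Definition tri (n : Z) : Z := (n * (n - 1) / 2)%Z.

Lemma tri_spec n : (2 * tri n = n * (n - 1))%Z.
Proof.
  unfold tri. rewrite <- Z.divide_div_mul_exact; [|lia|].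
  - rewrite Z.mul_comm. apply Z.div_mul. lia.
  - destruct (Z.Even_or_Odd n) as [[m ->]|[m ->]].
    + exists (m * (2 * m - 1))%Z. ring.
    + exists ((2 * m + 1) * m)%Z. ring.
Qed.

Lemma tri_add m n : tri (m + n) = (tri m + tri n + m * n)%Z.
Proof. pose proof (tri_spec m). pose proof (tri_spec n). pose proof (tri_spec (m + n)). nia. Qed.

Lemma tri_succ n : tri (n + 1) = (tri n + n)%Z.
Proof. rewrite tri_add. change (tri 1) with 0%Z. ring. Qed.

Lemma gauss_sum_le_nat (q y : C) : (0 < Cmod q < 1)%R -> y <> 0 ->
  exists B, sum_le (fun n : nat => Czpow q (Z.of_nat n * Z.of_nat n) * Czpow y (Z.of_nat n)) B.
Proof.
  intros Hq Hy. pose proof (Cmod_q_nz q Hq) as Hq0.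
  apply sum_le_ratio with 0%R; [lra| |].
  - intros n. apply Cmult_neq_0; now apply Czpow_nz.
  - apply is_lim_seq_ext with (fun n => (Cmod (q * y) * (Cmod q * Cmod q) ^ n)%R).
    + intros n.
      replace (Z.of_nat (S n) * Z.of_nat (S n))%Z
        with (Z.of_nat n * Z.of_nat n + (1 + Z.of_nat n + Z.of_nat n))%Z by lia.
      replace (Z.of_nat (S n)) with (Z.of_nat n + 1)%Z by lia.
      rewrite !Czpow_add, !Czpow_1_r, (Czpow_nat q n) by auto.
      rewrite Rpow_mult_distr, !Cmod_mult, Cmod_pow.
      field. split; apply Rgt_not_eq, Cmod_gt_0; now apply Czpow_nz.
    + replace (Finite 0) with (Rbar_mult (Cmod (q * y)) 0) by (simpl; f_equal; ring).
      apply is_lim_seq_scal_l, is_lim_seq_pow0. nra.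
Qed.

Lemma gauss_sum_le (q y : C) : (0 < Cmod q < 1)%R -> y <> 0 ->
  exists B, sum_le (fun k : Z => Czpow q (k * k) * Czpow y k) B.
Proof.
  intros Hq Hy.
  destruct (gauss_sum_le_nat q y Hq Hy) as [A HA].
  destruct (gauss_sum_le_nat q (/ y) Hq (Cinv_nz y Hy)) as [B HB].
  exists (A + B)%R. apply bilateral_sum_le; auto.
  apply (sum_le_comp S _ _ eq_add_S) in HB. revert HB. apply sum_le_dom. intros n.
  rewrite Czpow_inv by auto. right. do 3 f_equal.
Qed.

(** On the even and on the odd indices the triangular exponent is a square up to linear terms,
    so that [gauss_sum_le] applies. *)
Lemma theta_sum_le (q z : C) : (0 < Cmod q < 1)%R -> z <> 0 ->
  exists B, sum_le (fun n : Z => Czpow (- z) n * Czpow q (tri n)) B.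
Proof.
  intros Hq Hz. pose proof (Cmod_q_nz q Hq) as Hq0.
  assert (Hq2 : (0 < Cmod (q * q) < 1)%R) by (rewrite Cmod_mult; nra).
  assert (Hmz : - z <> 0) by (intros E; apply Hz; replace z with (- - z) by ring; rewrite E; ring).
  assert (K : forall r : Z, exists B, sum_le (fun k : Z =>
     Czpow (- z) (2 * k + r) * Czpow q (tri (2 * k + r))) B).
  { intros r.
    set (y := (Czpow (- z) 2 * Czpow q (2 * r - 1))).
    assert (Hy : y <> 0) by (apply Cmult_neq_0; now apply Czpow_nz).
    destruct (gauss_sum_le (q * q) y Hq2 Hy) as [B HB].
    exists (Cmod (Czpow (- z) r * Czpow q (tri r)) * B)%R. revert HB.
    apply sum_le_mono; [apply Cmod_ge_0|]. intros k. rewrite <- Cmod_mult. right. f_equal.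
    replace (tri (2 * k + r)) with (tri r + (2 * (k * k) + (2 * r - 1) * k))%Z.
    2:{ rewrite tri_add. pose proof (tri_spec (2 * k)). nia. }
    unfold y. replace (q * q) with (Czpow q 2) by (simpl; ring).
    rewrite !Czpow_add, Czpow_mult_l, <- !Czpow_mult_r by (auto; now apply Czpow_nz). ring. }
  destruct (K 0%Z) as [A HA]. destruct (K 1%Z) as [B HB]. exists (A + B)%R.
  set (u := fun n : Z => Czpow (- z) n * Czpow q (tri n)).
  assert (S1 : sum_le (fun n => if Z.even n then u n else 0) A).
  { apply (sum_le_inj (fun k => 2 * k + 0)%Z).
    - intros; lia.
    - intros j. destruct (Z.even j) eqn:E; auto. left. apply Z.even_spec in E.
      destruct E as [m ->]. exists m. lia.
    - revert HA. apply sum_le_dom. intros k.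
      destruct (Z.even (2 * k + 0)); [unfold u; lra|]. rewrite Cmod_0. apply Cmod_ge_0. }
  assert (S2 : sum_le (fun n => if Z.even n then 0 else u n) B).
  { apply (sum_le_inj (fun k => 2 * k + 1)%Z).
    - intros; lia.
    - intros j. destruct (Z.even j) eqn:E; auto. left.
      destruct (Z.Even_or_Odd j) as [H|[m ->]].
      + apply Z.even_spec in H. congruence.
      + exists m. lia.
    - revert HB. apply sum_le_dom. intros k.
      destruct (Z.even (2 * k + 1)); [rewrite Cmod_0; apply Cmod_ge_0|unfold u; lra]. }
  generalize (sum_le_plus _ _ _ _ S1 S2). apply sum_le_dom. intros n.
  right. f_equal. fold (u n). destruct (Z.even n); ring.
Qed.

Lemma euler_closed (q : C) m : (0 < Cmod q < 1)%R ->
  euler q m * qp q q m = (- (1)) ^ m * Czpow q (tri (Z.of_nat m)).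
Proof.
  intros Hq. pose proof (Cmod_q_nz q Hq) as Hq0.
  induction m as [|m IH].
  { change (tri (Z.of_nat 0)) with 0%Z. unfold qp. simpl. ring. }
  cbn [euler]. rewrite qp_S. replace (Z.of_nat (S m)) with (Z.of_nat m + 1)%Z by lia.
  rewrite tri_succ, Czpow_add, Czpow_nat, Cpow_S by auto.
  transitivity (- q ^ m * (euler q m * qp q q m)).
  - pose proof (one_minus_pow_nz q m ltac:(lra)) as H. rewrite Cpow_S in *. field. auto.
  - rewrite IH, Cpow_S. ring.
Qed.

Lemma Clim_of_bound (q : C) (f : nat -> C) (l : C) (K : R) : (Cmod q < 1)%R ->
  (forall n, (Cmod (f n - l) <= K * Cmod q ^ n)%R) -> Clim eventually f l.
Proof.
  intros Hq H eps Heps. generalize (Clim_pow0 q (RtoC K) Hq eps Heps). apply filter_imp.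
  intros n Hn. eapply Rle_lt_trans; [apply H|]. eapply Rle_lt_trans; [|exact Hn].
  replace (K * q ^ n - 0) with (K * q ^ n) by ring. rewrite Cmod_mult, Cmod_pow, Cmod_R.
  apply Rmult_le_compat_r; [apply pow_le, Cmod_ge_0|apply Rle_abs].
Qed.

(** Euler's other expansion: [G(y) = sum y^m / (q; q)_m] satisfies
    [G(y q) = (1 - y) G(y)], so that [(y; q)_n G(y) = G(y q^n)] tends to [1]. *)
Lemma euler_inv (q y : C) : (0 < Cmod q < 1)%R -> (Cmod y < 1)%R ->
  exists G B, sum_le (fun m => y ^ m / qp q q m) B
    /\ has_sum (fun m => y ^ m / qp q q m) G /\ G * qpoch_inf y q = 1.
Proof.
  intros Hq Hy.
  pose proof (nonzero_factors_q q Hq) as Hqq.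
  set (K := (rqinf (Cmod q) (Cmod q) / Cmod (qpoch_inf q q))%R).
  assert (HK : (0 <= K)%R).
  { eapply Rle_trans; [apply Cmod_ge_0|]. apply (qp_inv_bound q q O Hq Hqq). }
  assert (HE : forall t, (Cmod t < 1)%R -> exists B, sum_le (fun m => t ^ m / qp q q m) B).
  { intros t Ht. apply sum_le_geom with K (Cmod t).
    - split; auto. apply Cmod_ge_0.
    - intros m. unfold Cdiv. rewrite Cmod_mult, Cmod_pow, Rmult_comm.
      apply Rmult_le_compat_r; [apply pow_le, Cmod_ge_0|]. now apply qp_inv_bound. }
  assert (Hyn : forall n, (Cmod (y * q ^ n) <= Cmod y)%R).
  { intros n. rewrite Cmod_mult, Cmod_pow. rewrite <- (Rmult_1_r (Cmod y)) at 2.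
    apply Rmult_le_compat_l; [apply Cmod_ge_0|]. rewrite <- (pow1 n). apply pow_incr. lra. }
  destruct (HE y Hy) as [B HB]. destruct (sum_le_has_sum _ _ HB) as [G HG].
  exists G, B. split; [|split]; auto.
  assert (Hrec : forall t s s', has_sum (fun m => t ^ m / qp q q m) s ->
            has_sum (fun m => (t * q) ^ m / qp q q m) s' -> (1 - t) * s = s').
  { intros t s s' Hs Hs'.
    assert (E : s - s' = t * s).
    { eapply has_sum_unique; [apply has_sum_minus; [exact Hs|exact Hs']|].
      replace (t * s) with ((t ^ 0 / qp q q 0 - (t * q) ^ 0 / qp q q 0) + t * s) by (simpl; ring).
      apply (has_sum_nat_S (fun m => t ^ m / qp q q m - (t * q) ^ m / qp q q m)).
      eapply has_sum_ext; [|apply has_sum_scal, Hs]. intros m. simpl.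
      rewrite qp_S. pose proof (qp_nz q q m Hqq). pose proof (Hqq m).
      rewrite Cpow_mult_l. field. auto. }
    replace s' with (s - (s - s')) by ring. rewrite E. ring. }
  assert (HGn : forall n t, has_sum (fun m => (y * q ^ n) ^ m / qp q q m) t -> G * qp y q n = t).
  { induction n as [|n IH]; intros t Ht.
    - unfold qp. simpl Cprod. rewrite Cmult_1_r. apply (has_sum_unique _ _ _ HG).
      revert Ht. apply has_sum_ext. intros m. simpl. now rewrite Cmult_1_r.
    - destruct (HE (y * q ^ n)) as [B' HB']; [pose proof (Hyn n); lra|].
      destruct (sum_le_has_sum _ _ HB') as [t' Ht'].
      rewrite qp_S, Cmult_assoc, (IH t' Ht').
      rewrite Cmult_comm. apply Hrec; auto.
      revert Ht. apply has_sum_ext. intros m. rewrite Cpow_S.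
      replace (y * (q * q ^ n)) with (y * q ^ n * q) by ring. auto. }
  apply (Clim_unique eventually _ (fun n => G * qp y q n)).
  - apply Clim_scal; [apply eventually_filter|]. now apply qinf_cvg.
  - assert (HE' : exists B', sum_le (fun m => y ^ m / qp q q (S m)) B').
    { apply sum_le_geom with K (Cmod y).
      - split; auto. apply Cmod_ge_0.
      - intros m. unfold Cdiv. rewrite Cmod_mult, Cmod_pow, Rmult_comm.
        apply Rmult_le_compat_r; [apply pow_le, Cmod_ge_0|]. now apply qp_inv_bound. }
    destruct HE' as [B' HB'].
    apply Clim_of_bound with q (Cmod y * B')%R; [lra|]. intros n.
    assert (HD : sum_le (fun m => (y * q ^ n) ^ m / qp q q (S m)) B').
    { revert HB'. apply sum_le_dom. intros m. unfold Cdiv. rewrite !Cmod_mult, !(Cmod_pow _ m).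
      apply Rmult_le_compat_r; [apply Cmod_ge_0|]. apply pow_incr.
      split; [apply Cmod_ge_0|apply Hyn]. }
    destruct (sum_le_has_sum _ _ HD) as [t Ht].
    rewrite (HGn n (1 + y * q ^ n * t)).
    + replace (1 + y * q ^ n * t - 1) with (y * q ^ n * t) by ring.
      rewrite !Cmod_mult, Cmod_pow.
      pose proof (has_sum_bound _ _ _ Ht HD).
      replace (Cmod y * B' * Cmod q ^ n)%R with (Cmod y * Cmod q ^ n * B')%R by ring.
      apply Rmult_le_compat_l; auto.
      apply Rmult_le_pos; [apply Cmod_ge_0|apply pow_le, Cmod_ge_0].
    + replace (RtoC 1) with ((y * q ^ n) ^ 0 / qp q q 0) at 1 by (unfold qp; simpl; field).
      apply (has_sum_nat_S (fun m => (y * q ^ n) ^ m / qp q q m)).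
      eapply has_sum_ext; [|apply has_sum_scal, Ht]. intros m. simpl. unfold Cdiv. ring.
Qed.

Definition theta (q z : C) : C := qpoch_inf z q * qpoch_inf (q / z) q.

Lemma theta_shift (q z : C) : (0 < Cmod q < 1)%R -> z <> 0 ->
  theta q (z * q) = - theta q z / z.
Proof.
  intros Hq Hz. pose proof (Cmod_q_nz q Hq). unfold theta.
  rewrite (qinf_rec q z) by auto. rewrite (qinf_rec q (q / (z * q))) by auto.
  replace (q / (z * q) * q) with (q / z) by (field; auto). field. auto.
Qed.

Definition theta_term (q z : C) (n : Z) : C := Czpow (- z) n * Czpow q (tri n).

(** For [|q| < |z|], expand [(q; q)_oo (z; q)_oo], whose [n]-th coefficient
    contains [(q^(n+1); q)_oo] and so vanishes for [n < 0], once more by Euler,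
    and sum along [n + m] instead of [n]. *)
Lemma jacobi_large (q z : C) : (0 < Cmod q < 1)%R -> (Cmod q < Cmod z)%R ->
  has_sum (theta_term q z) (qpoch_inf q q * theta q z).
Proof.
  intros Hq Hz. pose proof (Cmod_q_nz q Hq) as Hq0.
  assert (Hz0 : z <> 0) by (apply Cmod_gt_0; lra).
  pose proof (Copp_nz z Hz0) as Hmz.
  pose proof (nonzero_factors_q q Hq) as Hqq.
  assert (Hy : (Cmod (q / z) < 1)%R).
  { rewrite Cmod_div by auto. apply Rmult_lt_reg_r with (Cmod z); [lra|].
    unfold Rdiv. rewrite Rmult_assoc, Rinv_l; lra. }
  destruct (euler_inv q (q / z) Hq Hy) as [G [B [HB [HG HG1]]]].
  destruct (theta_sum_le q z Hq Hz0) as [A HA].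
  destruct (sum_le_has_sum _ _ HA) as [V HV].
  pose proof (sum_le_prod _ _ _ _ HA HB) as HP.
  pose proof (has_sum_prod _ _ _ _ _ _ HA HB HV HG) as HS.
  set (w := fun p : Z * nat => Czpow (- z) (fst p) * Czpow q (tri (fst p))
                               * ((q / z) ^ snd p / qp q q (snd p))) in *.
  set (g := fun p : Z * nat => ((fst p + Z.of_nat (snd p))%Z, snd p)).
  set (h := fun p : Z * nat => ((fst p - Z.of_nat (snd p))%Z, snd p)).
  assert (Hgh : forall p, g (h p) = p) by (intros [n m]; unfold g, h; simpl; f_equal; lia).
  assert (Hhg : forall p, h (g p) = p) by (intros [n m]; unfold g, h; simpl; f_equal; lia).
  apply (has_sum_bij g h) in HS; auto.
  apply (sum_le_comp g) in HP.
  2:{ intros i i' E. rewrite <- (Hhg i), <- (Hhg i'). congruence. }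
  destruct (fubini _ _ (fun n => theta_term q z n * qpoch_inf (Czpow q (n + 1)) q) (V * G) HP) as [HR _].
  - intros n. apply has_sum_ext with (fun m => theta_term q z n * (euler q m * Czpow q (n + 1) ^ m)).
    + intros m. unfold g, w, theta_term. cbn [fst snd].
      rewrite tri_add, !Czpow_add, Czpow_1_r by auto.
      rewrite (Czpow_mult_r q n), !Czpow_nat by auto.
      assert (E : euler q m = (- (1)) ^ m * Czpow q (tri (Z.of_nat m)) / qp q q m).
      { rewrite <- euler_closed by auto. field. now apply qp_nz. }
      rewrite E. replace ((- z) ^ m) with ((- (1)) ^ m * z ^ m)
        by (rewrite <- Cpow_mult_l; f_equal; ring).
      replace ((q / z) ^ m) with (q ^ m / z ^ m).
      2:{ unfold Cdiv. now rewrite Cpow_mult_l, Cpow_inv. }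
      rewrite Cpow_mult_l. field. split; [now apply Cpow_nz|now apply qp_nz].
    + apply has_sum_scal. now apply qinf_euler.
  - exact HS.
  - assert (HR' : has_sum (fun n => theta_term q z n * qpoch_inf (Czpow q (n + 1)) q)
                     (qpoch_inf q q * qpoch_inf z q)).
    { apply (has_sum_inj Z.of_nat); [intros; lia| |].
      - intros j. destruct (Z_le_dec 0 j) as [H|H].
        + left. exists (Z.to_nat j). lia.
        + right. rewrite (qinf_zero q _ (Z.to_nat (- (j + 1)))); [ring|auto|].
          rewrite <- Czpow_nat, <- Czpow_add by auto.
          replace (j + 1 + Z.of_nat (Z.to_nat (- (j + 1))))%Z with 0%Z by lia. simpl. ring.
      - eapply has_sum_ext; [|apply has_sum_scal, (qinf_euler q z Hq)].
        intros n. simpl. unfold theta_term.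
        replace (Z.of_nat n + 1)%Z with (Z.of_nat (S n)) by lia. rewrite !Czpow_nat.
        rewrite (qinf_split q q n Hq), Cpow_S.
        replace ((- z) ^ n) with ((- (1)) ^ n * z ^ n)
          by (rewrite <- Cpow_mult_l; f_equal; ring).
        transitivity ((euler q n * qp q q n) * z ^ n * qpoch_inf (q * q ^ n) q); [ring|].
        rewrite euler_closed by auto. ring. }
    pose proof (has_sum_unique _ _ _ HR HR') as E.
    replace (qpoch_inf q q * theta q z) with V; auto. unfold theta.
    rewrite Cmult_assoc, <- E. rewrite <- Cmult_assoc, HG1. ring.
Qed.

(** Both sides are multiplied by [-1/z] when [z] is replaced by [z q], which extends
    [jacobi_large] to all [z]. *)
Lemma jacobi (q z : C) : (0 < Cmod q < 1)%R -> z <> 0 ->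
  has_sum (theta_term q z) (qpoch_inf q q * theta q z).
Proof.
  intros Hq Hz. pose proof (Cmod_q_nz q Hq) as Hq0.
  assert (H : exists n, (Cmod q ^ n * Cmod q < Cmod z)%R).
  { destruct (Clim_pow0 q q ltac:(lra) (Cmod z)) as [n Hn]; [now apply Cmod_gt_0|].
    exists n. specialize (Hn n (le_n n)).
    replace (q * q ^ n - 0) with (q * q ^ n) in Hn by ring.
    rewrite Cmod_mult, Cmod_pow in Hn. lra. }
  destruct H as [n Hn]. revert z Hz Hn. induction n as [|n IH]; intros z Hz Hn.
  - apply jacobi_large; auto. simpl in Hn. lra.
  - assert (Hz' : z / q <> 0) by (apply Cmult_neq_0; auto; now apply Cinv_nz).
    assert (H : has_sum (theta_term q (z / q)) (qpoch_inf q q * theta q (z / q))).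
    { apply IH; auto. rewrite Cmod_div by auto.
      apply Rmult_lt_reg_r with (Cmod q); [lra|]. unfold Rdiv.
      rewrite (Rmult_assoc (Cmod z)), Rinv_l by lra. simpl in Hn. lra. }
    replace (theta q z) with (theta q (z / q * q)) by (f_equal; field; auto).
    rewrite theta_shift by auto.
    replace (qpoch_inf q q * (- theta q (z / q) / (z / q)))
      with (- / (z / q) * (qpoch_inf q q * theta q (z / q))) by (field; auto).
    apply (has_sum_bij Z.succ Z.pred) in H; [|intros; lia|intros; lia].
    eapply has_sum_ext; [|apply has_sum_scal, H]. intros k. simpl. unfold theta_term.
    pose proof (Copp_nz _ Hz'). rewrite Czpow_succ by auto.
    unfold Z.succ. rewrite tri_succ, Czpow_add by auto.
    replace (- z) with (- (z / q) * q) by (field; auto).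
    rewrite Czpow_mult_l by auto. field. auto.
Qed.

Lemma theta_shift_Z (q z : C) (k : Z) : (0 < Cmod q < 1)%R -> z <> 0 ->
  Czpow (- z) k * Czpow q (tri k) * theta q (z * Czpow q k) = theta q z.
Proof.
  intros Hq Hz. pose proof (Cmod_q_nz q Hq) as Hq0. pose proof (Copp_nz z Hz) as Hmz.
  revert k. apply Z.bi_induction.
  - intros a b ->. tauto.
  - change (tri 0) with 0%Z. simpl. now rewrite !Cmult_1_l, Cmult_1_r.
  - intros k. rewrite Czpow_succ by auto. unfold Z.succ.
    rewrite tri_succ, !Czpow_add, Czpow_1_r by auto.
    rewrite (Cmult_assoc z), theta_shift by (auto; apply Cmult_neq_0; auto; now apply Czpow_nz).
    pose proof (Czpow_nz q k Hq0).
    replace (Czpow (- z) k * - z * (Czpow q (tri k) * Czpow q k) *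
      (- theta q (z * Czpow q k) / (z * Czpow q k)))
      with (Czpow (- z) k * Czpow q (tri k) * theta q (z * Czpow q k)); [tauto|].
    field. auto.
Qed.

(** * Odd theta functions of degree six *)

(** [P] is given on the punctured plane by an absolutely convergent sum of
    monomials whose norm sum is controlled by [M]. Indexing by an arbitrary type
    makes products of such sums again of this form. *)
Definition laurent (P : C -> C) (M : R -> R) : Prop :=
  exists (I : Type) (c : I -> C) (e : I -> Z), forall y : C, y <> 0 ->
    has_sum (fun i => c i * Czpow y (e i)) (P y) /\
    sum_le (fun i => c i * Czpow y (e i)) (M (Cmod y)).

Lemma laurent_mult P M P' M' : laurent P M -> laurent P' M' ->
  laurent (fun y => P y * P' y) (fun r => (M r * M' r)%R).
Proof.
  intros [I [c [e H]]] [J [c' [e' H']]].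
  exists (I * J)%type, (fun p : I * J => c (fst p) * c' (snd p)), (fun p : I * J => (e (fst p) + e' (snd p))%Z).
  intros y Hy. destruct (H y Hy) as [S B]. destruct (H' y Hy) as [S' B'].
  assert (E : forall p, c (fst p) * Czpow y (e (fst p)) * (c' (snd p) * Czpow y (e' (snd p)))
    = c (fst p) * c' (snd p) * Czpow y (e (fst p) + e' (snd p))).
  { intros p. rewrite (Czpow_add y _ _ Hy). ring. }
  split.
  - eapply has_sum_ext; [exact E|].
    apply (has_sum_prod (fun i => c i * Czpow y (e i)) (fun j => c' j * Czpow y (e' j)) _ _ _ _ B B' S S').
  - generalize (sum_le_prod _ _ _ _ B B'). apply sum_le_dom. intros p. cbv beta. rewrite E. apply Rle_refl.
Qed.

Lemma laurent_qinf (q s : C) : (0 < Cmod q < 1)%R ->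
  laurent (fun y => qpoch_inf (q * s * y) q) (fun r => rqinf (Cmod q) (Cmod q * Cmod s * r)).
Proof.
  intros Hq. exists nat, (fun n : nat => euler q n * (q * s) ^ n), Z.of_nat. intros y Hy.
  assert (E : forall n, euler q n * (q * s * y) ^ n = euler q n * (q * s) ^ n * Czpow y (Z.of_nat n)).
  { intros n. rewrite Czpow_nat, Cpow_mult_l. ring. }
  split.
  - eapply has_sum_ext; [exact E|]. now apply qinf_euler.
  - rewrite <- !Cmod_mult. generalize (euler_sum_le q (q * s * y) Hq).
    apply sum_le_dom. intros n. cbv beta. rewrite E. apply Rle_refl.
Qed.

Lemma laurent_inv P M : laurent P M -> laurent (fun y => P (/ y)) (fun r => M (/ r)%R).
Proof.
  intros [I [c [e H]]]. exists I, c, (fun i : I => (- e i)%Z). intros y Hy.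
  destruct (H (/ y) (Cinv_nz y Hy)) as [S B]. rewrite Cmod_inv in B by auto.
  assert (E : forall i, c i * Czpow (/ y) (e i) = c i * Czpow y (- e i)).
  { intros i. now rewrite Czpow_inv. }
  split; [eapply has_sum_ext; [exact E|exact S]|].
  revert B. apply sum_le_dom. intros i. cbv beta. rewrite E. apply Rle_refl.
Qed.

Lemma laurent_diff : laurent (fun y => y - / y) (fun r => (r + / r)%R).
Proof.
  exists bool, (fun b : bool => if b then RtoC 1 else - (1)), (fun b : bool => if b then 1%Z else (-1)%Z).
  intros y Hy. split.
  - replace (y - / y) with (1 * Czpow y 1 + - (1) * Czpow y (-1)) by (simpl; field; auto).
    apply (has_sum_bool (fun b : bool => (if b then RtoC 1 else - (1)) * Czpow y (if b then 1%Z else (-1)%Z))).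
  - replace (Cmod y + / Cmod y)%R with (Cmod (1 * Czpow y 1) + Cmod (- (1) * Czpow y (-1)))%R.
    + apply (sum_le_bool (fun b : bool => (if b then RtoC 1 else - (1)) * Czpow y (if b then 1%Z else (-1)%Z))).
    + simpl. rewrite Cmult_1_l, Cmult_1_r, Cmod_mult, Cmod_m1, Cmod_inv by auto. ring.
Qed.

Definition wprod (q : C) (ss : list C) (y : C) : C :=
  fold_right (fun s p => qpoch_inf (q * s * y) q * qpoch_inf (q * s * / y) q * p) 1 ss.

Definition rwprod (Q : R) (ts : list R) (r : R) : R :=
  fold_right (fun t p => (rqinf Q (Q * t * r) * rqinf Q (Q * t * / r) * p)%R) 1%R ts.

(** As a function of [y], the summand at [k = 0] of the very-well-poised bilateral series with
    base [y^2] and numerator parameters [y / s], multiplied by the infinite products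
    that clear its denominators; [s = 0] stands for an absent parameter. *)
Definition wpoised (q : C) (ss : list C) (y : C) : C := (y - / y) * wprod q ss y.

(** The majorant of [wpoised]: the same function with [q] and the parameters replaced by moduli,
    all signs being made positive. *)
Definition rwpoised (Q : R) (ts : list R) (r : R) : R := ((r + / r) * rwprod Q ts r)%R.

Lemma laurent_wpoised (q : C) (ss : list C) : (0 < Cmod q < 1)%R ->
  laurent (wpoised q ss) (rwpoised (Cmod q) (map Cmod ss)).
Proof.
  intros Hq. apply (laurent_mult _ _ _ _ laurent_diff).
  induction ss as [|s ss IH].
  - exists unit, (fun _ => 1), (fun _ => 0%Z). intros y Hy. split.
    + apply has_sum_ext with (fun _ : unit => RtoC 1); [intros i; simpl; ring|].
      apply (has_sum_single tt (fun _ : unit => RtoC 1)). intros []; congruence.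
    + intros l Hl. eapply Rle_trans; [apply (lnorm_incl _ l (tt :: nil) Hl)|].
      * intros []; simpl; auto.
      * simpl. rewrite Cmult_1_l, Cmod_1. lra.
  - apply (laurent_mult _ _ _ _ (laurent_mult _ _ _ _ (laurent_qinf q s Hq)
      (laurent_inv _ _ (laurent_qinf q s Hq))) IH).
Qed.

Lemma wprod_inv (q : C) (ss : list C) (y : C) : y <> 0 -> wprod q ss (/ y) = wprod q ss y.
Proof.
  intros Hy. assert (Hi : / / y = y) by (field; auto).
  induction ss as [|s ss IH]; simpl; auto. rewrite IH, Hi. ring.
Qed.

Lemma wpoised_inv (q : C) (ss : list C) (y : C) : y <> 0 -> wpoised q ss (/ y) = - wpoised q ss y.
Proof.
  intros Hy. unfold wpoised.
  rewrite wprod_inv by auto. field. auto.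
Qed.

Lemma rwpoised_inv Q ts r : r <> 0%R -> rwpoised Q ts (/ r) = rwpoised Q ts r.
Proof.
  intros Hr. unfold rwpoised.
  assert (E : rwprod Q ts (/ r) = rwprod Q ts r).
  { induction ts as [|s ss IH]; simpl; auto. rewrite IH, Rinv_inv. ring. }
  rewrite E, Rinv_inv. ring.
Qed.

Lemma rwprod_pos Q ts r : (0 < Q < 1)%R -> (0 < r)%R -> List.Forall (fun t => (0 <= t)%R) ts ->
  (0 < rwprod Q ts r)%R.
Proof.
  intros HQ Hr H. induction H as [|t ts Ht H IH]; simpl; [lra|].
  assert (0 < / r)%R by now apply Rinv_0_lt_compat.
  assert (K : forall w, (0 < w)%R -> (0 < rqinf Q (Q * t * w))%R).
  { intros w Hw. assert (0 <= Q * t * w)%R.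
    { apply Rmult_le_pos; [apply Rmult_le_pos|]; lra. }
    pose proof (rqinf_ge_1 Q _ HQ H1). lra. }
  apply Rmult_lt_0_compat; auto. apply Rmult_lt_0_compat; auto.
Qed.

Definition shift_ratio (Q : R) (ts : list R) (Y : R) : R :=
  fold_right (fun t p => ((Y + t) / (1 + Q * t * Y) * p)%R) 1%R ts.

Lemma rwprod_shift Q ts Y : (0 < Q < 1)%R -> (0 < Y)%R -> List.Forall (fun t => (0 <= t)%R) ts ->
  (rwprod Q ts (Y * Q) * Y ^ length ts = rwprod Q ts Y * shift_ratio Q ts Y)%R.
Proof.
  intros HQ HY H. induction H as [|t ts Ht H IH]; simpl; [ring|].
  assert (HiY : (0 < / Y)%R) by now apply Rinv_0_lt_compat.
  assert (P1 : (0 <= Q * t * Y)%R) by (apply Rmult_le_pos; [apply Rmult_le_pos|]; lra).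
  assert (P2 : (0 <= t * / Y)%R) by (apply Rmult_le_pos; lra).
  rewrite (rqinf_rec Q (Q * t * Y)) by auto.
  replace (Q * t * / (Y * Q))%R with (t * / Y)%R by (field; lra).
  rewrite (rqinf_rec Q (t * / Y)) by auto.
  replace (Q * (Q * t * Y))%R with (Q * t * (Y * Q))%R by ring.
  replace (Q * (t * / Y))%R with (Q * t * / Y)%R by ring.
  transitivity ((rwprod Q ts (Y * Q) * Y ^ length ts) * (rqinf Q (Q * t * (Y * Q)) * rqinf Q (Q * t * / Y)
     * ((1 + t * / Y) * Y)))%R; [ring|].
  rewrite IH. field. lra.
Qed.

Lemma shift_ratio_lim Q ts (Y : nat -> R) : is_lim_seq Y 0%R ->
  is_lim_seq (fun n => shift_ratio Q ts (Y n)) (fold_right Rmult 1%R ts).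
Proof.
  intros HY. induction ts as [|t ts IH]; simpl; [apply is_lim_seq_const|].
  apply is_lim_seq_mult'; auto.
  assert (E : Finite t = Finite ((0 + t) / (1 + Q * t * 0))) by (f_equal; field).
  rewrite E.
  apply is_lim_seq_div'.
  - apply is_lim_seq_plus'; auto. apply is_lim_seq_const.
  - apply is_lim_seq_plus'; [apply is_lim_seq_const|].
    apply is_lim_seq_mult'; auto. apply is_lim_seq_const.
  - lra.
Qed.

(** The shift of the base point from [x] to [x q^k] turns the very-well-poised summand at [0]
    into the one at [k], up to this monomial. *)
Definition wp_term (q : C) (P : C -> C) (x : C) (k : Z) : C :=
  Czpow q (3 * (k * k)) * Czpow x (6 * k) * P (x * Czpow q k).

Lemma wp_term_opp (q : C) (ss : list C) (x : C) (k : Z) : q <> 0 -> x <> 0 ->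
  wp_term q (wpoised q ss) x (- k) = - wp_term q (wpoised q ss) (/ x) k.
Proof.
  intros Hq Hx. unfold wp_term. rewrite Czpow_inv by auto.
  replace (/ x * Czpow q k) with (/ (x * Czpow q (- k))).
  2:{ rewrite Czpow_opp. pose proof (Czpow_nz q k Hq). field. auto. }
  rewrite wpoised_inv by (apply Cmult_neq_0; auto; now apply Czpow_nz).
  replace (- k * - k)%Z with (k * k)%Z by ring.
  replace (6 * - k)%Z with (- (6 * k))%Z by ring. ring.
Qed.

Definition wp_bound (q : C) (ss : list C) (x : C) (k : Z) : C :=
  wp_term q (fun y => RtoC (rwpoised (Cmod q) (map Cmod ss) (Cmod y))) x k.

Lemma Forall_Cmod (ss : list C) : List.Forall (fun t => (0 <= t)%R) (map Cmod ss).
Proof. induction ss; simpl; constructor; auto. apply Cmod_ge_0. Qed.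

Lemma rwpoised_pos Q ts r : (0 < Q < 1)%R -> (0 < r)%R -> List.Forall (fun t => (0 <= t)%R) ts ->
  (0 < rwpoised Q ts r)%R.
Proof.
  intros HQ Hr H. apply Rmult_lt_0_compat; [|now apply rwprod_pos].
  pose proof (Rinv_0_lt_compat r Hr). lra.
Qed.

Lemma fold_Cmod ss : fold_right Rmult 1%R (map Cmod ss) = Cmod (fold_right Cmult 1 ss).
Proof. induction ss as [|s ss IH]; simpl; [now rewrite Cmod_1|]. now rewrite IH, Cmod_mult. Qed.

(** Consecutive bounds have the ratio
    [Q^2 (1 + Q^2 Y^2) / (1 + Y^2) * prod (Y + |s|) / (1 + Q |s| Y)]
    with [Y = |x q^k|], which tends to [|q^2 prod s|]. *)
Lemma wp_bound_sum_le_nat (q : C) (ss : list C) (x : C) : (0 < Cmod q < 1)%R -> x <> 0 ->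
  length ss = 6%nat -> (Cmod (q ^ 2 * fold_right Cmult 1 ss) < 1)%R ->
  exists B, sum_le (fun n : nat => wp_bound q ss x (Z.of_nat n)) B.
Proof.
  intros Hq Hx Hlen Hss. pose proof (Cmod_q_nz q Hq) as Hq0.
  set (Q := Cmod q) in *. set (ts := map Cmod ss).
  assert (Hts : List.Forall (fun t => (0 <= t)%R) ts) by apply Forall_Cmod.
  assert (Hlt : length ts = 6%nat) by (unfold ts; now rewrite length_map).
  assert (HX : (0 < Cmod x)%R) by now apply Cmod_gt_0.
  set (Y := fun n => (Cmod x * Q ^ n)%R).
  assert (HYp : forall n, (0 < Y n)%R).
  { intros n. apply Rmult_lt_0_compat; auto. apply pow_lt. lra. }
  assert (HY : is_lim_seq Y 0%R).
  { replace (Finite 0) with (Rbar_mult (Cmod x) 0) by (simpl; f_equal; ring).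
    apply is_lim_seq_scal_l, is_lim_seq_pow0. lra. }
  assert (EY : forall n, Cmod (x * Czpow q (Z.of_nat n)) = Y n).
  { intros n. now rewrite Cmod_mult, Czpow_nat, Cmod_pow. }
  apply sum_le_ratio with (Cmod (q ^ 2 * fold_right Cmult 1 ss)); auto.
  - intros n. unfold wp_bound, wp_term. apply Cmult_neq_0.
    + apply Cmult_neq_0; now apply Czpow_nz.
    + intros E. apply RtoC_inj in E. fold ts Q in E. rewrite EY in E.
      pose proof (rwpoised_pos Q ts (Y n) Hq (HYp n) Hts). lra.
  - apply is_lim_seq_ext with (fun n => (Q ^ 2 * ((Y n * Y n * (Q * Q) + 1) / (Y n * Y n + 1))
                                         * shift_ratio Q ts (Y n))%R).
    + intros n. unfold wp_bound, wp_term. fold ts Q. rewrite !EY, !Cmod_mult, !Cmod_R.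
      pose proof (HYp n) as HYn.
      rewrite !Rabs_pos_eq by (apply Rlt_le, rwpoised_pos; auto).
      replace (Z.of_nat (S n)) with (Z.of_nat n + 1)%Z by lia.
      replace (3 * ((Z.of_nat n + 1) * (Z.of_nat n + 1)))%Z
        with (3 * (Z.of_nat n * Z.of_nat n) + (Z.of_nat (3 + 6 * n)))%Z by lia.
      replace (6 * (Z.of_nat n + 1))%Z with (6 * Z.of_nat n + Z.of_nat 6)%Z by lia.
      rewrite !Czpow_add, (Czpow_nat q (3 + 6 * n)), (Czpow_nat x 6), !Cmod_mult, !Cmod_pow by auto.
      fold Q.
      assert (EQ : (Q ^ (3 + 6 * n) * Cmod x ^ 6 = Q ^ 3 * Y n ^ 6)%R).
      { unfold Y. rewrite Rpow_mult_distr, pow_add, pow_mult, <- !pow_mult.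
        rewrite (Nat.mul_comm 6 n). ring. }
      replace (Y (S n)) with (Y n * Q)%R by (unfold Y; simpl; ring).
      unfold rwpoised.
      pose proof (rwprod_shift Q ts (Y n) Hq HYn Hts) as ES. rewrite Hlt in ES.
      pose proof (rwprod_pos Q ts (Y n) Hq HYn Hts) as HP.
      set (A := Cmod (Czpow q (3 * (Z.of_nat n * Z.of_nat n)))).
      set (B := Cmod (Czpow x (6 * Z.of_nat n))).
      assert (HA : (0 < A)%R) by (apply Cmod_gt_0; now apply Czpow_nz).
      assert (HB : (0 < B)%R) by (apply Cmod_gt_0; now apply Czpow_nz).
      transitivity ((Q ^ (3 + 6 * n) * Cmod x ^ 6) * (Y n * Q + / (Y n * Q)) * rwprod Q ts (Y n * Q)
         / ((Y n + / Y n) * rwprod Q ts (Y n)))%R.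
      * rewrite EQ.
        replace (Q ^ 3 * Y n ^ 6 * (Y n * Q + / (Y n * Q)) * rwprod Q ts (Y n * Q))%R
          with (Q ^ 3 * (Y n * Q + / (Y n * Q)) * (rwprod Q ts (Y n * Q) * Y n ^ 6))%R by ring.
        rewrite ES. assert (0 < Y n * Y n)%R by now apply Rmult_lt_0_compat.
        field. repeat split; try lra; apply Rgt_not_eq; nra.
      * assert (0 < Y n + / Y n)%R.
        { pose proof (Rinv_0_lt_compat _ HYn). lra. }
        assert (0 < Y n * Y n)%R by now apply Rmult_lt_0_compat.
        field. repeat split; try lra; apply Rgt_not_eq; nra.
    + rewrite Cmod_mult, Cmod_pow. fold Q. rewrite <- fold_Cmod. fold ts.
      replace (Finite (Q ^ 2 * fold_right Rmult 1%R ts))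
        with (Finite (Q ^ 2 * ((0 * 0 * (Q * Q) + 1) / (0 * 0 + 1)) * fold_right Rmult 1%R ts))
        by (f_equal; field).
      apply is_lim_seq_mult'; [|now apply shift_ratio_lim].
      apply is_lim_seq_mult'; [apply is_lim_seq_const|].
      assert (HYY : is_lim_seq (fun n => (Y n * Y n)%R) (0 * 0)%R) by now apply is_lim_seq_mult'.
      apply is_lim_seq_div'; [| |lra].
      * apply is_lim_seq_plus'; [|apply is_lim_seq_const].
        apply is_lim_seq_mult'; auto. apply is_lim_seq_const.
      * apply is_lim_seq_plus'; auto. apply is_lim_seq_const.
Qed.

Lemma wp_bound_sum_le (q : C) (ss : list C) (x : C) : (0 < Cmod q < 1)%R -> x <> 0 ->
  length ss = 6%nat -> (Cmod (q ^ 2 * fold_right Cmult 1 ss) < 1)%R ->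
  exists B, sum_le (wp_bound q ss x) B.
Proof.
  intros Hq Hx Hlen Hss. pose proof (Cmod_q_nz q Hq) as Hq0.
  destruct (wp_bound_sum_le_nat q ss x Hq Hx Hlen Hss) as [A HA].
  destruct (wp_bound_sum_le_nat q ss (/ x) Hq (Cinv_nz x Hx) Hlen Hss) as [B HB].
  exists (A + B)%R. apply bilateral_sum_le; auto.
  apply (sum_le_comp S _ _ eq_add_S) in HB. revert HB. apply sum_le_dom. intros n.
  right. unfold wp_bound, wp_term. set (k := Z.of_nat (S n)).
  replace (3 * (- k * - k))%Z with (3 * (k * k))%Z by ring.
  rewrite Czpow_inv by auto. replace (- (6 * k))%Z with (6 * - k)%Z by ring.
  rewrite !Cmod_mult. f_equal. f_equal. rewrite Czpow_opp.
  pose proof (Czpow_nz q k Hq0).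
  rewrite !Cmod_inv by auto.
  replace (/ Cmod x * Cmod (Czpow q k))%R with (/ (Cmod x * / Cmod (Czpow q k)))%R.
  - symmetry. f_equal. apply rwpoised_inv. apply Rgt_not_eq, Rmult_lt_0_compat; [now apply Cmod_gt_0|].
    apply Rinv_0_lt_compat. now apply Cmod_gt_0.
  - field. split; apply Rgt_not_eq; now apply Cmod_gt_0.
Qed.

(** Term of a theta series all of whose exponents of [x] are congruent to [r] modulo [6]. *)
Definition th6_term (q : C) (r : Z) (x : C) (k : Z) : C :=
  Czpow q (3 * (k * k) + k * r) * Czpow x (6 * k + r).

Definition th6 (q : C) (r : Z) (x : C) : C := usum (th6_term q r x).

Lemma th6_sum_le (q : C) (r : Z) (x : C) : (0 < Cmod q < 1)%R -> x <> 0 ->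
  exists B, sum_le (th6_term q r x) B.
Proof.
  intros Hq Hx. pose proof (Cmod_q_nz q Hq) as Hq0.
  assert (Hq3 : (0 < Cmod (Czpow q 3) < 1)%R).
  { change (Czpow q 3) with (q ^ 3). rewrite Cmod_pow. split; [apply pow_lt; lra|].
    apply (pow_lt_1 (Cmod q) 2). lra. }
  set (y := Czpow q r * Czpow x 6).
  assert (Hy : y <> 0) by (apply Cmult_neq_0; now apply Czpow_nz).
  destruct (gauss_sum_le _ y Hq3 Hy) as [B HB].
  exists (Cmod (Czpow x r) * B)%R. revert HB.
  apply sum_le_mono; [apply Cmod_ge_0|]. intros k. rewrite <- Cmod_mult. right. f_equal.
  unfold th6_term, y. rewrite Czpow_mult_l, <- !Czpow_mult_r by (auto; now apply Czpow_nz).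
  rewrite !Czpow_add by auto. replace (k * r)%Z with (r * k)%Z by ring. ring.
Qed.

Lemma th6_has_sum (q : C) (r : Z) (x : C) : (0 < Cmod q < 1)%R -> x <> 0 ->
  has_sum (th6_term q r x) (th6 q r x).
Proof.
  intros Hq Hx. destruct (th6_sum_le q r x Hq Hx) as [B HB]. now apply usum_correct with B.
Qed.

Lemma th6_inv (q : C) (r : Z) (x : C) : (0 < Cmod q < 1)%R -> x <> 0 ->
  th6 q r (/ x) = Czpow q (3 - r) * th6 q (6 - r) x.
Proof.
  intros Hq Hx. pose proof (Cmod_q_nz q Hq) as Hq0. apply usum_eq.
  pose proof (has_sum_scal (Czpow q (3 - r)) _ _ (th6_has_sum q (6 - r) x Hq Hx)) as H.
  apply (has_sum_bij (fun k => (- k - 1)%Z) (fun k => (- k - 1)%Z)) in H; try (intros; lia).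
  revert H. apply has_sum_ext. intros k. unfold th6_term.
  rewrite Czpow_inv, Cmult_assoc, <- Czpow_add by auto.
  f_equal; f_equal; ring.
Qed.

Lemma th6_inv_0 (q x : C) : (0 < Cmod q < 1)%R -> x <> 0 -> th6 q 0 (/ x) = th6 q 0 x.
Proof.
  intros Hq Hx. apply usum_eq.
  pose proof (th6_has_sum q 0 x Hq Hx) as H.
  apply (has_sum_bij (fun k => (- k)%Z) (fun k => (- k)%Z)) in H; try (intros; lia).
  revert H. apply has_sum_ext. intros k. unfold th6_term.
  rewrite Czpow_inv by auto. f_equal; f_equal; ring.
Qed.

(** Writing [e = 6 m + r] with [0 <= r < 6], the monomials
    [q^(3 k^2) x^(6 k) (x q^k)^e] become, after [k] is shifted by [m], the terms
    of [th6 r] times a constant: the sum depends on [x] only through the six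
    functions [th6 0], ..., [th6 5]. *)
Lemma wp_sum_th6 (q : C) (P : C -> C) (M : R -> R) : (0 < Cmod q < 1)%R -> laurent P M ->
  (forall x : C, x <> 0 -> exists B, sum_le (wp_term q (fun y => RtoC (M (Cmod y))) x) B) ->
  exists K : Z -> C, forall x : C, x <> 0 ->
    has_sum (wp_term q P x) (lsum (fun r => K r * th6 q r x) (0 :: 1 :: 2 :: 3 :: 4 :: 5 :: nil)%Z).
Proof.
  intros Hq [I [c [e HP]]] HM. pose proof (Cmod_q_nz q Hq) as Hq0.
  set (m := fun i => (e i / 6)%Z).
  set (U := fun (x : C) (p : Z * I) => Czpow q (3 * (fst p * fst p)) * Czpow x (6 * fst p)
              * (c (snd p) * Czpow (x * Czpow q (fst p)) (e (snd p)))).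
  assert (HU : forall x : C, x <> 0 -> exists B, sum_le (U x) B).
  { intros x Hx. destruct (HM x Hx) as [B HB]. exists B.
    apply tonelli with (fun k => Cmod (wp_term q (fun y => RtoC (M (Cmod y))) x k)).
    - intros k. assert (Hxk : x * Czpow q k <> 0) by (apply Cmult_neq_0; auto; now apply Czpow_nz).
      destruct (HP _ Hxk) as [_ HB'].
      unfold wp_term. rewrite Cmod_mult, Cmod_R, Rabs_pos_eq by apply (sum_le_ge_0 _ _ HB').
      revert HB'. apply sum_le_mono; [apply Cmod_ge_0|].
      intros i. unfold U. cbn [fst snd]. rewrite (Cmod_mult (_ * _) (c i * _)). lra.
    - revert HB. apply sum_le_dom. intros k. rewrite Cmod_R, Rabs_pos_eq; [lra|apply Cmod_ge_0]. }
  set (kap := fun i => c i * Czpow q (- (3 * (m i * m i) + m i * (e i mod 6)))).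
  assert (Hkap : exists B, sum_le kap B).
  { destruct (HU 1 C1_nz) as [B HB]. exists B.
    apply (sum_le_comp (fun i => ((- m i)%Z, i))) in HB.
    2:{ intros i j E. congruence. }
    revert HB. apply sum_le_dom. intros i. unfold U, kap. cbn [fst snd]. right. f_equal.
    rewrite Czpow_1_l, Cmult_1_l, <- Czpow_mult_r by auto.
    replace (Czpow q (3 * (- m i * - m i)) * 1 * (c i * Czpow q (- m i * e i)))
      with (c i * (Czpow q (3 * (- m i * - m i)) * Czpow q (- m i * e i))) by ring.
    rewrite <- Czpow_add by auto. do 2 f_equal.
    pose proof (Z.div_mod (e i) 6 ltac:(lia)) as E. fold (m i) in E. nia. }
  destruct Hkap as [BK HBK].
  set (kr := fun r i => if Z.eq_dec (e i mod 6) r then kap i else 0).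
  assert (Hkr : forall r, sum_le (kr r) BK).
  { intros r. revert HBK. apply sum_le_dom. intros i. unfold kr.
    destruct (Z.eq_dec (e i mod 6) r); [lra|]. rewrite Cmod_0. apply Cmod_ge_0. }
  exists (fun r => usum (kr r)). intros x Hx.
  destruct (HU x Hx) as [B HB]. destruct (sum_le_has_sum _ _ HB) as [S HS].
  assert (HW : has_sum (wp_term q P x) S).
  { apply (fubini (U x) B _ S HB); auto. intros k.
    assert (Hxk : x * Czpow q k <> 0) by (apply Cmult_neq_0; auto; now apply Czpow_nz).
    destruct (HP _ Hxk) as [HS' _]. unfold U, wp_term. cbn [fst snd].
    now apply has_sum_scal. }
  replace (lsum _ _) with S; auto.
  set (g := fun p : Z * I => ((fst p - m (snd p))%Z, snd p)).
  set (h := fun p : Z * I => ((fst p + m (snd p))%Z, snd p)).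
  apply (has_sum_bij g h) in HS.
  2,3: intros [k i]; unfold g, h; simpl; f_equal; lia.
  apply (has_sum_unique _ _ _ HS).
  eapply has_sum_ext; [|apply (has_sum_lsum
     (fun r (p : Z * I) => th6_term q r x (fst p) * kr r (snd p))
     (fun r => usum (kr r) * th6 q r x))].
  - intros [k i].
    assert (E : U x (g (k, i)) = th6_term q (e i mod 6) x k * kap i).
    { unfold U, g, th6_term, kap. cbn [fst snd].
      rewrite Czpow_mult_l, <- Czpow_mult_r by (auto; now apply Czpow_nz).
      transitivity (c i * (Czpow q (3 * ((k - m i) * (k - m i))) * Czpow q ((k - m i) * e i))
        * (Czpow x (6 * (k - m i)) * Czpow x (e i))); [ring|].
      rewrite <- !Czpow_add by auto.
      transitivity (c i * (Czpow q (3 * (k * k) + k * (e i mod 6))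
         * Czpow q (- (3 * (m i * m i) + m i * (e i mod 6)))) * Czpow x (6 * k + e i mod 6)); [|ring].
      rewrite <- Czpow_add by auto.
      pose proof (Z.div_mod (e i) 6 ltac:(lia)) as E. fold (m i) in E.
      f_equal; [f_equal|]; f_equal; nia. }
    rewrite E. pose proof (Z.mod_pos_bound (e i) 6 ltac:(lia)) as Hb.
    unfold kr. cbn [lsum fold_right fst snd].
    assert (Hc : (e i mod 6 = 0 \/ e i mod 6 = 1 \/ e i mod 6 = 2 \/ e i mod 6 = 3
             \/ e i mod 6 = 4 \/ e i mod 6 = 5)%Z) by lia.
    destruct Hc as [-> | [-> | [-> | [-> | [-> | ->]]]]]; simpl; ring.
  - intros r. rewrite Cmult_comm. destruct (th6_sum_le q r x Hq Hx) as [B' HB'].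
    apply (has_sum_prod _ _ _ _ _ _ HB' (Hkr r)); [now apply th6_has_sum|].
    now apply usum_correct with BK.
Qed.

(** Of the six functions, the antisymmetry under [x -> 1/x] leaves only the two
    combinations below. *)
Definition anti1 (q x : C) : C := th6 q 1 x - Czpow q 2 * th6 q 5 x.
Definition anti2 (q x : C) : C := th6 q 2 x - q * th6 q 4 x.

(** The sum is odd under [x -> 1/x], which exchanges [th6 r] with [th6 (6 - r)] up to
    constants: half the
    difference of its values at [x] and [1/x] contains neither [th6 0] nor [th6 3]. *)
Lemma wp_sum_span (q : C) (ss : list C) : (0 < Cmod q < 1)%R ->
  length ss = 6%nat -> (Cmod (q ^ 2 * fold_right Cmult 1 ss) < 1)%R ->
  exists al be : C, forall x : C, x <> 0 ->
    has_sum (wp_term q (wpoised q ss) x) (al * anti1 q x + be * anti2 q x).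
Proof.
  intros Hq Hlen Hss. pose proof (Cmod_q_nz q Hq) as Hq0.
  destruct (wp_sum_th6 q (wpoised q ss) (rwpoised (Cmod q) (map Cmod ss)) Hq) as [K HK].
  - now apply laurent_wpoised.
  - intros x Hx. now apply wp_bound_sum_le.
  - exists ((K 1%Z - / Czpow q 2 * K 5%Z) / 2), ((K 2%Z - / q * K 4%Z) / 2). intros x Hx.
    pose proof (HK x Hx) as H1. pose proof (HK (/ x) (Cinv_nz x Hx)) as H2.
    assert (H3 : has_sum (wp_term q (wpoised q ss) (/ x))
       (- (1) * lsum (fun r => K r * th6 q r x) (0 :: 1 :: 2 :: 3 :: 4 :: 5 :: nil)%Z)).
    { apply (has_sum_bij Z.opp Z.opp) in H1; try (intros; lia).
      eapply has_sum_ext; [|apply has_sum_scal, H1]. intros k. cbv beta.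
      rewrite wp_term_opp by auto. ring. }
    pose proof (has_sum_unique _ _ _ H2 H3) as E. cbn [lsum fold_right] in E, H1.
    rewrite th6_inv_0, !th6_inv in E by auto.
    change (K 0%Z * th6 q 0 x + (K 1%Z * (Czpow q 2 * th6 q 5 x) + (K 2%Z * (Czpow q 1 * th6 q 4 x)
      + (K 3%Z * (Czpow q 0 * th6 q 3 x) + (K 4%Z * (Czpow q (-1) * th6 q 2 x)
      + (K 5%Z * (Czpow q (-2) * th6 q 1 x) + 0))))) =
      - (1) * (K 0%Z * th6 q 0 x + (K 1%Z * th6 q 1 x + (K 2%Z * th6 q 2 x + (K 3%Z * th6 q 3 x
        + (K 4%Z * th6 q 4 x + (K 5%Z * th6 q 5 x + 0))))))) in E.
    unfold anti1, anti2.
    match type of E with ?R = _ * ?s =>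
      match goal with |- has_sum _ ?t => replace t with s; [exact H1|];
        transitivity ((s - R) / 2) end; [rewrite E|]
    end.
    + field.
    + simpl. field. auto.
Qed.

(** As a function of [x], an element of the two-dimensional space that vanishes at [p] and at
    [1/p]. *)
Definition theta_pair (q p x : C) : C :=
  theta q (p * x) * theta q (p / x) * (- / x * (qpoch_inf q q * theta q (x * x))).

(** The product [theta(p x) theta(p / x)] is multiplied by [q^(-k^2) x^(-2 k)] when [x] becomes
    [x q^k].  It may thus be pulled out of the sum, which leaves the series of Jacobi
    for [x^2], its terms being grouped in pairs. *)
Lemma theta_pair_sum (q p x : C) : (0 < Cmod q < 1)%R -> p <> 0 -> x <> 0 ->
  has_sum (wp_term q (wpoised q (/ p :: p / q :: RtoC 0 :: RtoC 0 :: RtoC 0 :: RtoC 0 :: nil)) x) (theta_pair q p x).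
Proof.
  intros Hq Hp Hx. pose proof (Cmod_q_nz q Hq) as Hq0.
  assert (Hxx : x * x <> 0) by now apply Cmult_neq_0.
  destruct (theta_sum_le q (x * x) Hq Hxx) as [B HB].
  pose proof (has_sum_pairs _ _ _ HB (jacobi q (x * x) Hq Hxx)) as H.
  apply (has_sum_scal (- / x)) in H.
  apply (has_sum_scal (theta q (p * x) * theta q (p / x))) in H.
  revert H. apply has_sum_ext. intros k.
  assert (Hpx : p * x <> 0) by now apply Cmult_neq_0.
  assert (Hpx' : p / x <> 0) by (apply Cmult_neq_0; auto; now apply Cinv_nz).
  set (Qk := Czpow q k). assert (HQk : Qk <> 0) by now apply Czpow_nz.
  pose proof (theta_shift_Z q (p * x) k Hq Hpx) as E1.
  pose proof (theta_shift_Z q (p / x) (- k) Hq Hpx') as E2.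
  rewrite <- E1, <- E2.
  unfold wp_term, wpoised, wprod, theta_term. cbn [fold_right]. fold Qk.
  rewrite !Cmult_0_r, !Cmult_0_l, !qinf_0, !Cmult_1_r by auto.
  unfold theta. rewrite (Czpow_opp q k). fold Qk.
  replace (q * / p * (x * Qk)) with (q / (p / x * / Qk)) by (field; auto).
  replace (q * / p * / (x * Qk)) with (q / (p * x * Qk)) by (field; auto).
  replace (q * (p / q) * (x * Qk)) with (p * x * Qk) by (field; auto).
  replace (q * (p / q) * / (x * Qk)) with (p / x * / Qk) by (field; auto).
  set (A1 := qpoch_inf (p * x * Qk) q). set (A2 := qpoch_inf (q / (p * x * Qk)) q).
  set (A3 := qpoch_inf (p / x * / Qk) q). set (A4 := qpoch_inf (q / (p / x * / Qk)) q).
  transitivity ((Czpow (- (p * x)) k * Czpow (- (p / x)) (- k) * Czpow (- (x * x)) (2 * k))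
     * (Czpow q (tri k) * Czpow q (tri (- k)) * Czpow q (tri (2 * k)))
     * (- / x * (1 + - (x * x) * Czpow q (2 * k))) * (A1 * A2 * A3 * A4)).
  { rewrite tri_succ, !Czpow_add, Czpow_1_r by (auto using Copp_nz). ring. }
  assert (EX : Czpow (- (p * x)) k * Czpow (- (p / x)) (- k) * Czpow (- (x * x)) (2 * k)
     = Czpow x (6 * k)).
  { rewrite <- (Czpow_inv (- (p / x))) by now apply Copp_nz.
    rewrite <- Czpow_mult_l by (auto using Copp_nz, Cinv_nz).
    rewrite (Czpow_mult_r (- (x * x))) by (auto using Copp_nz).
    rewrite <- Czpow_mult_l.
    - rewrite (Czpow_mult_r x) by auto. f_equal. simpl. field. auto.
    - apply Cmult_neq_0; auto using Copp_nz, Cinv_nz.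
    - apply Czpow_nz. auto using Copp_nz. }
  rewrite EX, <- !Czpow_add by auto.
  assert (EQ : (tri k + tri (- k) + tri (2 * k) = 3 * (k * k) + - k)%Z).
  { pose proof (tri_spec k). pose proof (tri_spec (- k)). pose proof (tri_spec (2 * k)). nia. }
  rewrite EQ, Czpow_add, Czpow_opp by auto. fold Qk.
  replace (2 * k)%Z with (k + k)%Z by ring. rewrite Czpow_add by auto. fold Qk.
  field. auto.
Qed.

Definition wsum (q : C) (ss : list C) (x : C) : C := usum (wp_term q (wpoised q ss) x).

Lemma wsum_correct (q : C) (ss : list C) (x : C) : (0 < Cmod q < 1)%R -> x <> 0 ->
  length ss = 6%nat -> (Cmod (q ^ 2 * fold_right Cmult 1 ss) < 1)%R ->
  has_sum (wp_term q (wpoised q ss) x) (wsum q ss x).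
Proof.
  intros Hq Hx Hlen Hss.
  destruct (wp_sum_span q ss Hq Hlen Hss) as [al [be H]].
  unfold wsum. rewrite (usum_eq _ _ (H x Hx)). now apply H.
Qed.

Lemma theta_1 (q : C) : (0 < Cmod q < 1)%R -> theta q 1 = 0.
Proof. intros Hq. unfold theta. rewrite (qinf_zero q 1 0) by (auto; simpl; ring). ring. Qed.

Lemma theta_pair_diag (q p : C) : (0 < Cmod q < 1)%R -> p <> 0 -> theta_pair q p p = 0.
Proof.
  intros Hq Hp. unfold theta_pair. replace (p / p) with (RtoC 1) by (field; auto).
  rewrite theta_1 by auto. ring.
Qed.

(** Three elements of a two-dimensional space of functions, evaluated at the three
    points [x], [p], [r], have a vanishing determinant. *)
Lemma wsum_three_term (q : C) (ss : list C) (x p r : C) : (0 < Cmod q < 1)%R ->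
  x <> 0 -> p <> 0 -> r <> 0 ->
  length ss = 6%nat -> (Cmod (q ^ 2 * fold_right Cmult 1 ss) < 1)%R ->
  wsum q ss x * (theta_pair q r p * theta_pair q p r) =
  wsum q ss p * (theta_pair q r x * theta_pair q p r) +
  wsum q ss r * (theta_pair q p x * theta_pair q r p).
Proof.
  intros Hq Hx Hp Hr Hlen Hss.
  assert (K : forall w : C, w <> 0 -> exists al be : C, forall y : C, y <> 0 ->
            theta_pair q w y = al * anti1 q y + be * anti2 q y).
  { intros w Hw.
    destruct (wp_sum_span q (/ w :: w / q :: RtoC 0 :: RtoC 0 :: RtoC 0 :: RtoC 0 :: nil) Hq) as [al [be H]].
    - reflexivity.
    - match goal with |- (Cmod ?w < 1)%R => replace w with (RtoC 0) by (simpl; ring) end.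
      rewrite Cmod_0. lra.
    - exists al, be. intros y Hy. exact (has_sum_unique _ _ _ (theta_pair_sum q w y Hq Hw Hy) (H y Hy)). }
  destruct (wp_sum_span q ss Hq Hlen Hss) as [al [be H]].
  assert (K' : forall y : C, y <> 0 -> wsum q ss y = al * anti1 q y + be * anti2 q y).
  { intros y Hy. apply usum_eq. exact (H y Hy). }
  destruct (K p Hp) as [ap [bp Ep]]. destruct (K r Hr) as [ar [br Er]].
  pose proof (theta_pair_diag q p Hq Hp) as Dp. pose proof (theta_pair_diag q r Hq Hr) as Dr.
  rewrite Ep in Dp by auto. rewrite Er in Dr by auto.
  rewrite !K', !Ep, !Er by auto.
  set (x1 := anti1 q x) in *. set (x2 := anti2 q x) in *.
  set (p1 := anti1 q p) in *. set (p2 := anti2 q p) in *.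
  set (r1 := anti1 q r) in *. set (r2 := anti2 q r) in *.
  match goal with |- _ = ?rhs => transitivity (rhs
    + ((al * x1 + be * x2) * (ap * p1 + bp * p2) * (ar * r1 + br * r2)
       - (ap * x1 + bp * x2) * (al * p1 + be * p2) * (ar * r1 + br * r2)
       - (ar * x1 + br * x2) * (ap * p1 + bp * p2) * (al * r1 + be * r2))); [ring|] end.
  rewrite Dp, Dr. ring.
Qed.

Lemma qinf_neg_shift (q p : C) n : (0 < Cmod q < 1)%R -> p <> 0 ->
  qpoch_inf (q / (p * q ^ n)) q * ((- p) ^ n * Czpow q (tri (Z.of_nat n)))
  = qp p q n * qpoch_inf (q / p) q.
Proof.
  intros Hq Hp. pose proof (Cmod_q_nz q Hq) as Hq0. induction n as [|n IH].
  - change (tri (Z.of_nat 0)) with 0%Z. unfold qp. simpl. rewrite !Cmult_1_r. ring.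
  - pose proof (Cpow_nz q n Hq0) as Hqn.
    rewrite qp_S. replace (Z.of_nat (S n)) with (Z.of_nat n + 1)%Z by lia.
    rewrite tri_succ, Czpow_add, Czpow_nat by auto.
    rewrite (qinf_rec q (q / (p * q ^ S n))) by auto.
    replace (q / (p * q ^ S n) * q) with (q / (p * q ^ n)) by (rewrite Cpow_S; field; auto).
    transitivity ((1 - p * q ^ n) * (qpoch_inf (q / (p * q ^ n)) q
       * ((- p) ^ n * Czpow q (tri (Z.of_nat n))))).
    + rewrite !Cpow_S. field. auto.
    + rewrite IH. ring.
Qed.

Lemma wprod_shift (q : C) (ss : list C) (x : C) n : (0 < Cmod q < 1)%R -> x <> 0 ->
  List.Forall (fun s : C => s <> 0) ss ->
  wprod q ss (x * q ^ n) * lprod (fun s : C => qp (q * s * x) q n) ss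
   * ((- x) ^ n * Czpow q (tri (Z.of_nat n))) ^ length ss
  = lprod (fun s : C => qp (x / s) q n) ss * lprod (fun s : C => s) ss ^ n * wprod q ss x.
Proof.
  intros Hq Hx Hss. pose proof (Cmod_q_nz q Hq) as Hq0. pose proof (Cpow_nz q n Hq0) as Hqn.
  induction Hss as [|s ss Hs Hss IH].
  - simpl. rewrite Cpow_1_l. ring.
  - cbn [wprod lprod fold_right length] in *. fold (lprod (fun s : C => qp (q * s * x) q n) ss).
    fold (lprod (fun s : C => qp (x / s) q n) ss). fold (lprod (fun s : C => s) ss).
    fold (wprod q ss x). fold (wprod q ss (x * q ^ n)).
    assert (Hp : x / s <> 0) by (apply Cmult_neq_0; auto; now apply Cinv_nz).
    pose proof (qinf_neg_shift q (x / s) n Hq Hp) as E.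
    replace (q / (x / s)) with (q * s * / x) in E by (field; auto).
    replace (q / (x / s * q ^ n)) with (q * s * / (x * q ^ n)) in E by (field; auto).
    replace (- (x / s)) with (- x * / s) in E by (field; auto).
    rewrite Cpow_mult_l, Cpow_inv in E by auto.
    rewrite (qinf_split q (q * s * x) n Hq), Cpow_S, (Cpow_mult_l s).
    replace (q * s * (x * q ^ n)) with (q * s * x * q ^ n) by ring.
    pose proof (Cpow_nz s n Hs) as Hsn.
    transitivity ((wprod q ss (x * q ^ n) * lprod (fun s : C => qp (q * s * x) q n) ss
         * ((- x) ^ n * Czpow q (tri (Z.of_nat n))) ^ length ss)
       * (qp (q * s * x) q n * qpoch_inf (q * s * x * q ^ n) q)
       * (qpoch_inf (q * s * / (x * q ^ n)) q * ((- x) ^ n * / s ^ n * Czpow q (tri (Z.of_nat n))))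
       * s ^ n).
    + field. auto.
    + rewrite IH, E. ring.
Qed.

(** Dividing by the constant [wprod q ss x] gives the usual summand of a basic hypergeometric
    series, since [(u q^n; q)_oo] and [(u q^(-n); q)_oo] are multiples of [(u; q)_oo] by finite
    products. *)
Lemma wp_term_nat (q : C) (ss : list C) (x : C) n : (0 < Cmod q < 1)%R -> x <> 0 ->
  List.Forall (fun s : C => s <> 0) ss -> length ss = 6%nat ->
  wp_term q (wpoised q ss) x (Z.of_nat n) * lprod (fun s : C => qp (q * s * x) q n) ss
  = - / x * wprod q ss x * ((1 - x * x * (q ^ n * q ^ n)) * (lprod (fun s : C => qp (x / s) q n) ss
     * (q ^ 2 * lprod (fun s : C => s) ss) ^ n)).
Proof.
  intros Hq Hx Hss Hlen. pose proof (Cmod_q_nz q Hq) as Hq0. pose proof (Cpow_nz q n Hq0) as Hqn.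
  pose proof (wprod_shift q ss x n Hq Hx Hss) as E. rewrite Hlen in E.
  assert (E6 : ((- x) ^ n * Czpow q (tri (Z.of_nat n))) ^ 6
     = Czpow x (6 * Z.of_nat n) * (Czpow q (3 * (Z.of_nat n * Z.of_nat n)) * / (q ^ n) ^ 3)).
  { rewrite Cpow_mult_l, <- Cpow_mult_r, Nat.mul_comm, Cpow_mult_r.
    replace ((- x) ^ 6) with (x ^ 6) by ring.
    rewrite <- Czpow_nat. rewrite (Czpow_mult_r x) by auto. f_equal.
    rewrite <- Czpow_nat, <- Czpow_mult_r by auto.
    replace (tri (Z.of_nat n) * Z.of_nat 6)%Z with
      (3 * (Z.of_nat n * Z.of_nat n) + - (Z.of_nat n * 3))%Z.
    2:{ pose proof (tri_spec (Z.of_nat n)). lia. }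
    rewrite Czpow_add, Czpow_opp, (Czpow_mult_r q (Z.of_nat n) 3), Czpow_nat by auto. reflexivity. }
  rewrite E6 in E. unfold wp_term, wpoised. rewrite Czpow_nat.
  transitivity ((x * q ^ n - / (x * q ^ n)) * (q ^ n) ^ 3 * (wprod q ss (x * q ^ n)
     * lprod (fun s : C => qp (q * s * x) q n) ss *
     (Czpow x (6 * Z.of_nat n) * (Czpow q (3 * (Z.of_nat n * Z.of_nat n)) * / (q ^ n) ^ 3)))).
  - field. auto.
  - rewrite E, Cpow_mult_l, <- (Cpow_mult_r q 2 n), (Nat.mul_comm 2 n), Cpow_mult_r. field. auto.
Qed.

(** * Jackson's terminating sum *)

(** The very-well-poised summand with base [l] and parameters [x], [y], [w], without the power
    of its argument. *)
Definition vw (q l x y w : C) (j : nat) : C :=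
  qp l q j * (1 - l * (q ^ j * q ^ j)) / ((1 - l) * qp q q j)
  * (qp x q j * qp y q j * qp w q j)
  / (qp (l * q / x) q j * qp (l * q / y) q j * qp (l * q / w) q j).

(** Summand of Jackson's 8-phi-7 multiplied by [(r; q)_n / (q, l q; q)_n].  This absorbs the
    negative powers of [q], so that the summand has a limit as [n] grows, and it turns the sum
    over [n] for fixed [j] into a 6-phi-5.  The letter [r] stands for [A / l] with
    [A = q l^2 / (x y w)]. *)
Definition jackson_term (q l x y w r : C) (n j : nat) : C :=
  vw q l x y w j * r ^ j * qp (l * r * q ^ n) q j * qp r q (n - j)
  / (qp q q (n - j) * qp (l * q) q (n + j)).

(** Ratio of the closed forms of the sums for [n + 1] and for [n]. *)
Definition jackson_fac (q l x y w r : C) (n : nat) : C :=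
  (1 - x * r * q ^ n) * (1 - y * r * q ^ n) * (1 - w * r * q ^ n)
  / ((1 - q * q ^ n) * (1 - l * q / x * q ^ n) * (1 - l * q / y * q ^ n) * (1 - l * q / w * q ^ n)).

(** The telescoping partner for the recurrence in [n]: the sum over [j <= J] of
    [jackson_term (n+1) j - jackson_fac n * jackson_term n j] is this single product. *)
Definition jackson_cert (q l x y w r : C) (n J : nat) : C :=
  - (r * q ^ n * (1 - l * r * q * (q ^ n * q ^ n))) * qp (l * q) q J
  * (qp x q (S J) * qp y q (S J) * qp w q (S J))
  / (qp q q J * (qp (l * q / x) q J * qp (l * q / y) q J * qp (l * q / w) q J))
  * (r / q) ^ J * qp (l * r * q ^ S n) q J * qp r q (n - J)
  / (qp q q (n - J) * qp (l * q) q (S n + J))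
  / ((1 - q * q ^ n) * (1 - l * q / x * q ^ n) * (1 - l * q / y * q ^ n) * (1 - l * q / w * q ^ n)).

(** What is left of [jackson_step] after the common factors are removed, with [k = q^J] and
    [u = q^m]. *)
Lemma jackson_core (q l x y w k u : C) : q <> 0 -> x <> 0 -> y <> 0 -> w <> 0 -> k <> 0 ->
  let r := q * l / (x * y * w) in let N := q * k * u in
  - (r * N * (1 - l * r * q * (N * N))) * (1 - l * q * k)
    * ((1 - x * (q * k)) * (1 - y * (q * k)) * (1 - w * (q * k))) * (/ (q * k)) * (1 - l * r * (q * N) * k) * (1 - q * u)
  + N * (1 - l * r * q * (N * N)) * (1 - q * k)
    * ((1 - l * q / x * k) * (1 - l * q / y * k) * (1 - l * q / w * k)) * / k * (1 - r * u) * (1 - l * q * (q * N * k))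
  = (1 - l * (q * k * (q * k))) * (1 - l * r * (q * N) * k) * (1 - r * u)
      * ((1 - q * N) * (1 - l * q / x * N) * (1 - l * q / y * N) * (1 - l * q / w * N))
    - (1 - x * r * N) * (1 - y * r * N) * (1 - w * r * N) * (1 - l * (q * k * (q * k))) * (1 - l * r * N)
      * (1 - q * u) * (1 - l * q * (q * N * k)).
Proof.
  intros Hq Hx Hy Hw Hk r N. unfold r, N. field. auto.
Qed.

Lemma jackson_step (q l x y w r : C) (m J : nat) :
  q <> 0 -> x <> 0 -> y <> 0 -> w <> 0 -> l <> 0 -> 1 - l <> 0 ->
  nonzero_factors q q -> nonzero_factors q (l * q) ->
  nonzero_factors q (l * q / x) -> nonzero_factors q (l * q / y) -> nonzero_factors q (l * q / w) ->
  r = q * l / (x * y * w) ->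
  let n := (S J + m)%nat in
  jackson_cert q l x y w r n (S J) - jackson_cert q l x y w r n J =
  jackson_term q l x y w r (S n) (S J) - jackson_fac q l x y w r n * jackson_term q l x y w r n (S J).
Proof.
  intros Hq Hx Hy Hw Hl Hl1 Hqq Hlq Hlx Hly Hlw Hr n.
  unfold jackson_cert, jackson_term, jackson_fac, vw.
  replace (n - S J)%nat with m by (unfold n; lia).
  replace (n - J)%nat with (S m) by (unfold n; lia).
  replace (S n - S J)%nat with (S m) by (unfold n; lia).
  replace (S n + S J)%nat with (S (S n + J)) by lia.
  replace (n + S J)%nat with (S n + J)%nat by lia.
  rewrite (qp_S_l (l * r * q ^ n) q J), (qp_S_l l q J), !(qp_S _ _ (S J)), !(qp_S _ _ m), !(qp_S _ _ (S n + J)), !(qp_S _ _ J).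
  replace (l * r * q ^ n * q) with (l * r * q ^ S n) by (rewrite Cpow_S; ring).
  set (P := (S n + J)%nat).
  pose proof (qp_nz _ _ J Hqq) as N1. pose proof (qp_nz _ _ m Hqq) as N2.
  pose proof (qp_nz _ _ P Hlq) as N3. pose proof (qp_nz _ _ J Hlx) as N4.
  pose proof (qp_nz _ _ J Hly) as N5. pose proof (qp_nz _ _ J Hlw) as N6.
  set (k := q ^ J) in *. 
  assert (EJ : q ^ S J = q * k) by (unfold k; now rewrite Cpow_S).
  set (u := q ^ m) in *.
  assert (En : q ^ n = q * k * u) by (unfold n; rewrite Cpow_add_r, EJ; reflexivity).
  assert (EP : q ^ P = q * (q * k * u) * k) by (unfold P; rewrite Cpow_add_r, Cpow_S, En; reflexivity).
  pose proof (Hqq J) as M1. pose proof (Hqq m) as M2. pose proof (Hlq P) as M3.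
  pose proof (Hlx J) as M4. pose proof (Hly J) as M5. pose proof (Hlw J) as M6.
  pose proof (Hqq n) as M7. pose proof (Hlx n) as M8. pose proof (Hly n) as M9. pose proof (Hlw n) as M10.
  rewrite EP in M3. rewrite En in *. 
  fold k in M1, M4, M5, M6. fold u in M2.
  rewrite !EP, !(Cpow_S r), !(Cpow_S (r / q)), ?EJ.
  replace ((r / q) ^ J) with (r ^ J / k).
  2:{ unfold Cdiv, k. rewrite Cpow_mult_l, Cpow_inv; auto. }
  assert (Hk : k <> 0) by now apply Cpow_nz.
  replace (l * r * q ^ S n) with (l * r * (q * (q * k * u))) by (now rewrite Cpow_S, En).
  pose proof (jackson_core q l x y w k u Hq Hx Hy Hw Hk) as core. cbv zeta in core.
  rewrite <- Hr in core.
  set (N := q * k * u) in *.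
  set (D4 := 1 - l * q / x * k) in *. set (D5 := 1 - l * q / y * k) in *.
  set (D6 := 1 - l * q / w * k) in *. set (D7 := 1 - q * N) in *.
  set (D8 := 1 - l * q / x * N) in *. set (D9 := 1 - l * q / y * N) in *.
  set (D10 := 1 - l * q / w * N) in *. set (D1 := 1 - q * k) in *. set (D2 := 1 - q * u) in *.
  set (D3 := 1 - l * q * (q * N * k)) in *. set (L1 := 1 - l) in *.
  set (a1 := qp (l * q) q J). set (a2 := qp x q J). set (a3 := qp y q J). set (a4 := qp w q J).
  set (a5 := qp (l * r * (q * N)) q J). set (a6 := qp r q m).
  set (d1 := qp q q J) in *. set (d2 := qp q q m) in *. set (d3 := qp (l * q) q P) in *.
  set (d4 := qp (l * q / x) q J) in *. set (d5 := qp (l * q / y) q J) in *.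
  set (d6 := qp (l * q / w) q J) in *. set (rJ := r ^ J).
  set (cm := rJ * r * a1 * (a2 * (1 - x * k) * (a3 * (1 - y * k)) * (a4 * (1 - w * k))) * a5 * a6
     / (d1 * D1 * (d4 * D4 * (d5 * D5) * (d6 * D6)) * (d2 * D2) * (d3 * D3) * (D7 * D8 * D9 * D10))).
  match type of core with ?lhs = ?rhs => transitivity (cm * lhs); [|rewrite core] end;
    unfold cm; field; repeat split; auto.
Qed.

Lemma jackson_core_0 (q l x y w N : C) : x <> 0 -> y <> 0 -> w <> 0 ->
  let r := q * l / (x * y * w) in
  - (r * N * (1 - l * r * q * (N * N))) * ((1 - x) * (1 - y) * (1 - w))
  = (1 - r * N) * ((1 - l * q / x * N) * (1 - l * q / y * N) * (1 - l * q / w * N))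
    - (1 - x * r * N) * (1 - y * r * N) * (1 - w * r * N) * (1 - l * q * N).
Proof. intros Hx Hy Hw r. unfold r. field. auto. Qed.

Lemma jackson_step_0 (q l x y w r : C) (n : nat) :
  x <> 0 -> y <> 0 -> w <> 0 -> 1 - l <> 0 ->
  nonzero_factors q q -> nonzero_factors q (l * q) ->
  nonzero_factors q (l * q / x) -> nonzero_factors q (l * q / y) -> nonzero_factors q (l * q / w) ->
  r = q * l / (x * y * w) ->
  jackson_cert q l x y w r n 0 =
  jackson_term q l x y w r (S n) 0 - jackson_fac q l x y w r n * jackson_term q l x y w r n 0.
Proof.
  intros Hx Hy Hw Hl1 Hqq Hlq Hlx Hly Hlw Hr.
  unfold jackson_cert, jackson_term, jackson_fac, vw.
  rewrite !Nat.sub_0_r, !Nat.add_0_r, !(qp_S _ _ n), !(qp_S _ _ 0).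
  change (qp x q 0) with (RtoC 1). change (qp y q 0) with (RtoC 1). change (qp w q 0) with (RtoC 1).
  change (qp l q 0) with (RtoC 1). change (qp (l * q) q 0) with (RtoC 1).
  change (qp (l * q / x) q 0) with (RtoC 1). change (qp (l * q / y) q 0) with (RtoC 1).
  change (qp (l * q / w) q 0) with (RtoC 1). change (qp q q 0) with (RtoC 1).
  change (qp (l * r * q ^ S n) q 0) with (RtoC 1). change (qp (l * r * q ^ n) q 0) with (RtoC 1).
  change (q ^ 0) with (RtoC 1). change (r ^ 0) with (RtoC 1). change ((r / q) ^ 0) with (RtoC 1).
  pose proof (jackson_core_0 q l x y w (q ^ n) Hx Hy Hw) as core. cbv zeta in core.
  rewrite <- Hr in core.
  pose proof (qp_nz _ _ n Hqq) as N2. pose proof (qp_nz _ _ n Hlq) as N3.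
  pose proof (Hqq n) as M7. pose proof (Hlx n) as M8. pose proof (Hly n) as M9. pose proof (Hlw n) as M10.
  pose proof (Hlq n) as M3.
  set (N := q ^ n) in *. set (D7 := 1 - q * N) in *.
  set (D8 := 1 - l * q / x * N) in *. set (D9 := 1 - l * q / y * N) in *.
  set (D10 := 1 - l * q / w * N) in *. set (L1 := 1 - l) in *. set (D3 := 1 - l * q * N) in *.
  set (a6 := qp r q n). set (d2 := qp q q n) in *. set (d3 := qp (l * q) q n) in *.
  set (cm := a6 / (d2 * (d3 * D3) * (D7 * D8 * D9 * D10))).
  match type of core with ?lhs = ?rhs => transitivity (cm * lhs); [|rewrite core] end;
    unfold cm; replace (1 - l * (1 * 1)) with L1 by (unfold L1; ring); field; repeat split; auto.
Qed.

(** The difference between the sum for [n + 1] and [jackson_fac n] times the sum for [n]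
    telescopes; the last term, [j = n + 1], cancels the partial sum [jackson_cert] at
    [J = n]. *)
Lemma jackson (q l x y w r : C) (n : nat) :
  q <> 0 -> x <> 0 -> y <> 0 -> w <> 0 -> l <> 0 -> 1 - l <> 0 ->
  nonzero_factors q q -> nonzero_factors q (l * q) ->
  nonzero_factors q (l * q / x) -> nonzero_factors q (l * q / y) -> nonzero_factors q (l * q / w) ->
  r = q * l / (x * y * w) ->
  lsum (jackson_term q l x y w r n) (seq 0 (S n)) =
  qp (x * r) q n * qp (y * r) q n * qp (w * r) q n
  / (qp q q n * qp (l * q / x) q n * qp (l * q / y) q n * qp (l * q / w) q n).
Proof.
  intros Hq Hx Hy Hw Hl Hl1 Hqq Hlq Hlx Hly Hlw Hr.
  induction n as [|n IH].
  { unfold jackson_term, vw, qp. simpl. field. auto. }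
  assert (T : forall J, (J <= n)%nat ->
    lsum (jackson_term q l x y w r (S n)) (seq 0 (S J)) =
    jackson_fac q l x y w r n * lsum (jackson_term q l x y w r n) (seq 0 (S J))
    + jackson_cert q l x y w r n J).
  { induction J as [|J IHJ]; intros HJ.
    - rewrite (jackson_step_0 q l x y w r n) by auto. simpl. ring.
    - rewrite !(seq_S (S J)), !lsum_app, IHJ by lia.
      replace n with (S J + (n - S J))%nat by lia.
      pose proof (jackson_step q l x y w r (n - S J) J Hq Hx Hy Hw Hl Hl1 Hqq Hlq Hlx Hly Hlw Hr) as E.
      cbv zeta in E. cbn [lsum fold_right].
      replace (0 + S J)%nat with (S J) by lia.
      match type of E with ?a - ?b = ?c - ?d =>
        replace a with ((c - d) + b) by (rewrite <- E; ring) end.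
      ring. }
  rewrite (seq_S (S n)), lsum_app, (T n (le_n n)), IH. cbn [lsum fold_right].
  replace (0 + S n)%nat with (S n) by lia.
  assert (E : jackson_term q l x y w r (S n) (S n) = - jackson_cert q l x y w r n n).
  { unfold jackson_cert, jackson_term, vw. rewrite !Nat.sub_diag.
    replace (S n + S n)%nat with (S (S n + n)) by lia.
    rewrite (qp_S_l l q n), !(qp_S _ _ (S n + n)), !(qp_S _ _ n), !(Cpow_S r).
    change (qp r q 0) with (RtoC 1). change (qp q q 0) with (RtoC 1).
    set (P := (S n + n)%nat).
    pose proof (qp_nz _ _ n Hqq) as N1.
    pose proof (qp_nz _ _ P Hlq) as N3. pose proof (qp_nz _ _ n Hlx) as N4.
    pose proof (qp_nz _ _ n Hly) as N5. pose proof (qp_nz _ _ n Hlw) as N6.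
    pose proof (Hlq P) as M3.
    pose proof (Hqq n) as M7. pose proof (Hlx n) as M8. pose proof (Hly n) as M9. pose proof (Hlw n) as M10.
    assert (EP : q ^ P = q * q ^ n * q ^ n) by (unfold P; now rewrite Cpow_add_r, Cpow_S).
    rewrite EP in *. rewrite (Cpow_S q n).
    replace ((r / q) ^ n) with (r ^ n / q ^ n).
    2:{ unfold Cdiv. rewrite Cpow_mult_l, Cpow_inv; auto. }
    pose proof (Cpow_nz q n Hq) as HN.
    set (N := q ^ n) in *. set (D7 := 1 - q * N) in *.
    set (D8 := 1 - l * q / x * N) in *. set (D9 := 1 - l * q / y * N) in *.
    set (D10 := 1 - l * q / w * N) in *. set (L1 := 1 - l) in *.
    replace (1 - l * q * (q * N * N)) with (1 - l * (q * N * (q * N))) in * by ring.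
    set (D3 := 1 - l * (q * N * (q * N))) in *.
    replace (1 - l * r * q * (N * N)) with (1 - l * r * (q * N) * N) by ring.
    set (G := 1 - l * r * (q * N) * N).
    field. repeat split; auto. }
  rewrite E. unfold jackson_fac. rewrite !qp_S.
  pose proof (qp_nz _ _ n Hqq) as N1. pose proof (qp_nz _ _ n Hlx) as N4.
  pose proof (qp_nz _ _ n Hly) as N5. pose proof (qp_nz _ _ n Hlw) as N6.
  pose proof (Hqq n) as M7. pose proof (Hlx n) as M8. pose proof (Hly n) as M9. pose proof (Hlw n) as M10.
  set (N := q ^ n) in *. set (D7 := 1 - q * N) in *.
  set (D8 := 1 - l * q / x * N) in *. set (D9 := 1 - l * q / y * N) in *.
  set (D10 := 1 - l * q / w * N) in *.
  field. repeat split; auto.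
Qed.

(** * The 6-phi-5 sum and Bailey's two-term transformation *)

Definition bdd {I : Type} (u : I -> C) : Prop := exists K, forall i, (Cmod (u i) <= K)%R.

Lemma bdd_mult {I : Type} (u v : I -> C) : bdd u -> bdd v -> bdd (fun i => u i * v i).
Proof.
  intros [K H] [L H']. exists (K * L)%R. intros i. rewrite Cmod_mult.
  apply Rmult_le_compat; auto using Cmod_ge_0.
Qed.

Lemma bdd_const {I : Type} (c : C) : bdd (fun _ : I => c).
Proof. exists (Cmod c). intros _. lra. Qed.

Lemma bdd_comp {I J : Type} (g : J -> I) (u : I -> C) : bdd u -> bdd (fun j => u (g j)).
Proof. intros [K H]. exists K. auto. Qed.

Lemma bdd_qp (q x : C) : (0 < Cmod q < 1)%R -> bdd (qp x q).
Proof. intros Hq. exists (rqinf (Cmod q) (Cmod x)). intros n. now apply qp_bound. Qed.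

Lemma bdd_qp_inv (q x : C) : (0 < Cmod q < 1)%R -> nonzero_factors q x -> bdd (fun n => / qp x q n).
Proof. intros Hq Hx. eexists. intros n. now apply qp_inv_bound. Qed.

Lemma bdd_linear (q x : C) : (0 < Cmod q < 1)%R -> bdd (fun n : nat => 1 - x * (q ^ n * q ^ n)).
Proof.
  intros Hq. exists (1 + Cmod x)%R. intros n.
  eapply Rle_trans; [apply (Cmod_triangle 1 (- (x * (q ^ n * q ^ n))))|].
  rewrite Cmod_opp, !Cmod_mult, !Cmod_pow, Cmod_1.
  assert (0 <= Cmod q ^ n <= 1)%R.
  { split; [apply pow_le; lra|]. rewrite <- (pow1 n). apply pow_incr. lra. }
  pose proof (Cmod_ge_0 x). assert (0 <= Cmod q ^ n * Cmod q ^ n <= 1)%R by nra. nra.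
Qed.

Lemma bdd_ext {I : Type} (u v : I -> C) : (forall i, u i = v i) -> bdd u -> bdd v.
Proof. intros E [K H]. exists K. intros i. now rewrite <- E. Qed.

Lemma bdd_vw (q l x y w : C) : (0 < Cmod q < 1)%R ->
  nonzero_factors q (l * q / x) -> nonzero_factors q (l * q / y) -> nonzero_factors q (l * q / w) ->
  bdd (vw q l x y w).
Proof.
  intros Hq Hx Hy Hw. pose proof (nonzero_factors_q q Hq) as Hqq.
  apply bdd_ext with (fun j => / (1 - l) * (qp l q j * ((1 - l * (q ^ j * q ^ j)) * (/ qp q q j *
    (qp x q j * (qp y q j * (qp w q j * (/ qp (l * q / x) q j * (/ qp (l * q / y) q j * / qp (l * q / w) q j))))))))).
  - intros j. unfold vw, Cdiv. destruct (classic (1 - l = 0)) as [E|E].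
    + rewrite E, Cmult_0_l, Cinv_0. ring.
    + pose proof (qp_nz _ _ j Hqq). pose proof (qp_nz _ _ j Hx).
      pose proof (qp_nz _ _ j Hy). pose proof (qp_nz _ _ j Hw). unfold Cdiv in *.
      field. repeat split; auto.
  - repeat (apply bdd_mult; auto using bdd_const, bdd_qp, bdd_qp_inv, bdd_linear).
Qed.

Lemma bdd_geom_sum_le (u : nat -> C) (z : C) : bdd u -> (Cmod z < 1)%R ->
  exists B, sum_le (fun n => u n * z ^ n) B.
Proof.
  intros [K HK] Hz. apply sum_le_geom with K (Cmod z).
  - split; auto. apply Cmod_ge_0.
  - intros n. rewrite Cmod_mult, Cmod_pow.
    apply Rmult_le_compat_r; auto. apply pow_le, Cmod_ge_0.
Qed.

(** The limit [n -> oo] of Jackson's sum, termwise by [tannery] with a geometric majorant. *)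
Lemma six_phi_five (q l x y w r : C) : (0 < Cmod q < 1)%R ->
  x <> 0 -> y <> 0 -> w <> 0 -> l <> 0 -> 1 - l <> 0 -> nonzero_factors q (l * q) ->
  nonzero_factors q (l * q / x) -> nonzero_factors q (l * q / y) -> nonzero_factors q (l * q / w) ->
  r = q * l / (x * y * w) -> (Cmod r < 1)%R ->
  exists s, has_sum (fun j => vw q l x y w j * r ^ j) s /\
    s * (qpoch_inf r q * (qpoch_inf (l * q / x) q * qpoch_inf (l * q / y) q * qpoch_inf (l * q / w) q))
    = qpoch_inf (l * q) q * (qpoch_inf (x * r) q * qpoch_inf (y * r) q * qpoch_inf (w * r) q).
Proof.
  intros Hq Hx Hy Hw Hl Hl1 Hlq Hlx Hly Hlw Hr Hr1.
  pose proof (Cmod_q_nz q Hq) as Hq0. pose proof (nonzero_factors_q q Hq) as Hqq.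
  destruct (bdd_geom_sum_le (vw q l x y w) r) as [B HB]; auto using bdd_vw.
  destruct (sum_le_has_sum _ _ HB) as [s Hs]. exists s. split; auto.
  set (c := qpoch_inf r q * / (qpoch_inf q q * qpoch_inf (l * q) q)).
  pose proof (qinf_nz q q Hq Hqq) as Z1. pose proof (qinf_nz q _ Hq Hlq) as Z2.
  pose proof (qinf_nz q _ Hq Hlx) as Z3. pose proof (qinf_nz q _ Hq Hly) as Z4.
  pose proof (qinf_nz q _ Hq Hlw) as Z5.
  assert (Hbd : bdd (fun p : nat * nat => qp (l * r * q ^ fst p) q (snd p)
      * (qp r q (fst p - snd p) * (/ qp q q (fst p - snd p) * / qp (l * q) q (fst p + snd p))))).
  { apply bdd_mult.
    - exists (rqinf (Cmod q) (Cmod (l * r))). intros [n j]. cbn [fst snd].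
      eapply Rle_trans; [now apply qp_bound|].
      rewrite (Cmod_mult (l * r)), Cmod_pow, Rmult_comm. apply rqinf_pow; auto. apply Cmod_ge_0.
    - apply bdd_mult; [apply (bdd_comp (fun p : nat * nat => (fst p - snd p)%nat)), bdd_qp; auto|].
      apply bdd_mult.
      + apply (bdd_comp (fun p : nat * nat => (fst p - snd p)%nat) (fun n => / qp q q n)).
        now apply bdd_qp_inv.
      + apply (bdd_comp (fun p : nat * nat => (fst p + snd p)%nat) (fun n => / qp (l * q) q n)).
        now apply bdd_qp_inv. }
  destruct Hbd as [K HK].
  assert (HK0 : (0 <= K)%R).
  { eapply Rle_trans; [apply Cmod_ge_0|apply (HK (0, 0)%nat)]. }
  set (K' := RtoC (K + Cmod c)). pose proof (Cmod_ge_0 c) as Hc0.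
  assert (EK' : Cmod K' = (K + Cmod c)%R) by (unfold K'; rewrite Cmod_R; apply Rabs_pos_eq; lra).
  assert (EJ : forall n j, jackson_term q l x y w r n j = vw q l x y w j * r ^ j *
     (qp (l * r * q ^ n) q j * (qp r q (n - j) * (/ qp q q (n - j) * / qp (l * q) q (n + j))))).
  { intros n j. unfold jackson_term. pose proof (qp_nz q q (n - j) Hqq).
    pose proof (qp_nz (l * q) q (n + j) Hlq). field. auto. }
  assert (L1 : Clim eventually (fun n => lsum (jackson_term q l x y w r n) (seq 0 (S n))) (s * c)).
  { apply (tannery eventually _
      (fun n j => if Nat.leb j n then jackson_term q l x y w r n j else 0)
      (fun j => c * (vw q l x y w j * r ^ j))
      (fun j => K' * (vw q l x y w j * r ^ j)) _ _ (Cmod K' * B)).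
    - revert HB. apply sum_le_mono; [apply Cmod_ge_0|]. intros j. rewrite Cmod_mult. lra.
    - intros j. rewrite !(Cmod_mult _ (_ * _)). apply Rmult_le_compat_r; [apply Cmod_ge_0|].
      rewrite EK'. lra.
    - apply filter_forall. intros n j. destruct (Nat.leb j n).
      + rewrite EJ, Cmult_comm, !(Cmod_mult _ (vw _ _ _ _ _ _ * _)).
        apply Rmult_le_compat_r; [apply Cmod_ge_0|]. rewrite EK'.
        specialize (HK (n, j)). cbn [fst snd] in HK. lra.
      + rewrite Cmod_0. apply Cmod_ge_0.
    - apply filter_forall. intros n.
      pose proof (has_sum_finite (fun j => if Nat.leb j n then jackson_term q l x y w r n j else 0) (S n)) as H.
      replace (lsum (jackson_term q l x y w r n) (seq 0 (S n))) with
        (lsum (fun j => if Nat.leb j n then jackson_term q l x y w r n j else 0) (seq 0 (S n))).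
      + apply H. intros j Hj. destruct (Nat.leb_spec j n); auto; lia.
      + assert (G : forall L, (forall j, In j L -> (j <= n)%nat) ->
          lsum (fun j => if Nat.leb j n then jackson_term q l x y w r n j else 0) L
          = lsum (jackson_term q l x y w r n) L).
        { induction L as [|a L IH]; intros HL; simpl; auto. rewrite IH by (intros; apply HL; now right).
          destruct (Nat.leb_spec a n); auto. specialize (HL a (or_introl eq_refl)). lia. }
        apply G. intros j Hj. apply in_seq in Hj. lia.
    - rewrite (Cmult_comm s). now apply has_sum_scal.
    - intros j.
      assert (L : Clim eventually (fun n => vw q l x y w j * r ^ j *
        (qp (l * r * q ^ n) q j * (qp r q (n - j) * (/ qp q q (n - j) * / qp (l * q) q (n + j)))))
        (vw q l x y w j * r ^ j * (qp 0 q j * (qpoch_inf r q * (/ qpoch_inf q q * / qpoch_inf (l * q) q))))).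
      { apply Clim_scal; [apply eventually_filter|]. apply Clim_mult; [apply eventually_filter| |].
        - apply Clim_qp; [apply eventually_filter|]. apply Clim_pow0. lra.
        - apply Clim_mult; [apply eventually_filter| |].
          + apply (Clim_nat_shift (qp r q)). now apply qinf_cvg.
          + apply Clim_mult; [apply eventually_filter| |].
            * apply (Clim_nat_shift (fun n => / qp q q n)).
              apply Clim_inv; [apply eventually_filter|auto|]. now apply qinf_cvg.
            * apply Clim_inv; [apply eventually_filter|auto|].
              apply (Clim_nat_comp (qp (l * q) q)); [intros; lia|]. now apply qinf_cvg. }
      rewrite qp_0 in L.
      replace (c * (vw q l x y w j * r ^ j)) with
        (vw q l x y w j * r ^ j * (1 * (qpoch_inf r q * (/ qpoch_inf q q * / qpoch_inf (l * q) q))))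
        by (unfold c; field; auto).
      intros eps Heps. destruct (L eps Heps) as [N HN]. exists (N + j)%nat. intros n Hn.
      destruct (Nat.leb_spec j n); [|lia]. rewrite EJ. apply HN. lia. }
  assert (L2 : Clim eventually (fun n => lsum (jackson_term q l x y w r n) (seq 0 (S n)))
    (qpoch_inf (x * r) q * qpoch_inf (y * r) q * qpoch_inf (w * r) q
     * / (qpoch_inf q q * qpoch_inf (l * q / x) q * qpoch_inf (l * q / y) q * qpoch_inf (l * q / w) q))).
  { apply (Clim_ext eventually _ (fun n => qp (x * r) q n * qp (y * r) q n * qp (w * r) q n
      * / (qp q q n * qp (l * q / x) q n * qp (l * q / y) q n * qp (l * q / w) q n))).
    - intros n. symmetry. now apply jackson.
    - repeat (apply Clim_mult; [apply eventually_filter| |]); try now apply qinf_cvg.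
      apply Clim_inv; [apply eventually_filter| |].
      + repeat apply Cmult_neq_0; auto.
      + repeat (apply Clim_mult; [apply eventually_filter| |]); now apply qinf_cvg. }
  pose proof (Clim_unique eventually _ _ _ _ L1 L2) as E. unfold c in E.
  transitivity ((s * (qpoch_inf r q * / (qpoch_inf q q * qpoch_inf (l * q) q))) * (qpoch_inf q q *
     qpoch_inf (l * q) q * (qpoch_inf (l * q / x) q * qpoch_inf (l * q / y) q * qpoch_inf (l * q / w) q))).
  - field. auto.
  - rewrite E. field. repeat split; auto.
Qed.

(** The contribution of two further parameters [e] and [f] to a well-poised summand with base
    [a]. *)
Definition efac (q a e f : C) (n : nat) : C :=
  qp e q n * qp f q n / (qp (a * q / e) q n * qp (a * q / f) q n).

Lemma bdd_efac (q a e f : C) : (0 < Cmod q < 1)%R ->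
  nonzero_factors q (a * q / e) -> nonzero_factors q (a * q / f) -> bdd (efac q a e f).
Proof.
  intros Hq He Hf.
  apply bdd_ext with (fun n => qp e q n * (qp f q n * (/ qp (a * q / e) q n * / qp (a * q / f) q n))).
  - intros n. unfold efac. pose proof (qp_nz _ _ n He). pose proof (qp_nz _ _ n Hf).
    unfold Cdiv in *. field. auto.
  - repeat (apply bdd_mult; auto using bdd_qp, bdd_qp_inv).
Qed.

Lemma nonzero_factors_shift (q x : C) n : nonzero_factors q x -> nonzero_factors q (x * q ^ n).
Proof.
  intros H i. replace (1 - x * q ^ n * q ^ i) with (1 - x * q ^ (n + i)); [apply H|].
  rewrite Cpow_add_r. ring.
Qed.

(** For fixed [j] the sum over [m] is the 6-phi-5 with base [A q^(2 j)], where [A = l r], and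
    parameters [r], [e q^j], [f q^j]. *)
Lemma vwp_row (q l x y w r e f : C) (j : nat) : (0 < Cmod q < 1)%R ->
  l <> 0 -> r <> 0 -> e <> 0 -> f <> 0 ->
  nonzero_factors q (l * r) -> nonzero_factors q (l * q) ->
  nonzero_factors q (l * r * q / e) -> nonzero_factors q (l * r * q / f) ->
  nonzero_factors q (l * q / e) -> nonzero_factors q (l * q / f) ->
  (Cmod (l * q / (e * f)) < 1)%R ->
  has_sum (fun m => jackson_term q l x y w r (j + m) j *
     (qp (l * r) q (j + m) * (1 - l * r * (q ^ (j + m) * q ^ (j + m))) / (1 - l * r)
      * efac q (l * r) e f (j + m) * (l * q / (e * f)) ^ (j + m)))
   (vw q l x y w j * efac q l e f j * (l * r * q / (e * f)) ^ j
    * (qpoch_inf (l * r * q) q * qpoch_inf (l * r * q / (e * f)) q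
        * qpoch_inf (l * q / e) q * qpoch_inf (l * q / f) q
       / (qpoch_inf (l * q / (e * f)) q * qpoch_inf (l * q) q
          * qpoch_inf (l * r * q / e) q * qpoch_inf (l * r * q / f) q))).
Proof.
  intros Hq Hl Hr He Hf HA Hlq HAe HAf Hle Hlf Hz.
  pose proof (Cmod_q_nz q Hq) as Hq0. pose proof (nonzero_factors_q q Hq) as Hqq.
  pose proof (Cpow_nz q j Hq0) as Hqj.
  set (a := l * r * (q ^ j * q ^ j)).
  assert (Ha : nonzero_factors q a).
  { unfold a. rewrite <- Cpow_add_r. now apply nonzero_factors_shift. }
  assert (Ha1 : 1 - a <> 0) by (specialize (Ha O); simpl in Ha; now rewrite Cmult_1_r in Ha).
  assert (HA1 : 1 - l * r <> 0) by (specialize (HA O); simpl in HA; now rewrite Cmult_1_r in HA).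
  assert (E1 : a * q / r = l * q * q ^ (j + j)) by (unfold a; rewrite Cpow_add_r; field; auto).
  assert (E2 : a * q / (e * q ^ j) = l * r * q / e * q ^ j) by (unfold a; field; auto).
  assert (E3 : a * q / (f * q ^ j) = l * r * q / f * q ^ j) by (unfold a; field; auto).
  assert (Ez : l * q / (e * f) = q * a / (r * (e * q ^ j) * (f * q ^ j))) by (unfold a; field; auto).
  destruct (six_phi_five q a r (e * q ^ j) (f * q ^ j) (l * q / (e * f))) as [s [Hs Es]]; auto.
  - now apply Cmult_neq_0.
  - now apply Cmult_neq_0.
  - unfold a. repeat apply Cmult_neq_0; auto.
  - replace (a * q) with (a * q ^ 1) by (simpl; ring). now apply nonzero_factors_shift.
  - rewrite E1. now apply nonzero_factors_shift.
  - rewrite E2. now apply nonzero_factors_shift.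
  - rewrite E3. now apply nonzero_factors_shift.
  - set (z := l * q / (e * f)) in *.
    set (cj := vw q l x y w j * (r * z) ^ j * (qp (l * r) q (j + j) * (1 - a) / (1 - l * r))
      * (qp e q j * qp f q j) / (qp (l * q) q (j + j) * (qp (l * r * q / e) q j * qp (l * r * q / f) q j))).
    pose proof (qinf_nz q _ Hq Hlq) as Z1. pose proof (qinf_nz q _ Hq HAe) as Z2.
    pose proof (qinf_nz q _ Hq HAf) as Z3.
    assert (Z4 : qpoch_inf z q <> 0).
    { apply qinf_nz; auto. intros i. apply one_minus_nz. rewrite Cmod_mult, Cmod_pow.
      assert (Cmod q ^ i <= 1)%R by (rewrite <- (pow1 i); apply pow_incr; lra).
      pose proof (Cmod_ge_0 z). pose proof (pow_le (Cmod q) i ltac:(lra)). nra. }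
    apply (has_sum_scal cj) in Hs.
    match goal with |- has_sum _ ?t => replace t with (cj * s) end.
    + revert Hs. apply has_sum_ext. intros m.
      unfold cj, vw at 2, jackson_term, efac.
      replace (j + m - j)%nat with m by lia.
      rewrite E1, E2, E3.
      rewrite !(qp_add _ _ j m).
      replace (j + m + j)%nat with (j + j + m)%nat by lia. rewrite (qp_add (l * q) q (j + j) m).
      assert (EA : qp (l * r) q (j + j) * qp a q m = qp (l * r) q j * qp (l * r * q ^ j) q m * qp (l * r * q ^ (j + m)) q j).
      { rewrite <- !qp_add. replace (j + m + j)%nat with (j + j + m)%nat by lia.
        rewrite (qp_add (l * r) q (j + j) m), Cpow_add_r. reflexivity. }
      pose proof (qp_nz _ _ j Hqq). pose proof (qp_nz _ _ m Hqq).
      pose proof (qp_nz _ _ (j + j) Hlq).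
      pose proof (qp_nz _ _ m (nonzero_factors_shift _ _ (j + j) Hlq)).
      pose proof (qp_nz _ _ j HAe). pose proof (qp_nz _ _ m (nonzero_factors_shift _ _ j HAe)).
      pose proof (qp_nz _ _ j HAf). pose proof (qp_nz _ _ m (nonzero_factors_shift _ _ j HAf)).
      rewrite Cpow_mult_l, !(Cpow_add_r _ j m).
      replace (l * r * (q ^ j * q ^ m * (q ^ j * q ^ m))) with (a * (q ^ m * q ^ m)) by (unfold a; ring).
      rewrite (Cpow_add_r q j m) in EA.
      transitivity (vw q l x y w j * r ^ j * qp r q m / (qp q q m *
         (qp (l * q) q (j + j) * qp (l * q * q ^ (j + j)) q m)) * (qp (l * r) q (j + j) * qp a q m)
         * ((1 - a * (q ^ m * q ^ m)) / (1 - l * r) *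
         (qp e q j * qp (e * q ^ j) q m * (qp f q j * qp (f * q ^ j) q m)
          / (qp (l * r * q / e) q j * qp (l * r * q / e * q ^ j) q m *
             (qp (l * r * q / f) q j * qp (l * r * q / f * q ^ j) q m))) * (z ^ j * z ^ m))).
      * field. repeat split; auto.
      * rewrite EA. field. repeat split; auto.
    + rewrite E1, E2, E3 in Es.
      replace (r * z) with (l * r * q / (e * f)) in Es by (unfold z; field; auto).
      replace (e * q ^ j * z) with (l * q / f * q ^ j) in Es by (unfold z; field; auto).
      replace (f * q ^ j * z) with (l * q / e * q ^ j) in Es by (unfold z; field; auto).
      unfold cj. replace (r * z) with (l * r * q / (e * f)) by (unfold z; field; auto).
      unfold efac.
      assert (EAq : qpoch_inf (l * r * q) q * (1 - l * r) = qp (l * r) q (j + j) * (1 - a) * qpoch_inf (a * q) q).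
      { rewrite <- (Cmult_assoc (qp _ _ _)), <- qinf_rec by auto. unfold a. rewrite <- Cpow_add_r, <- qinf_split by auto.
        rewrite (qinf_rec q (l * r)) by auto. ring. }
      pose proof (qp_nz _ _ j Hle). pose proof (qp_nz _ _ j Hlf).
      pose proof (qp_nz _ _ j HAe). pose proof (qp_nz _ _ j HAf). pose proof (qp_nz _ _ (j + j) Hlq).
      rewrite (qinf_split q (l * q / e) j), (qinf_split q (l * q / f) j) by auto.
      rewrite (qinf_split q (l * q) (j + j)), (qinf_split q (l * r * q / e) j), (qinf_split q (l * r * q / f) j) in * by auto.
      assert (Z1' : qpoch_inf (l * q * q ^ (j + j)) q <> 0) by (intros E; apply Z1; rewrite E; ring).
      assert (Z2' : qpoch_inf (l * r * q / e * q ^ j) q <> 0) by (intros E; apply Z2; rewrite E; ring).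
      assert (Z3' : qpoch_inf (l * r * q / f * q ^ j) q <> 0) by (intros E; apply Z3; rewrite E; ring).
      set (v1 := qpoch_inf (l * q * q ^ (j + j)) q) in *.
      set (v2 := qpoch_inf (l * r * q / e * q ^ j) q) in *.
      set (v3 := qpoch_inf (l * r * q / f * q ^ j) q) in *.
      set (v4 := qpoch_inf z q) in *.
      replace s with (s * (v4 * (v1 * v2 * v3)) / (v4 * (v1 * v2 * v3))) by (field; auto).
      rewrite Es.
      replace (qpoch_inf (l * r * q) q) with (qp (l * r) q (j + j) * (1 - a) * qpoch_inf (a * q) q / (1 - l * r))
        by (rewrite <- EAq; field; auto).
      field. repeat split; auto.
Qed.

(** Bailey's transformation: in the double series over [j] and [n = j + m], summing over [j]
    first is Jackson's sum, and summing over [m] first is the 6-phi-5 sum of [vwp_row]. *)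
Lemma vwp_transform (q l x y w r e f : C) : (0 < Cmod q < 1)%R ->
  x <> 0 -> y <> 0 -> w <> 0 -> l <> 0 -> e <> 0 -> f <> 0 ->
  r = q * l / (x * y * w) ->
  nonzero_factors q (l * r) -> nonzero_factors q l ->
  nonzero_factors q (l * q / x) -> nonzero_factors q (l * q / y) -> nonzero_factors q (l * q / w) ->
  nonzero_factors q (l * r * q / e) -> nonzero_factors q (l * r * q / f) ->
  nonzero_factors q (l * q / e) -> nonzero_factors q (l * q / f) ->
  (Cmod (l * q / (e * f)) < 1)%R -> (Cmod (l * r * q / (e * f)) < 1)%R ->
  exists s t,
    has_sum (fun n => vw q (l * r) (x * r) (y * r) (w * r) n * efac q (l * r) e f n
                      * (l * q / (e * f)) ^ n) s /\
    has_sum (fun j => vw q l x y w j * efac q l e f j * (l * r * q / (e * f)) ^ j) t /\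
    s * (qpoch_inf (l * q / (e * f)) q * qpoch_inf (l * q) q
         * qpoch_inf (l * r * q / e) q * qpoch_inf (l * r * q / f) q)
    = t * (qpoch_inf (l * r * q) q * qpoch_inf (l * r * q / (e * f)) q
           * qpoch_inf (l * q / e) q * qpoch_inf (l * q / f) q).
Proof.
  intros Hq Hx Hy Hw Hl He Hf Er HA Hlam Hlx Hly Hlw HAe HAf Hle Hlf Hz1 Hz2.
  pose proof (Cmod_q_nz q Hq) as Hq0. pose proof (nonzero_factors_q q Hq) as Hqq.
  assert (Hr : r <> 0).
  { rewrite Er. apply Cmult_neq_0; [now apply Cmult_neq_0|apply Cinv_nz].
    repeat apply Cmult_neq_0; auto. }
  assert (Hl1 : 1 - l <> 0) by (specialize (Hlam O); simpl in Hlam; now rewrite Cmult_1_r in Hlam).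
  assert (HA1 : 1 - l * r <> 0) by (specialize (HA O); simpl in HA; now rewrite Cmult_1_r in HA).
  assert (Hlq : nonzero_factors q (l * q)).
  { replace (l * q) with (l * q ^ 1) by (simpl; ring). now apply nonzero_factors_shift. }
  set (z1 := l * q / (e * f)) in *. set (z2 := l * r * q / (e * f)) in *.
  assert (Ez : z2 = r * z1) by (unfold z1, z2; field; auto).
  set (u := fun p : nat * nat => let j := fst p in let m := snd p in
     jackson_term q l x y w r (j + m) j *
     (qp (l * r) q (j + m) * (1 - l * r * (q ^ (j + m) * q ^ (j + m))) / (1 - l * r)
      * efac q (l * r) e f (j + m) * z1 ^ (j + m))).
  (* The double series is dominated by a product of two geometric series. *)
  assert (HB : exists B, sum_le u B).
  { set (v := fun p : nat * nat =>
      vw q l x y w (fst p) * (qp (l * r * q ^ (fst p + snd p)) q (fst p) * (qp r q (snd p)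
      * (/ qp q q (snd p) * (/ qp (l * q) q (fst p + snd p + fst p) *
        (qp (l * r) q (fst p + snd p) * ((1 - l * r * (q ^ (fst p + snd p) * q ^ (fst p + snd p)))
        * (/ (1 - l * r) * efac q (l * r) e f (fst p + snd p)))))))) ).
    assert (Hv : bdd v).
    { unfold v.
      apply bdd_mult; [apply (bdd_comp fst), bdd_vw; auto|].
      apply bdd_mult.
      { exists (rqinf (Cmod q) (Cmod (l * r))). intros p.
        eapply Rle_trans; [now apply qp_bound|].
        rewrite (Cmod_mult (l * r)), Cmod_pow, Rmult_comm. apply rqinf_pow; auto. apply Cmod_ge_0. }
      apply bdd_mult; [apply (bdd_comp snd), bdd_qp; auto|].
      apply bdd_mult; [apply (bdd_comp snd (fun n => / qp q q n)), bdd_qp_inv; auto|].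
      apply bdd_mult; [apply (bdd_comp (fun p : nat * nat => (fst p + snd p + fst p)%nat)
         (fun n => / qp (l * q) q n)), bdd_qp_inv; auto|].
      apply bdd_mult; [apply (bdd_comp (fun p : nat * nat => (fst p + snd p)%nat)), bdd_qp; auto|].
      apply bdd_mult; [apply (bdd_comp (fun p : nat * nat => (fst p + snd p)%nat)
         (fun n => 1 - l * r * (q ^ n * q ^ n))), bdd_linear; auto|].
      apply bdd_mult; [apply bdd_const|].
      apply (bdd_comp (fun p : nat * nat => (fst p + snd p)%nat)), bdd_efac; auto. }
    destruct Hv as [K HK].
    destruct (bdd_geom_sum_le (fun _ => 1) z2 (bdd_const 1) Hz2) as [B2 HB2].
    destruct (bdd_geom_sum_le (fun _ => 1) z1 (bdd_const 1) Hz1) as [B1 HB1].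
    exists (K * (B2 * B1))%R. generalize (sum_le_prod _ _ _ _ HB2 HB1).
    apply sum_le_mono.
    - eapply Rle_trans; [apply Cmod_ge_0|apply (HK (0, 0)%nat)].
    - intros [j m]. specialize (HK (j, m)). cbn [fst snd] in *.
      replace (u (j, m)) with (v (j, m) * ((1 * z2 ^ j) * (1 * z1 ^ m))).
      + rewrite Cmod_mult. apply Rmult_le_compat_r; [apply Cmod_ge_0|auto].
      + unfold u, v, jackson_term. cbn [fst snd]. replace (j + m - j)%nat with m by lia.
        rewrite Ez, Cpow_mult_l, (Cpow_add_r z1).
        pose proof (qp_nz _ _ m Hqq). pose proof (qp_nz _ _ (j + m + j) Hlq). field. auto. }
  destruct HB as [B HB]. destruct (sum_le_has_sum _ _ HB) as [S HS].
  destruct (bdd_geom_sum_le (fun j => vw q l x y w j * efac q l e f j) z2) as [Bt HBt]; auto.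
  { apply bdd_mult; [now apply bdd_vw|now apply bdd_efac]. }
  destruct (sum_le_has_sum _ _ HBt) as [t Ht].
  exists S, t. split; [|split]; auto.
  - set (g := fun p : nat * nat => ((fst p + snd p)%nat, fst p)).
    set (W := fun p : nat * nat => if Nat.leb (snd p) (fst p) then u (snd p, (fst p - snd p)%nat) else 0).
    assert (Hg : forall p p', g p = g p' -> p = p').
    { intros [j m] [j' m']. unfold g. cbn [fst snd]. intros E. injection E as E1 E2.
      f_equal; lia. }
    assert (HWg : forall p, u p = W (g p)).
    { intros [j m]. unfold W, g. cbn [fst snd]. destruct (Nat.leb_spec j (j + m)); [|lia].
      do 2 f_equal. lia. }
    assert (HW0 : forall p, (exists i, g i = p) \/ W p = 0).
    { intros [n j]. unfold W. cbn [fst snd]. destruct (Nat.leb_spec j n); auto.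
      left. exists (j, (n - j)%nat). unfold g. cbn [fst snd]. f_equal. lia. }
    apply (fubini W B _ S).
    + apply (sum_le_inj g); auto. revert HB. apply sum_le_dom. intros p. rewrite HWg. lra.
    + intros n.
      assert (E : lsum (fun j => W (n, j)) (seq 0 (Datatypes.S n)) =
        vw q (l * r) (x * r) (y * r) (w * r) n * efac q (l * r) e f n * z1 ^ n).
      { set (c := qp (l * r) q n * (1 - l * r * (q ^ n * q ^ n)) / (1 - l * r)
                  * efac q (l * r) e f n * z1 ^ n).
        assert (E : forall L, (forall j, In j L -> (j <= n)%nat) ->
           lsum (fun j => W (n, j)) L = c * lsum (jackson_term q l x y w r n) L).
        { induction L as [|a L IH]; intros HL; simpl; [ring|].
          rewrite IH by (intros; apply HL; now right).
          unfold W, u. cbn [fst snd].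
          assert (Ha : (a <= n)%nat) by (apply HL; now left).
          destruct (Nat.leb_spec a n); [|lia].
          replace (a + (n - a))%nat with n by lia. unfold c. ring. }
        rewrite E by (intros j Hj; apply in_seq in Hj; lia).
        rewrite jackson by auto. unfold c, vw.
        replace (l * r * q / (x * r)) with (l * q / x) by (field; auto).
        replace (l * r * q / (y * r)) with (l * q / y) by (field; auto).
        replace (l * r * q / (w * r)) with (l * q / w) by (field; auto).
        pose proof (qp_nz _ _ n Hqq). pose proof (qp_nz _ _ n Hlx).
        pose proof (qp_nz _ _ n Hly). pose proof (qp_nz _ _ n Hlw).
        field. repeat split; auto. }
      rewrite <- E. apply (has_sum_finite (fun j => W (n, j))).
      intros j Hj. unfold W. cbn [fst snd]. destruct (Nat.leb_spec j n); auto; lia.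
    + apply (has_sum_inj g); auto. revert HS. apply has_sum_ext. exact HWg.
  - set (c := qpoch_inf (l * r * q) q * qpoch_inf z2 q
        * qpoch_inf (l * q / e) q * qpoch_inf (l * q / f) q
       / (qpoch_inf z1 q * qpoch_inf (l * q) q
          * qpoch_inf (l * r * q / e) q * qpoch_inf (l * r * q / f) q)).
    destruct (fubini u B (fun j => vw q l x y w j * efac q l e f j * z2 ^ j * c) S HB) as [HR _]; auto.
    + intros j. unfold u. cbn [fst snd]. now apply vwp_row.
    + assert (ES : S = c * t).
      { apply (has_sum_unique _ _ _ HR). eapply has_sum_ext; [|apply has_sum_scal, Ht].
        intros j. simpl. ring. }
      rewrite ES. unfold c.
      pose proof (qinf_nz q _ Hq Hlq) as Z1. pose proof (qinf_nz q _ Hq HAe) as Z2.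
      pose proof (qinf_nz q _ Hq HAf) as Z3.
      assert (Z4 : qpoch_inf z1 q <> 0).
      { apply qinf_nz; auto. intros i. apply one_minus_nz. rewrite Cmod_mult, Cmod_pow.
        assert (Cmod q ^ i <= 1)%R by (rewrite <- (pow1 i); apply pow_incr; lra).
        pose proof (Cmod_ge_0 z1). pose proof (pow_le (Cmod q) i ltac:(lra)). nra. }
      field. repeat split; auto.
Qed.

(** * Continuity of basic hypergeometric series in their parameters *)

Definition qratio (num den : list C) (q z : C) (n : nat) : C :=
  lprod (fun x : C => qp x q n) num / lprod (fun x : C => qp x q n) den * z ^ n.

Lemma qpochs_nat (xs : list C) (q : C) (n : nat) :
  qpochs xs q (Z.of_nat n) = lprod (fun x : C => qp x q n) xs.
Proof.
  induction xs as [|x xs IH]; simpl; auto. now rewrite qpoch_nat, IH.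
Qed.

Lemma phi_term_qratio (num den : list C) (q z : C) (n : nat) :
  phi_term num den q z n = qratio num (q :: den) q z n.
Proof. unfold phi_term, qratio. now rewrite !qpochs_nat. Qed.

Lemma psi_term_nat (num den : list C) (q z : C) (n : nat) :
  psi_term num den q z (Z.of_nat n) = qratio num den q z n.
Proof. unfold psi_term, qratio. now rewrite !qpochs_nat, Czpow_nat. Qed.

Lemma qpoch_neg (x q : C) (n : nat) : q <> 0 -> x <> 0 ->
  qpoch x q (- Z.of_nat n) = / ((- x) ^ n * Czpow q (- tri (- Z.of_nat n)) * qp (q / x) q n).
Proof.
  intros Hq Hx.
  assert (E : qpoch x q (- Z.of_nat n) = / qp (x * Czpow q (- Z.of_nat n)) q n).
  { assert (G : forall k m, Cprod (fun j => 1 - x * Czpow q (k + Z.of_nat j)) m = qp (x * Czpow q k) q m).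
    { intros k m. induction m as [|m IH]; simpl; auto.
      rewrite IH, qp_S, Czpow_add, Czpow_nat by auto. ring. }
    destruct n as [|n]; [unfold qp; simpl; field|].
    change (- Z.of_nat (S n))%Z with (Z.neg (Pos.of_succ_nat n)).
    cbn [qpoch]. rewrite SuccNat2Pos.id_succ, G. reflexivity. }
  rewrite E. f_equal. clear E. induction n as [|n IH].
  - unfold qp, tri. simpl. field.
  - rewrite qp_S_l.
    replace (x * Czpow q (- Z.of_nat (S n)) * q) with (x * Czpow q (- Z.of_nat n)).
    2:{ replace (- Z.of_nat n)%Z with (- Z.of_nat (S n) + 1)%Z by lia.
        rewrite Czpow_add, Czpow_1_r by auto. ring. }
    rewrite IH, qp_S.
    replace (- tri (- Z.of_nat (S n)))%Z
      with (- tri (- Z.of_nat n) + - Z.of_nat (S n))%Z.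
    2:{ pose proof (tri_spec (- Z.of_nat n)). pose proof (tri_spec (- Z.of_nat (S n))). nia. }
    rewrite Czpow_add, (Czpow_opp q (Z.of_nat (S n))), Czpow_nat, !Cpow_S by auto.
    pose proof (Cpow_nz q n Hq). field. auto.
Qed.

(** Reversing the direction of summation; the convention [/ 0 = 0] makes the formula valid even
    where a denominator parameter produces a zero factor. *)
Lemma psi_term_neg (num den : list C) (q z : C) (n : nat) : q <> 0 -> z <> 0 ->
  List.Forall (fun x : C => x <> 0) num -> List.Forall (fun x : C => x <> 0) den ->
  length num = length den ->
  psi_term num den q z (- Z.of_nat n) =
  qratio (map (fun x => q / x) den) (map (fun x => q / x) num) q
    (lprod (fun x : C => x) den / (lprod (fun x : C => x) num * z)) n.
Proof.
  intros Hq Hz Hnum Hden Hlen.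
  set (w := Czpow q (- tri (- Z.of_nat n))).
  assert (Hw : w <> 0) by now apply Czpow_nz.
  assert (K : forall xs : list C, List.Forall (fun x : C => x <> 0) xs ->
    qpochs xs q (- Z.of_nat n) = / (((- (1)) ^ n * w) ^ length xs * lprod (fun x : C => x) xs ^ n
       * lprod (fun x : C => qp x q n) (map (fun x => q / x) xs))).
  { induction 1 as [|x xs Hx Hxs IH].
    - simpl. rewrite Cpow_1_l. field.
    - cbn [qpochs fold_right length lprod map]. fold (qpochs xs q (- Z.of_nat n)).
      fold (lprod (fun x : C => x) xs).
      fold (lprod (fun x : C => qp x q n) (map (fun x => q / x) xs)).
      rewrite IH, qpoch_neg, <- Cinv_mult by auto. f_equal. fold w.
      rewrite Cpow_S, (Cpow_mult_l x).
      replace (- x) with (- (1) * x) by ring. rewrite (Cpow_mult_l (- (1))). ring. }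
  assert (P : forall xs : list C, List.Forall (fun x : C => x <> 0) xs -> lprod (fun x : C => x) xs <> 0).
  { induction 1; simpl; [exact C1_nz|now apply Cmult_neq_0]. }
  pose proof (P _ Hnum) as P1. pose proof (P _ Hden) as P2.
  unfold psi_term, qratio. rewrite (K _ Hnum), (K _ Hden), Hlen.
  unfold Cdiv. rewrite !Cinv_inv, Czpow_opp, Czpow_nat, !Cinv_mult, !Cpow_mult_l, !Cpow_inv by auto.
  assert (Hm : (- (1)) ^ n <> 0).
  { apply Cpow_nz. intros E. apply C1_nz. replace (RtoC 1) with (- - (1)) by ring. rewrite E. ring. }
  pose proof (Cpow_nz _ (length den) Hm). pose proof (Cpow_nz _ (length den) Hw).
  pose proof (Cpow_nz _ n P1). pose proof (Cpow_nz _ n P2). pose proof (Cpow_nz _ n Hz).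
  set (i := / lprod (fun x : C => qp x q n) (map (fun x => q * / x) num)).
  field. repeat split; auto.
Qed.

Inductive Clim_list {T : Type} (F : (T -> Prop) -> Prop) : (T -> list C) -> list C -> Prop :=
| Clim_nil : Clim_list F (fun _ => nil) nil
| Clim_cons : forall h x L l, Clim F h x -> Clim_list F L l ->
    Clim_list F (fun t => h t :: L t) (x :: l).

Lemma qinf_nz_factors (q x : C) : (0 < Cmod q < 1)%R -> qpoch_inf x q <> 0 -> nonzero_factors q x.
Proof. intros Hq H i E. apply H. now apply qinf_zero with i. Qed.

(** Non-vanishing of all factors at once is the non-vanishing of the continuous function
    [qpoch_inf]. *)
Lemma nonzero_factors_open {T : Type} (F : (T -> Prop) -> Prop) (FF : Filter F) (q : C)
  (f : T -> C) (l : C) : (0 < Cmod q < 1)%R -> nonzero_factors q l -> Clim F f l ->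
  F (fun t => nonzero_factors q (f t)).
Proof.
  intros Hq Hl H.
  pose proof (qinf_nz q l Hq Hl) as Hn.
  generalize (Clim_nz F FF _ _ Hn (qinf_continuous F FF q f l Hq H)). apply filter_imp.
  intros t Ht. apply qinf_nz_factors; auto. apply Cmod_gt_0.
  apply Cmod_gt_0 in Hn. lra.
Qed.

Lemma nonzero_factors_list_open {T : Type} (F : (T -> Prop) -> Prop) (FF : Filter F) (q : C)
  (L : T -> list C) (l : list C) : (0 < Cmod q < 1)%R ->
  List.Forall (nonzero_factors q) l -> Clim_list F L l ->
  F (fun t => List.Forall (nonzero_factors q) (L t)).
Proof.
  intros Hq Hl H. revert Hl. induction H as [|h x L l Hx HL IH]; intros Hl.
  - apply filter_forall. constructor.
  - inversion Hl as [|? ? Hx' Hl' E].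
    generalize (filter_and _ _ (nonzero_factors_open F FF q h x Hq Hx' Hx) (IH Hl')).
    apply filter_imp. intros t [A B]. now constructor.
Qed.

(** Only finitely many factors can vanish in the limit, and each of them is moved off zero by a
    change of modulus. *)
Lemma nonzero_factors_generic {T : Type} (F : (T -> Prop) -> Prop) (FF : Filter F) (q : C)
  (f : T -> C) (l : C) : (0 < Cmod q < 1)%R -> Clim F f l ->
  F (fun t => Cmod (f t) <> Cmod l) -> F (fun t => nonzero_factors q (f t)).
Proof.
  intros Hq H Hne.
  destruct (Clim_pow0 q l ltac:(lra) 1%R Rlt_0_1) as [N HN]. specialize (HN N (le_n N)).
  replace (l * q ^ N - 0) with (l * q ^ N) in HN by ring.
  assert (Hbase : nonzero_factors q (l * q ^ N)).
  { intros i. apply one_minus_nz. rewrite (Cmod_mult _ (q ^ i)), (Cmod_pow q i).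
    assert (Cmod q ^ i <= 1)%R by (rewrite <- (pow1 i); apply pow_incr; lra).
    pose proof (Cmod_ge_0 (l * q ^ N)). pose proof (pow_le (Cmod q) i ltac:(lra)). nra. }
  assert (Hc : Clim F (fun t => f t * q ^ N) (l * q ^ N)).
  { apply Clim_mult; auto. now apply Clim_const. }
  pose proof (nonzero_factors_open F FF q _ _ Hq Hbase Hc) as H1.
  assert (H2 : F (fun t => forall i, (i < N)%nat -> 1 - f t * q ^ i <> 0)).
  { clear HN Hbase Hc H1. induction N as [|N IH].
    - apply filter_forall. intros; lia.
    - assert (HNN : F (fun t => 1 - f t * q ^ N <> 0)).
      { destruct (classic (1 - l * q ^ N = 0)) as [E|E].
        - revert Hne. apply filter_imp. intros t Ht E'. apply Ht.
          assert (E2 : f t * q ^ N = l * q ^ N).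
          { transitivity (1 - (1 - f t * q ^ N)); [ring|]. rewrite E', <- E. ring. }
          apply (f_equal Cmod) in E2. rewrite !Cmod_mult in E2.
          assert (0 < Cmod (q ^ N))%R by (apply Cmod_gt_0, Cpow_nz, Cmod_q_nz; auto).
          apply Rmult_eq_reg_r with (Cmod (q ^ N)); auto. lra.
        - assert (HL : Clim F (fun t => 1 + (- q ^ N) * f t) (1 + (- q ^ N) * l)).
          { apply Clim_plus; auto; [now apply Clim_const|now apply Clim_scal]. }
          assert (E3 : 1 + - q ^ N * l <> 0).
          { intros E3. apply E. rewrite <- E3. ring. }
          generalize (Clim_nz F FF _ _ E3 HL). apply filter_imp. intros t Ht E'.
          replace (1 + - q ^ N * f t) with (1 - f t * q ^ N) in Ht by ring.
          rewrite E', Cmod_0 in Ht. apply Cmod_gt_0 in E3. lra. }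
      generalize (filter_and _ _ IH HNN). apply filter_imp. intros t [A B] i Hi.
      destruct (Nat.eq_dec i N) as [->|]; auto. apply A. lia. }
  generalize (filter_and _ _ H1 H2). apply filter_imp. intros t [A B] i.
  destruct (Nat.lt_ge_cases i N) as [Hi|Hi]; auto.
  specialize (A (i - N)%nat). rewrite <- Cmult_assoc, <- Cpow_add_r in A.
  now replace (N + (i - N))%nat with i in A by lia.
Qed.

Lemma rqinf_mono (Q r r' : R) : (0 < Q < 1)%R -> (0 <= r <= r')%R -> (rqinf Q r <= rqinf Q r')%R.
Proof.
  intros HQ Hr. unfold rqinf. apply Series_le; [|apply reuler_ex; auto; lra].
  intros n. pose proof (reuler_pos Q n HQ). split.
  - apply Rmult_le_pos; [lra|]. apply pow_le. lra.
  - apply Rmult_le_compat_l; [lra|]. now apply pow_incr.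
Qed.

Lemma lprod_qp_bound {T : Type} (F : (T -> Prop) -> Prop) (FF : Filter F) (q : C)
  (L : T -> list C) (l : list C) : (0 < Cmod q < 1)%R -> Clim_list F L l ->
  exists K, (0 <= K)%R /\ F (fun t => forall n, (Cmod (lprod (fun x : C => qp x q n) (L t)) <= K)%R).
Proof.
  intros Hq H. induction H as [|h x L l Hx HL [K [HK IH]]].
  - exists 1%R. split; [lra|]. apply filter_forall. intros _ n. simpl. rewrite Cmod_1. lra.
  - pose proof (Cmod_ge_0 x).
    assert (P : (0 <= rqinf (Cmod q) (Cmod x + 1))%R) by (pose proof (rqinf_ge_1 (Cmod q) (Cmod x + 1) Hq); lra).
    exists (rqinf (Cmod q) (Cmod x + 1) * K)%R. split; [now apply Rmult_le_pos|].
    generalize (filter_and _ _ (Cmod_le_1plus F FF h x Hx) IH). apply filter_imp.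
    intros t [A B] n. simpl. rewrite Cmod_mult. apply Rmult_le_compat; auto using Cmod_ge_0.
    eapply Rle_trans; [now apply qp_bound|]. apply rqinf_mono; auto. split; auto. apply Cmod_ge_0.
Qed.

Lemma lprod_qp_inv_bound {T : Type} (F : (T -> Prop) -> Prop) (FF : Filter F) (q : C)
  (L : T -> list C) (l : list C) : (0 < Cmod q < 1)%R -> Clim_list F L l ->
  List.Forall (nonzero_factors q) l ->
  exists K, (0 <= K)%R /\ F (fun t => forall n, (Cmod (/ lprod (fun x : C => qp x q n) (L t)) <= K)%R).
Proof.
  intros Hq H. induction H as [|h x L l Hx HL IH]; intros Hnz.
  - exists 1%R. split; [lra|]. apply filter_forall. intros _ n. simpl.
    rewrite Cmod_inv, Cmod_1 by exact C1_nz. lra.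
  - inversion Hnz as [|? ? Hx' Hl' E]. destruct (IH Hl') as [K [HK HF]]. clear IH.
    pose proof (Cmod_ge_0 x). pose proof (qinf_nz q x Hq Hx') as Hn.
    assert (P0 : (0 < Cmod (qpoch_inf x q))%R) by now apply Cmod_gt_0.
    assert (P : (0 <= rqinf (Cmod q) (Cmod x + 1))%R) by (pose proof (rqinf_ge_1 (Cmod q) (Cmod x + 1) Hq); lra).
    set (K1 := (rqinf (Cmod q) (Cmod x + 1) * / (Cmod (qpoch_inf x q) / 2))%R).
    assert (HK1 : (0 <= K1)%R) by (apply Rmult_le_pos; auto; apply Rlt_le, Rinv_0_lt_compat; lra).
    exists (K1 * K)%R. split; [now apply Rmult_le_pos|].
    generalize (filter_and _ _ (filter_and _ _ (Cmod_le_1plus F FF h x Hx) HF)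
      (filter_and _ _ (nonzero_factors_open F FF q h x Hq Hx' Hx)
         (Clim_nz F FF _ _ Hn (qinf_continuous F FF q h x Hq Hx)))). apply filter_imp.
    intros t [[A B] [A1 B1]] n. simpl. rewrite Cinv_mult, Cmod_mult.
    apply Rmult_le_compat; auto using Cmod_ge_0.
    eapply Rle_trans; [now apply qp_inv_bound|]. unfold K1.
    apply Rmult_le_compat.
    + pose proof (rqinf_ge_1 (Cmod q) (Cmod (h t)) Hq (Cmod_ge_0 _)). lra.
    + apply Rlt_le, Rinv_0_lt_compat. lra.
    + apply rqinf_mono; auto. split; auto. apply Cmod_ge_0.
    + apply Rinv_le_contravar; lra.
Qed.

Lemma lprod_Clim {T : Type} (F : (T -> Prop) -> Prop) (FF : Filter F) (G : C -> C)
  (L : T -> list C) (l : list C) :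
  (forall h x, Clim F h x -> Clim F (fun t => G (h t)) (G x)) -> Clim_list F L l ->
  Clim F (fun t => lprod G (L t)) (lprod G l).
Proof.
  intros HG H. induction H as [|h x L l Hx HL IH]; simpl; [now apply Clim_const|].
  apply Clim_mult; auto.
Qed.

Lemma lprod_qp_nz (q : C) (l : list C) n : List.Forall (nonzero_factors q) l ->
  lprod (fun x : C => qp x q n) l <> 0.
Proof.
  induction 1; simpl; [exact C1_nz|]. apply Cmult_neq_0; auto. now apply qp_nz.
Qed.

(** Near the limit the terms are dominated by a single geometric series, whose ratio lies
    between [|z|] and [1], so that [tannery] applies. *)
Lemma qratio_sum_Clim {T : Type} (F : (T -> Prop) -> Prop) (FF : ProperFilter F) (q : C)
  (N D : T -> list C) (num den : list C) (zf : T -> C) (z : C) : (0 < Cmod q < 1)%R ->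
  Clim_list F N num -> Clim_list F D den -> Clim F zf z -> (Cmod z < 1)%R ->
  List.Forall (nonzero_factors q) den ->
  exists s, has_sum (qratio num den q z) s /\
    Clim F (fun t => usum (qratio (N t) (D t) q (zf t))) s /\
    F (fun t => has_sum (qratio (N t) (D t) q (zf t)) (usum (qratio (N t) (D t) q (zf t)))).
Proof.
  intros Hq HN HD Hz Hz1 Hnz. assert (FF' : Filter F) by apply FF.
  destruct (lprod_qp_bound F _ q N num Hq HN) as [K1 [P1 B1]].
  destruct (lprod_qp_inv_bound F _ q D den Hq HD Hnz) as [K2 [P2 B2]].
  set (rho := ((Cmod z + 1) / 2)%R).
  pose proof (Cmod_ge_0 z) as Hz0.
  assert (Hrho : (0 <= rho < 1)%R) by (unfold rho; lra).
  assert (Bz : F (fun t => (Cmod (zf t) <= rho)%R)).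
  { assert (He : (0 < rho - Cmod z)%R) by (unfold rho; lra).
    generalize (Hz _ He). apply filter_imp. intros t Ht.
    replace (zf t) with (z + (zf t - z)) by ring. eapply Rle_trans; [apply Cmod_triangle|]. lra. }
  set (M := fun n : nat => RtoC (K1 * K2 * rho ^ n)).
  assert (EM : forall n, Cmod (M n) = (K1 * K2 * rho ^ n)%R).
  { intros n. unfold M. rewrite Cmod_R, Rabs_pos_eq; auto.
    apply Rmult_le_pos; [now apply Rmult_le_pos|apply pow_le; lra]. }
  destruct (sum_le_geom M (K1 * K2) rho Hrho) as [B HB]; [intros n; rewrite EM; lra|].
  assert (Hdom : forall (nu de : list C) (z' : C) n,
     (Cmod (lprod (fun x : C => qp x q n) nu) <= K1)%R ->
     (Cmod (/ lprod (fun x : C => qp x q n) de) <= K2)%R -> (Cmod z' <= rho)%R ->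
     (Cmod (qratio nu de q z' n) <= Cmod (M n))%R).
  { intros nu de z' n A1 A2 A3. rewrite EM. unfold qratio, Cdiv. rewrite !Cmod_mult, Cmod_pow.
    apply Rmult_le_compat.
    - apply Rmult_le_pos; apply Cmod_ge_0.
    - apply pow_le, Cmod_ge_0.
    - apply Rmult_le_compat; auto using Cmod_ge_0.
    - apply pow_incr. split; auto. apply Cmod_ge_0. }
  assert (HL : forall n, Clim F (fun t => qratio (N t) (D t) q (zf t) n) (qratio num den q z n)).
  { intros n. unfold qratio, Cdiv. apply Clim_mult; auto.
    - apply Clim_mult; auto.
      + apply lprod_Clim; auto. intros h x Hh. now apply Clim_qp.
      + apply Clim_inv; auto; [now apply lprod_qp_nz|].
        apply lprod_Clim; auto. intros h x Hh. now apply Clim_qp.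
    - now apply Clim_pow. }
  assert (Bt : F (fun t => forall n, (Cmod (qratio (N t) (D t) q (zf t) n) <= Cmod (M n))%R)).
  { generalize (filter_and _ _ (filter_and _ _ B1 B2) Bz). apply filter_imp.
    intros t [[A1 A2] A3] n. now apply Hdom. }
  assert (HS : F (fun t => has_sum (qratio (N t) (D t) q (zf t)) (usum (qratio (N t) (D t) q (zf t))))).
  { revert Bt. apply filter_imp. intros t Ht. apply usum_correct with B.
    revert HB. now apply sum_le_dom. }
  assert (BL : forall n, (Cmod (qratio num den q z n) <= Cmod (M n))%R).
  { intros n. replace (qratio num den q z n) with (qratio num den q z n - 0) by ring.
    apply (Clim_dist_le F FF _ _ _ _ (HL n)). revert Bt. apply filter_imp. intros t Ht.
    replace (qratio (N t) (D t) q (zf t) n - 0) with (qratio (N t) (D t) q (zf t) n) by ring. auto. }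
  assert (HB' : sum_le (qratio num den q z) B) by (revert HB; now apply sum_le_dom).
  destruct (sum_le_has_sum _ _ HB') as [s Hs]. exists s. split; [|split]; auto.
  now apply (tannery F _ (fun t => qratio (N t) (D t) q (zf t)) (qratio num den q z) M _ _ B).
Qed.

(** * The identity for parameters in general position *)

Lemma qp_shift1 (q x : C) n : qp (q * x) q n * (1 - x) = qp x q n * (1 - x * q ^ n).
Proof. rewrite <- qp_S, qp_S_l, (Cmult_comm q x). ring. Qed.

(** The quotient of the factors that come from the square roots [s] and [- s] of the base. *)
Lemma qp_sqrt (q s : C) n :
  qp (q * s) q n * qp (- (q * s)) q n * (1 - s * s)
  = qp s q n * qp (- s) q n * (1 - s * s * (q ^ n * q ^ n)).
Proof.
  pose proof (qp_shift1 q s n) as E1. pose proof (qp_shift1 q (- s) n) as E2.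
  replace (q * - s) with (- (q * s)) in E2 by ring.
  transitivity ((qp (q * s) q n * (1 - s)) * (qp (- (q * s)) q n * (1 - - s))); [ring|].
  rewrite E1, E2. ring.
Qed.

Lemma phi_has_sum (num den : list C) (q z s : C) :
  has_sum (qratio num (q :: den) q z) s -> phi num den q z = s.
Proof.
  intros H. apply (@iota_unique C_AbsRing C_CompleteNormedModule).
  - intros t Ht. apply (@filterlim_locally_unique nat C_AbsRing C_NormedModule eventually _
      (sum_n (phi_term num den q z))); auto.
    apply has_sum_series. eapply has_sum_ext; [|exact H]. intros n. now rewrite phi_term_qratio.
  - apply has_sum_series. eapply has_sum_ext; [|exact H]. intros n. now rewrite phi_term_qratio.
Qed.

Lemma nonzero_factors_1 (q x : C) : nonzero_factors q x -> 1 - x <> 0.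
Proof. intros H. specialize (H O). simpl in H. now rewrite Cmult_1_r in H. Qed.

Lemma nonzero_factors_S (q x : C) : 1 - x <> 0 -> nonzero_factors q (x * q) -> nonzero_factors q x.
Proof.
  intros H0 H [|i].
  - simpl. now rewrite Cmult_1_r.
  - specialize (H i). rewrite Cpow_S. now rewrite <- Cmult_assoc in H.
Qed.

Ltac nonzero :=
  unfold Cdiv;
  repeat first [assumption | exact C1_nz | apply Cmult_neq_0 | apply Cinv_nz | apply Copp_nz | apply Cpow_nz].

Definition wsum_params (s b c d e f g : C) : list C :=
  s / b :: s / c :: s / d :: s / e :: s / f :: s / g :: nil.

(** At the point [x = f / s] the factor [(q^(1+k); q)_oo] kills all terms with [k < 0], and the
    others form the 8-phi-7 with base [A = f^2 / a], which Bailey's transformation carries to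
    the base [lambda]. *)
Lemma wsum_at_param (q s b c d e f g sl : C) : (0 < Cmod q < 1)%R ->
  s <> 0 -> b <> 0 -> c <> 0 -> d <> 0 -> e <> 0 -> f <> 0 -> g <> 0 ->
  let a := s ^ 2 in
  sl ^ 2 = lambda q a d e f g ->
  nonzero_factors q (lambda q a d e f g) ->
  List.Forall (nonzero_factors q) (phi_den q a b c d e f g sl) ->
  nonzero_factors q (f * f / a) -> nonzero_factors q (q * f / b) -> nonzero_factors q (q * f / c) ->
  (Cmod (psi_arg q a b c d e f g) < 1)%R -> (Cmod (phi_arg q a b c) < 1)%R ->
  wsum q (wsum_params s b c d e f g) (f / s)
  * (qpoch_inf (psi_arg q a b c d e f g) q * qpoch_inf (q ^ 2 * a * f / (d * e * g)) q
     * qpoch_inf (q * f / b) q * qpoch_inf (q * f / c) q)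
  = - (s / f) * (1 - f * f / a) * wprod q (wsum_params s b c d e f g) (f / s)
    * (phi (phi_num q a b c d e f g sl) (phi_den q a b c d e f g sl) q (phi_arg q a b c)
       * (qpoch_inf (f * f / a * q) q * qpoch_inf (phi_arg q a b c) q
          * qpoch_inf (q ^ 2 * a ^ 2 / (b * d * e * g)) q * qpoch_inf (q ^ 2 * a ^ 2 / (c * d * e * g)) q)).
Proof.
  intros Hq Hs Hb Hc Hd He Hf Hg a Hsl Hlam Hden HA HAb HAc Hz1 Hz2.
  pose proof (Cmod_q_nz q Hq) as Hq0. pose proof (nonzero_factors_q q Hq) as Hqq.
  set (l := lambda q a d e f g) in *.
  set (x := q * a / (d * e)). set (y := q * a / (d * g)). set (w := q * a / (e * g)).
  set (r := f * f / a / l). set (E := b * f / a). set (F := c * f / a).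
  assert (Ha : a <> 0) by (unfold a; now apply Cpow_nz).
  assert (Hl : l <> 0).
  { unfold l, lambda. nonzero. }
  assert (Hx : x <> 0 /\ y <> 0 /\ w <> 0 /\ E <> 0 /\ F <> 0).
  { unfold x, y, w, E, F. repeat split; nonzero. }
  destruct Hx as [Hx [Hy [Hw [HE HF]]]].
  assert (Elr : l * r = f * f / a) by (unfold r; field; auto).
  assert (Exr : x * r = g * f / a) by (unfold x, r, l, lambda; field; repeat split; auto).
  assert (Eyr : y * r = e * f / a) by (unfold y, r, l, lambda; field; repeat split; auto).
  assert (Ewr : w * r = d * f / a) by (unfold w, r, l, lambda; field; repeat split; auto).
  assert (Er : r = q * l / (x * y * w)).
  { unfold x, y, w, r, l, lambda. field; repeat split; auto. }
  assert (Elx : l * q / x = q * f / g) by (unfold x, l, lambda; field; repeat split; auto).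
  assert (Ely : l * q / y = q * f / e) by (unfold y, l, lambda; field; repeat split; auto).
  assert (Elw : l * q / w = q * f / d) by (unfold w, l, lambda; field; repeat split; auto).
  assert (ElE : l * q / E = q ^ 2 * a ^ 2 / (b * d * e * g)) by (unfold E, l, lambda; field; repeat split; auto).
  assert (ElF : l * q / F = q ^ 2 * a ^ 2 / (c * d * e * g)) by (unfold F, l, lambda; field; repeat split; auto).
  assert (EAE : l * r * q / E = q * f / b) by (rewrite Elr; unfold E; field; repeat split; auto).
  assert (EAF : l * r * q / F = q * f / c) by (rewrite Elr; unfold F; field; repeat split; auto).
  assert (Ez1 : l * q / (E * F) = psi_arg q a b c d e f g).
  { unfold E, F, l, lambda, psi_arg. field; repeat split; auto. }
  assert (Ez2 : l * r * q / (E * F) = phi_arg q a b c).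
  { rewrite Elr. unfold E, F, phi_arg. field; repeat split; auto. }
  assert (Elq : l * q = q ^ 2 * a * f / (d * e * g)) by (unfold l, lambda; field; repeat split; auto).
  inversion Hden as [|? ? D1 Hden1]; subst. inversion Hden1 as [|? ? D2 Hden2]; subst.
  inversion Hden2 as [|? ? D3 Hden3]; subst. inversion Hden3 as [|? ? D4 Hden4]; subst.
  inversion Hden4 as [|? ? D5 Hden5]; subst. inversion Hden5 as [|? ? D6 Hden6]; subst.
  inversion Hden6 as [|? ? D7 Hden7]; subst. clear Hden Hden1 Hden2 Hden3 Hden4 Hden5 Hden6 Hden7.
  destruct (vwp_transform q l x y w r E F) as [S [t [HS [Ht EQ]]]]; auto;
    try (rewrite ?EAE, ?EAF, ?Ez1, ?Ez2, ?Elr, ?Elx, ?Ely, ?Elw, ?ElE, ?ElF; assumption).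
  rewrite Ez1, Ez2, EAE, EAF, ElE, ElF, Elq in EQ. rewrite Elr in EQ.
  assert (Ephi : phi (phi_num q a b c d e f g sl) (phi_den q a b c d e f g sl) q (phi_arg q a b c) = t).
  { apply phi_has_sum. revert Ht. apply has_sum_ext. intros n. rewrite Ez2.
    unfold vw, efac, qratio, phi_num, phi_den. fold l. rewrite Elx, Ely, Elw, ElE, ElF.
    rewrite !lprod_cons. cbn [lprod fold_right]. fold x y w. fold E F.
    pose proof (qp_sqrt q sl n) as Esq. replace (sl * sl) with l in Esq by (rewrite <- Hsl; ring).
    pose proof (nonzero_factors_1 q l Hlam) as L1.
    pose proof (qp_nz _ _ n D1) as N1. pose proof (qp_nz _ _ n D2) as N2.
    pose proof (qp_nz _ _ n D3) as N3. pose proof (qp_nz _ _ n D4) as N4.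
    pose proof (qp_nz _ _ n D5) as N5. pose proof (qp_nz _ _ n D6) as N6.
    pose proof (qp_nz _ _ n D7) as N7. pose proof (qp_nz _ _ n Hqq) as N8.
    replace (1 - l * (q ^ n * q ^ n)) with (qp (q * sl) q n * qp (- (q * sl)) q n * (1 - l)
       / (qp sl q n * qp (- sl) q n)) by (rewrite Esq; field; auto).
    field. repeat split; auto. }
  set (p := f / s). assert (Hp : p <> 0) by (unfold p; nonzero).
  set (ss := wsum_params s b c d e f g).
  assert (Hss : List.Forall (fun s : C => s <> 0) ss).
  { unfold ss, wsum_params. repeat (constructor; [nonzero|]). constructor. }
  assert (Epp : p * p = f * f / a) by (unfold p, a; field; auto).
  assert (K1 : forall t : C, t <> 0 -> q * (s / t) * p = q * f / t) by (intros; unfold p; field; auto).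
  assert (K2 : forall t : C, t <> 0 -> p / (s / t) = t * f / a) by (intros; unfold p, a; field; auto).
  assert (W : has_sum (wp_term q (wpoised q ss) p)
     (- (s / f) * (1 - f * f / a) * wprod q ss p * S)).
  { apply (has_sum_inj Z.of_nat); [intros; lia| |].
    - intros k. destruct (Z_le_dec 0 k) as [H|H].
      + left. exists (Z.to_nat k). lia.
      + right. unfold wp_term, wpoised.
        assert (E0 : qpoch_inf (q * (s / f) * (p * Czpow q k)) q = 0).
        { apply (qinf_zero q _ (Z.to_nat (- k - 1))); auto.
          rewrite <- Czpow_nat.
          replace (q * (s / f) * (p * Czpow q k)) with (Czpow q 1 * Czpow q k)
            by (rewrite Czpow_1_r; unfold p; field; auto).
          rewrite <- !Czpow_add by auto.
          replace (1 + k + Z.of_nat (Z.to_nat (- k - 1)))%Z with 0%Z by lia. simpl. ring. }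
        unfold wprod, ss, wsum_params. cbn [fold_right]. rewrite E0. ring.
    - eapply has_sum_ext; [|apply has_sum_scal, HS]. intros n. cbv beta.
      pose proof (wp_term_nat q ss p n Hq Hp Hss eq_refl) as EW.
      unfold ss at 2 4 5, wsum_params in EW. rewrite !lprod_cons in EW.
      cbn [lprod fold_right] in EW. rewrite Epp in EW.
      rewrite !K1, !K2 in EW by assumption. replace (q * f / f) with q in EW by (field; auto).
      fold E F in EW.
      replace (q ^ 2 * (s / b * (s / c * (s / d * (s / e * (s / f * (s / g * 1)))))))
        with (psi_arg q a b c d e f g) in EW by (unfold psi_arg, a; field; repeat split; auto).
      replace (- / p) with (- (s / f)) in EW by (unfold p; field; auto).
      unfold vw, efac. rewrite EAE, EAF, Exr, Eyr, Ewr, Elr, Ez1.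
      replace (f * f / a * q / (g * f / a)) with (q * f / g) by (field; auto).
      replace (f * f / a * q / (e * f / a)) with (q * f / e) by (field; auto).
      replace (f * f / a * q / (d * f / a)) with (q * f / d) by (field; auto).
      pose proof (nonzero_factors_1 q _ HA) as A1.
      pose proof (qp_nz _ _ n D3) as N3. pose proof (qp_nz _ _ n D4) as N4.
      pose proof (qp_nz _ _ n D5) as N5. pose proof (qp_nz _ _ n Hqq) as N8.
      pose proof (qp_nz _ _ n HAb) as N6. pose proof (qp_nz _ _ n HAc) as N7.
      match type of EW with ?u * ?v = ?w => assert (EW' : u = w / v) end.
      { rewrite <- EW. field. repeat split; auto. }
      rewrite EW'. set (A := f * f / a) in *.
      field. repeat split; auto. }
  unfold wsum. rewrite (usum_eq _ _ W), Ephi, <- Cmult_assoc, EQ. reflexivity.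
Qed.

Lemma wsum_params_nz (s b c d e f g : C) :
  s <> 0 -> b <> 0 -> c <> 0 -> d <> 0 -> e <> 0 -> f <> 0 -> g <> 0 ->
  List.Forall (fun s : C => s <> 0) (wsum_params s b c d e f g).
Proof. intros. unfold wsum_params. repeat (constructor; [nonzero|]). constructor. Qed.

Lemma wsum_params_arg (q s b c d e f g : C) :
  s <> 0 -> b <> 0 -> c <> 0 -> d <> 0 -> e <> 0 -> f <> 0 -> g <> 0 ->
  q ^ 2 * lprod (fun s : C => s) (wsum_params s b c d e f g) = psi_arg q (s ^ 2) b c d e f g.
Proof. intros. unfold wsum_params, psi_arg. simpl. field. repeat split; auto. Qed.

Lemma psi_term_opp (q s b c d e f g : C) (n : nat) : q <> 0 ->
  s <> 0 -> b <> 0 -> c <> 0 -> d <> 0 -> e <> 0 -> f <> 0 -> g <> 0 ->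
  let a := s ^ 2 in
  psi_term (psi_num q b c d e f g s) (psi_den q a b c d e f g s) q (psi_arg q a b c d e f g)
    (- Z.of_nat n) =
  qratio (map (fun x => q / x) (psi_den q a b c d e f g s))
    (map (fun x => q / x) (psi_num q b c d e f g s)) q (psi_arg q a b c d e f g) n.
Proof.
  intros Hq0 Hs Hb Hc Hd He Hf Hg a.
  assert (Ha : a <> 0) by (unfold a; now apply Cpow_nz).
  rewrite psi_term_neg; auto;
    try (unfold psi_num, psi_den, psi_arg; repeat (constructor; [nonzero|]); try constructor; nonzero).
  f_equal. unfold psi_den, psi_num, psi_arg, a. simpl. field. repeat split; auto.
Qed.

(** At [x = sqrt a] the parameters [x / s] of [wpoised] are [b], ..., [g].  Negative indices
    reduce to positive ones by the symmetry [x -> 1/x]. *)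
Lemma wp_term_psi (q s b c d e f g : C) (k : Z) : (0 < Cmod q < 1)%R ->
  s <> 0 -> b <> 0 -> c <> 0 -> d <> 0 -> e <> 0 -> f <> 0 -> g <> 0 ->
  let a := s ^ 2 in
  List.Forall (nonzero_factors q) (psi_den q a b c d e f g s) ->
  List.Forall (nonzero_factors q) (map (fun x => q / x) (psi_num q b c d e f g s)) ->
  wp_term q (wpoised q (wsum_params s b c d e f g)) s k =
  - / s * (1 - a) * wprod q (wsum_params s b c d e f g) s
  * psi_term (psi_num q b c d e f g s) (psi_den q a b c d e f g s) q (psi_arg q a b c d e f g) k.
Proof.
  intros Hq Hs Hb Hc Hd He Hf Hg a Hden Hnum.
  pose proof (Cmod_q_nz q Hq) as Hq0.
  assert (Ha : a <> 0) by (unfold a; now apply Cpow_nz).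
  pose proof (wsum_params_nz s b c d e f g Hs Hb Hc Hd He Hf Hg) as Hss.
  pose proof (wsum_params_arg q s b c d e f g Hs Hb Hc Hd He Hf Hg) as Earg. fold a in Earg.
  set (z := psi_arg q a b c d e f g) in *.
  assert (Hz : z <> 0) by (unfold z, psi_arg; nonzero).
  set (ss := wsum_params s b c d e f g) in *.
  assert (Ess : s * s = a) by (unfold a; ring).
  pose proof (Forall_inv Hden) as D1. pose proof (Forall_inv (Forall_inv_tail Hden)) as D2.
  assert (A1 : 1 - a <> 0).
  { replace (1 - a) with ((1 - s) * (1 - - s)) by (unfold a; ring).
    apply Cmult_neq_0; now apply (nonzero_factors_1 q). }
  assert (K1 : forall t : C, t <> 0 -> q * (s / t) * s = q * a / t) by (intros; unfold a; field; auto).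
  assert (K2 : forall t : C, t <> 0 -> s / (s / t) = t) by (intros; field; auto).
  assert (K3 : forall t : C, t <> 0 -> q * (s / t) * / s = q / t) by (intros; field; auto).
  assert (K4 : forall t : C, t <> 0 -> / s / (s / t) = q / (q * a / t)).
  { intros. unfold a. field. auto. }
  destruct (Z_le_dec 0 k) as [Hk|Hk].
  - replace k with (Z.of_nat (Z.to_nat k)) by lia. set (n := Z.to_nat k).
    pose proof (wp_term_nat q ss s n Hq Hs Hss eq_refl) as EW.
    rewrite Earg, Ess in EW. unfold ss at 2 4, wsum_params in EW. rewrite !lprod_cons in EW.
    cbn [lprod fold_right] in EW.
    rewrite !K1, !K2 in EW by assumption.
    rewrite psi_term_nat. unfold qratio, psi_num, psi_den. rewrite !lprod_cons.
    cbn [lprod fold_right].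
    pose proof (qp_sqrt q s n) as Esq. rewrite Ess in Esq.
    pose proof (lprod_qp_nz q _ n Hden) as Hdn. unfold psi_den in Hdn. rewrite !lprod_cons in Hdn.
    cbn [lprod fold_right] in Hdn.
    pose proof (qp_nz _ _ n D1) as N1. pose proof (qp_nz _ _ n D2) as N2.
    set (P := qp (q * a / b) q n * (qp (q * a / c) q n * (qp (q * a / d) q n *
       (qp (q * a / e) q n * (qp (q * a / f) q n * (qp (q * a / g) q n * 1)))))) in *.
    assert (HP : P <> 0) by (intros E; apply Hdn; rewrite E; ring).
    match type of EW with ?u * ?v = ?w => assert (EW' : u = w / v) end.
    { rewrite <- EW. field. auto. }
    rewrite EW'.
    replace (1 - a * (q ^ n * q ^ n)) with (qp (q * s) q n * qp (- (q * s)) q n * (1 - a)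
       / (qp s q n * qp (- s) q n)) by (rewrite Esq; field; auto).
    field. repeat split; auto.
  - replace k with (- Z.of_nat (Z.to_nat (- k)))%Z by lia. set (n := Z.to_nat (- k)).
    rewrite wp_term_opp by auto.
    assert (His : / s <> 0) by now apply Cinv_nz.
    pose proof (wp_term_nat q ss (/ s) n Hq His Hss eq_refl) as EW.
    rewrite Earg, wprod_inv in EW by auto.
    unfold ss at 2 4, wsum_params in EW. rewrite !lprod_cons in EW.
    cbn [lprod fold_right] in EW.
    rewrite !K3, !K4 in EW by assumption.
    unfold z at 1. unfold a at 1 2 3. rewrite psi_term_opp by auto. fold a. fold z.
    pose proof (lprod_qp_nz q _ n Hnum) as Hdn.
    pose proof (Forall_inv Hnum) as M1. pose proof (Forall_inv (Forall_inv_tail Hnum)) as M2.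
    cbv beta in M1, M2.
    unfold qratio.
    unfold psi_num, psi_den in *. cbn [map] in *. rewrite !lprod_cons in *.
    cbn [lprod fold_right] in *.
    replace (q / (q * s)) with (/ s) in * by (field; auto).
    replace (q / - (q * s)) with (- / s) in * by (field; auto).
    replace (q / s) with (q * / s) by (field; auto).
    replace (q / - s) with (- (q * / s)) by (field; auto).
    pose proof (qp_sqrt q (/ s) n) as Esq.
    pose proof (qp_nz _ _ n M1) as N1. pose proof (qp_nz _ _ n M2) as N2.
    set (P := qp (q / b) q n * (qp (q / c) q n * (qp (q / d) q n *
       (qp (q / e) q n * (qp (q / f) q n * (qp (q / g) q n * 1)))))) in *.
    assert (HP : P <> 0) by (intros E; apply Hdn; rewrite E; ring).
    match type of EW with ?u * ?v = ?w => assert (EW' : u = w / v) end.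
    { rewrite <- EW. field. auto. }
    rewrite EW'.
    replace (1 - / s * / s * (q ^ n * q ^ n)) with (qp (q * / s) q n * qp (- (q * / s)) q n * (1 - / s * / s)
       / (qp (/ s) q n * qp (- / s) q n)) by (rewrite Esq; field; auto).
    unfold a. field. repeat split; auto.
Qed.

Lemma wsum_swap (q s b c d e f g : C) : (0 < Cmod q < 1)%R ->
  s <> 0 -> b <> 0 -> c <> 0 -> d <> 0 -> e <> 0 -> f <> 0 -> g <> 0 ->
  (Cmod (psi_arg q (s ^ 2) b c d e f g) < 1)%R -> forall x : C, x <> 0 ->
  wsum q (wsum_params s b c d e g f) x = wsum q (wsum_params s b c d e f g) x.
Proof.
  intros Hq Hs Hb Hc Hd He Hf Hg Hz x Hx. apply usum_eq.
  eapply has_sum_ext; [|apply wsum_correct; auto].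
  - intros k. unfold wp_term, wpoised, wprod, wsum_params. simpl. ring.
  - fold (@lprod C (fun s => s) (wsum_params s b c d e f g)).
    change (fold_right Cmult 1 (wsum_params s b c d e f g)) with (lprod (fun s : C => s) (wsum_params s b c d e f g)).
    now rewrite wsum_params_arg.
Qed.

(** The values that have to be kept off the powers of [q], besides those occurring in the
    denominators of the theorem, for the 8-phi-7 with base [f^2 / a] to be defined and for the
    theta functions at [f / s] not to vanish. *)
Definition generic_params (q a b c f g : C) : list C :=
  f * f / a :: q * a / (f * f) :: q * a / (f * g) :: q * f / b :: q * f / c :: nil.

Lemma theta_nz (q z : C) : (0 < Cmod q < 1)%R -> nonzero_factors q z -> nonzero_factors q (q / z) ->
  theta q z <> 0.
Proof. intros Hq H1 H2. apply Cmult_neq_0; now apply qinf_nz. Qed.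

Lemma theta_pair_nz (q p r : C) : (0 < Cmod q < 1)%R -> r <> 0 ->
  theta q (p * r) <> 0 -> theta q (p / r) <> 0 -> theta q (r * r) <> 0 -> theta_pair q p r <> 0.
Proof.
  intros Hq Hr H1 H2 H3. pose proof (qinf_nz q q Hq (nonzero_factors_q q Hq)).
  unfold theta_pair. nonzero.
Qed.

(** The coordinate of the bilateral sum on one of the two basis functions.  All products that
    involve [f^2 / a], [q f / b] or [q f / c] cancel in it. *)
Lemma branch (q s b c d e f g sl : C) : (0 < Cmod q < 1)%R ->
  s <> 0 -> b <> 0 -> c <> 0 -> d <> 0 -> e <> 0 -> f <> 0 -> g <> 0 ->
  let a := s ^ 2 in
  sl ^ 2 = lambda q a d e f g -> 1 - a <> 0 ->
  List.Forall (nonzero_factors q) (T_den q a b c d e f g) ->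
  List.Forall (nonzero_factors q) (phi_den q a b c d e f g sl) ->
  List.Forall (nonzero_factors q) (generic_params q a b c f g) ->
  nonzero_factors q (q / g) -> nonzero_factors q (q * a / g) ->
  (Cmod (psi_arg q a b c d e f g) < 1)%R -> (Cmod (phi_arg q a b c) < 1)%R ->
  wsum q (wsum_params s b c d e f g) (f / s) * theta_pair q (g / s) s =
  theta_pair q (g / s) (f / s) *
   (- / s * (1 - a) * wprod q (wsum_params s b c d e f g) s * T q a b c d e f g sl).
Proof.
  intros Hq Hs Hb Hc Hd He Hf Hg a Hsl A1 HT Hphi Hgen Hqg Hqag Hz1 Hz2.
  pose proof (Cmod_q_nz q Hq) as Hq0. pose proof (nonzero_factors_q q Hq) as Hqq.
  assert (Ha : a <> 0) by (unfold a; now apply Cpow_nz).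
  unfold T_den in HT. unfold generic_params in Hgen.
  repeat match goal with H : List.Forall _ (_ :: _) |- _ =>
    let H1 := fresh "NT" in pose proof (Forall_inv H) as H1; apply Forall_inv_tail in H end.
  match goal with H : nonzero_factors q (q ^ 2 * a * f / (d * e * g)) |- _ => rename H into Nlq end.
  match goal with H : nonzero_factors q (q ^ 2 * a ^ 3 / _) |- _ => rename H into Nz end.
  match goal with H : nonzero_factors q (f * f / a) |- _ => rename H into NA end.
  match goal with H : nonzero_factors q (q * f / b) |- _ => rename H into NAb end.
  match goal with H : nonzero_factors q (q * f / c) |- _ => rename H into NAc end.
  assert (Nl : nonzero_factors q (lambda q a d e f g)).
  { apply nonzero_factors_S.
    - rewrite <- Hsl. replace (1 - sl ^ 2) with ((1 - sl) * (1 - - sl)) by ring.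
      unfold phi_den in Hphi.
      apply Cmult_neq_0; apply (nonzero_factors_1 q);
        [exact (Forall_inv Hphi)|exact (Forall_inv (Forall_inv_tail Hphi))].
    - replace (lambda q a d e f g * q) with (q ^ 2 * a * f / (d * e * g)); auto.
      unfold lambda. field. auto. }
  pose proof (wsum_at_param q s b c d e f g sl Hq Hs Hb Hc Hd He Hf Hg Hsl Nl Hphi NA NAb NAc Hz1 Hz2) as W.
  fold a in W.
  assert (Nqfg : nonzero_factors q (q * f / g)).
  { exact (Forall_inv (Forall_inv_tail (Forall_inv_tail Hphi))). }
  pose proof (nonzero_factors_1 q _ NA) as NA1.
  assert (NAq : nonzero_factors q (f * f / a * q)).
  { replace (f * f / a * q) with (f * f / a * q ^ 1) by (simpl; ring). now apply nonzero_factors_shift. }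
  set (A := f * f / a) in *.
  assert (Es : theta_pair q (g / s) s =
    qpoch_inf g q * qpoch_inf (q / g) q * (qpoch_inf (g / a) q * qpoch_inf (q * a / g) q)
    * (- / s * (qpoch_inf q q * ((1 - a) * qpoch_inf (q * a) q * qpoch_inf (q / a) q)))).
  { unfold theta_pair, theta.
    replace (g / s * s) with g by (field; auto).
    replace (g / s / s) with (g / a) by (unfold a; field; auto).
    replace (q / (g / a)) with (q * a / g) by (field; auto).
    replace (s * s) with a by (unfold a; ring).
    rewrite (qinf_rec q a), (Cmult_comm a q) by auto. ring. }
  assert (Ep : theta_pair q (g / s) (f / s) =
    qpoch_inf (f * g / a) q * qpoch_inf (q * a / (f * g)) q * (qpoch_inf (g / f) q * qpoch_inf (q * f / g) q)
    * (- (s / f) * (qpoch_inf q q * ((1 - A) * qpoch_inf (A * q) q * qpoch_inf (q * a / (f * f)) q)))).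
  { unfold theta_pair, theta.
    replace (g / s * (f / s)) with (f * g / a) by (unfold a; field; auto).
    replace (g / s / (f / s)) with (g / f) by (field; auto).
    replace (q / (f * g / a)) with (q * a / (f * g)) by (field; auto).
    replace (q / (g / f)) with (q * f / g) by (field; auto).
    replace (f / s * (f / s)) with A by (unfold A, a; field; auto).
    replace (q / A) with (q * a / (f * f)) by (unfold A; field; auto).
    rewrite (qinf_rec q A) by auto.
    replace (/ (f / s)) with (s / f) by (field; auto). ring. }
  assert (Ews : wprod q (wsum_params s b c d e f g) s =
    qpoch_inf (q * a / b) q * qpoch_inf (q / b) q * (qpoch_inf (q * a / c) q * qpoch_inf (q / c) q)
    * (qpoch_inf (q * a / d) q * qpoch_inf (q / d) q) * (qpoch_inf (q * a / e) q * qpoch_inf (q / e) q)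
    * (qpoch_inf (q * a / f) q * qpoch_inf (q / f) q) * (qpoch_inf (q * a / g) q * qpoch_inf (q / g) q)).
  { assert (K : forall t : C, t <> 0 -> q * (s / t) * s = q * a / t) by (intros; unfold a; field; auto).
    assert (K' : forall t : C, t <> 0 -> q * (s / t) * / s = q / t) by (intros; field; auto).
    unfold wprod, wsum_params. cbn [fold_right].
    rewrite !K, !K' by assumption. ring. }
  assert (Ewp : wprod q (wsum_params s b c d e f g) (f / s) =
    qpoch_inf (q * f / b) q * qpoch_inf (q * a / (b * f)) q
    * (qpoch_inf (q * f / c) q * qpoch_inf (q * a / (c * f)) q)
    * (qpoch_inf (q * f / d) q * qpoch_inf (q * a / (d * f)) q)
    * (qpoch_inf (q * f / e) q * qpoch_inf (q * a / (e * f)) q)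
    * (qpoch_inf q q * qpoch_inf (q * a / (f * f)) q)
    * (qpoch_inf (q * f / g) q * qpoch_inf (q * a / (f * g)) q)).
  { assert (K : forall t : C, t <> 0 -> q * (s / t) * (f / s) = q * f / t) by (intros; field; auto).
    assert (K' : forall t : C, t <> 0 -> q * (s / t) * / (f / s) = q * a / (t * f)).
    { intros. unfold a. field. auto. }
    unfold wprod, wsum_params. cbn [fold_right].
    rewrite !K, !K' by assumption.
    replace (q * f / f) with q by (field; auto). rewrite (Cmult_comm g f). ring. }
  rewrite Ewp in W. rewrite Es, Ep, Ews.
  unfold T, T_num, T_den. cbn [qpochs_inf fold_right].
  unfold psi_arg, phi_arg in *.
  set (Phi := phi _ _ _ _) in *.
  repeat match goal with H : nonzero_factors q _ |- _ => apply (qinf_nz q _ Hq) in H end.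
  match type of W with ?u * ?v = ?w => assert (W' : u = w / v) end.
  { rewrite <- W. field. repeat split; auto. }
  rewrite W'.
  clear W W' Es Ep Ews Ewp.
  field. repeat split; auto.
Qed.

(** The determinant relation [wsum_three_term] at the points [s], [f / s], [g / s], with both
    coordinates evaluated by [branch]. *)
Lemma psi_generic (q s b c d e f g sl sl' : C) : (0 < Cmod q < 1)%R ->
  s <> 0 -> b <> 0 -> c <> 0 -> d <> 0 -> e <> 0 -> f <> 0 -> g <> 0 ->
  let a := s ^ 2 in
  sl ^ 2 = lambda q a d e f g -> sl' ^ 2 = lambda q a d e g f ->
  List.Forall (nonzero_factors q) (psi_den q a b c d e f g s) ->
  List.Forall (nonzero_factors q) (map (fun x => q / x) (psi_num q b c d e f g s)) ->
  List.Forall (nonzero_factors q) (T_den q a b c d e f g) ->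
  List.Forall (nonzero_factors q) (T_den q a b c d e g f) ->
  List.Forall (nonzero_factors q) (phi_den q a b c d e f g sl) ->
  List.Forall (nonzero_factors q) (phi_den q a b c d e g f sl') ->
  List.Forall (nonzero_factors q) (generic_params q a b c f g) ->
  List.Forall (nonzero_factors q) (generic_params q a b c g f) ->
  (Cmod (psi_arg q a b c d e f g) < 1)%R -> (Cmod (phi_arg q a b c) < 1)%R ->
  has_sum (psi_term (psi_num q b c d e f g s) (psi_den q a b c d e f g s) q (psi_arg q a b c d e f g))
    (T q a b c d e f g sl + T q a b c d e g f sl').
Proof.
  intros Hq Hs Hb Hc Hd He Hf Hg a Hsl Hsl' Hpd Hpn HT HT' Hphi Hphi' Hgen Hgen' Hz1 Hz2.
  pose proof (Cmod_q_nz q Hq) as Hq0.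
  assert (Ha : a <> 0) by (unfold a; now apply Cpow_nz).
  assert (Hz1' : (Cmod (psi_arg q a b c d e g f) < 1)%R).
  { replace (psi_arg q a b c d e g f) with (psi_arg q a b c d e f g); auto.
    unfold psi_arg. f_equal. ring. }
  assert (A1 : 1 - a <> 0).
  { replace (1 - a) with ((1 - s) * (1 - - s)) by (unfold a; ring).
    apply Cmult_neq_0; apply (nonzero_factors_1 q);
      [exact (Forall_inv Hpd)|exact (Forall_inv (Forall_inv_tail Hpd))]. }
  set (ss := wsum_params s b c d e f g).
  assert (Hss1 : (Cmod (q ^ 2 * fold_right Cmult 1 ss) < 1)%R).
  { change (fold_right Cmult 1 ss) with (lprod (fun s : C => s) ss).
    unfold ss. now rewrite wsum_params_arg. }
  assert (Hp : f / s <> 0) by nonzero. assert (Hr : g / s <> 0) by nonzero.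
  pose proof (wsum_three_term q ss s (f / s) (g / s) Hq Hs Hp Hr eq_refl Hss1) as E3.
  pose proof HT as HTl. pose proof HT' as HTl'. pose proof Hgen as Hgl. pose proof Hgen' as Hgl'.
  unfold T_den in HTl, HTl'. unfold generic_params in Hgl, Hgl'.
  repeat match goal with H : List.Forall _ (_ :: _) |- _ =>
    match H with HTl => idtac | HTl' => idtac | Hgl => idtac | Hgl' => idtac end;
    let H1 := fresh "NT" in pose proof (Forall_inv H) as H1; apply Forall_inv_tail in H end.
  assert (Nqfg : nonzero_factors q (q * f / g)) by exact (Forall_inv (Forall_inv_tail (Forall_inv_tail Hphi))).
  assert (Nqgf : nonzero_factors q (q * g / f)) by exact (Forall_inv (Forall_inv_tail (Forall_inv_tail Hphi'))).
  assert (B1 := branch q s b c d e f g sl Hq Hs Hb Hc Hd He Hf Hg Hsl A1 HT Hphi Hgen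
     ltac:(assumption) ltac:(assumption) Hz1 Hz2).
  assert (B2 := branch q s b c d e g f sl' Hq Hs Hb Hc Hd He Hg Hf Hsl' A1 HT' Hphi' Hgen'
     ltac:(assumption) ltac:(assumption) Hz1' Hz2).
  rewrite (wsum_swap q s b c d e f g) in B2 by auto.
  assert (Ewp : wprod q (wsum_params s b c d e g f) s = wprod q ss s).
  { unfold ss, wprod, wsum_params. simpl. ring. }
  rewrite Ewp in B2. fold ss in B1, B2. fold a in B1, B2.
  assert (Th1 : theta_pair q (g / s) (f / s) <> 0).
  { apply theta_pair_nz; auto.
    - replace (g / s * (f / s)) with (f * g / a) by (unfold a; field; auto).
      apply theta_nz; auto.
      replace (q / (f * g / a)) with (q * a / (f * g)) by (field; auto). assumption.
    - replace (g / s / (f / s)) with (g / f) by (field; auto). apply theta_nz; auto.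
      replace (q / (g / f)) with (q * f / g) by (field; auto). assumption.
    - replace (f / s * (f / s)) with (f * f / a) by (unfold a; field; auto). apply theta_nz; auto.
      replace (q / (f * f / a)) with (q * a / (f * f)) by (field; auto). assumption. }
  assert (Th2 : theta_pair q (f / s) (g / s) <> 0).
  { apply theta_pair_nz; auto.
    - replace (f / s * (g / s)) with (f * g / a) by (unfold a; field; auto).
      apply theta_nz; auto.
      replace (q / (f * g / a)) with (q * a / (f * g)) by (field; auto). assumption.
    - replace (f / s / (g / s)) with (f / g) by (field; auto). apply theta_nz; auto.
      replace (q / (f / g)) with (q * g / f) by (field; auto). assumption.
    - replace (g / s * (g / s)) with (g * g / a) by (unfold a; field; auto). apply theta_nz; auto.
      replace (q / (g * g / a)) with (q * a / (g * g)) by (field; auto). assumption. }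
  set (K := - / s * (1 - a) * wprod q ss s) in *.
  assert (HK : K <> 0).
  { assert (W : wprod q ss s <> 0).
    { assert (Q1 : forall t : C, t <> 0 -> nonzero_factors q (q * a / t) -> nonzero_factors q (q / t) ->
        qpoch_inf (q * (s / t) * s) q * qpoch_inf (q * (s / t) * / s) q <> 0).
      { intros t Ht H1 H2. apply Cmult_neq_0; apply qinf_nz; auto.
        - replace (q * (s / t) * s) with (q * a / t) by (unfold a; field; auto). auto.
        - replace (q * (s / t) * / s) with (q / t) by (field; auto). auto. }
      unfold ss, wprod, wsum_params. cbn [fold_right].
      repeat (apply Cmult_neq_0; [apply Q1; assumption|]). exact C1_nz. }
    unfold K. nonzero. }
  assert (EW : wsum q ss s = K * (T q a b c d e f g sl + T q a b c d e g f sl')).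
  { set (D := theta_pair q (g / s) (f / s) * theta_pair q (f / s) (g / s)) in *.
    assert (HD : D <> 0) by (unfold D; now apply Cmult_neq_0).
    assert (E4 : wsum q ss s * D = K * (T q a b c d e f g sl + T q a b c d e g f sl') * D).
    { rewrite E3, !Cmult_assoc, B1, B2. unfold D. ring. }
    transitivity (wsum q ss s * D / D); [field; auto|]. rewrite E4. field. auto. }
  pose proof (wsum_correct q ss s Hq Hs eq_refl Hss1) as HW.
  apply (has_sum_scal (/ K)) in HW. rewrite EW in HW.
  replace (/ K * (K * (T q a b c d e f g sl + T q a b c d e g f sl')))
    with (T q a b c d e f g sl + T q a b c d e g f sl') in HW by (field; auto).
  revert HW. apply has_sum_ext. intros k. unfold ss.
  rewrite (wp_term_psi q s b c d e f g k) by auto. fold a. fold ss. fold K. field. auto.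
Qed.

(** * Removing the genericity conditions *)

Lemma nonzero_factors_neg_inv (q x : C) : q <> 0 -> x <> 0 ->
  nonzero_factors_neg q x -> nonzero_factors q (q / x).
Proof.
  intros Hq Hx H i E. apply (H (- Z.of_nat (S i))%Z); [lia|].
  rewrite Czpow_opp, Czpow_nat. pose proof (Cpow_nz q i Hq).
  assert (E' : x = q * q ^ i).
  { transitivity (x * (1 - (1 - q / x * q ^ i))); [rewrite E; ring|]. field. auto. }
  rewrite E', Cpow_S. field. auto.
Qed.

(** The factors by which [f] and [g] are moved off the exceptional values. *)
Definition nudge (n : nat) : C := RtoC (1 + / (INR n + 1)).

Lemma nudge_gt_1 n : (1 < Cmod (nudge n))%R.
Proof.
  unfold nudge. rewrite Cmod_R. pose proof (pos_INR n).
  assert (0 < / (INR n + 1))%R by (apply Rinv_0_lt_compat; lra).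
  rewrite Rabs_pos_eq; lra.
Qed.

Lemma nudge_Clim : Clim eventually nudge 1.
Proof.
  intros eps Heps.
  destruct (archimed_cor1 eps Heps) as [N [HN HN0]]. exists N. intros n Hn.
  unfold nudge. replace (RtoC (1 + / (INR n + 1)) - 1) with (RtoC (/ (INR n + 1))).
  2:{ rewrite RtoC_plus. ring. }
  rewrite Cmod_R. pose proof (pos_INR n).
  rewrite Rabs_pos_eq by (apply Rlt_le, Rinv_0_lt_compat; lra).
  eapply Rle_lt_trans; [|exact HN]. apply Rinv_le_contravar.
  - now apply lt_0_INR.
  - apply le_INR in Hn. lra.
Qed.

Lemma nudge_nz n : nudge n <> 0.
Proof. apply Cmod_gt_0. pose proof (nudge_gt_1 n). lra. Qed.

Lemma nudged_nonzero_factors (q l : C) (h : nat -> C) (w : nat -> C) : (0 < Cmod q < 1)%R ->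
  l <> 0 -> Clim eventually w 1 -> (forall n, Cmod (w n) <> 1%R) -> (forall n, h n = l * w n) ->
  eventually (fun n => nonzero_factors q (h n)).
Proof.
  intros Hq Hl Hw Hw1 Hh.
  apply (nonzero_factors_generic eventually _ q h l Hq).
  - apply (Clim_ext eventually _ (fun n => l * w n)); [intros n; now rewrite Hh|].
    pose proof (Clim_scal eventually _ w l 1 Hw) as K. now rewrite Cmult_1_r in K.
  - apply filter_forall. intros n E. rewrite Hh, Cmod_mult in E. apply (Hw1 n).
    apply Cmod_gt_0 in Hl. apply Rmult_eq_reg_l with (Cmod l); [|lra]. lra.
Qed.

Lemma nudge_sq_ne n : Cmod (nudge n * nudge n) <> 1%R.
Proof. rewrite Cmod_mult. pose proof (nudge_gt_1 n). nra. Qed.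

(** Multiplying [f] and [g] by the same factor [t > 1] changes the modulus of each of these
    quantities, by [t], [t^2] or [t^(-2)]. *)
Lemma generic_nudged (q a b c f g : C) : (0 < Cmod q < 1)%R ->
  a <> 0 -> b <> 0 -> c <> 0 -> f <> 0 -> g <> 0 ->
  eventually (fun n => List.Forall (nonzero_factors q)
    (generic_params q a b c (f * nudge n) (g * nudge n))).
Proof.
  intros Hq Ha Hb Hc Hf Hg. pose proof (Cmod_q_nz q Hq) as Hq0.
  pose proof nudge_Clim as Hn. pose proof nudge_nz as Hnz.
  assert (Hn2 : Clim eventually (fun n => nudge n * nudge n) 1).
  { replace (RtoC 1) with (1 * 1) by ring. apply Clim_mult; auto. apply eventually_filter. }
  assert (Hi2 : Clim eventually (fun n => / (nudge n * nudge n)) 1).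
  { replace (RtoC 1) with (/ 1) by field. apply Clim_inv; auto; [apply eventually_filter|exact C1_nz]. }
  assert (Hi2' : forall n, Cmod (/ (nudge n * nudge n)) <> 1%R).
  { intros n. rewrite Cmod_inv by (apply Cmult_neq_0; auto). pose proof (nudge_sq_ne n) as H.
    intros E. apply H. rewrite <- (Rinv_inv (Cmod _)), E. apply Rinv_1. }
  assert (H1 : forall n, Cmod (nudge n) <> 1%R) by (intros n; pose proof (nudge_gt_1 n); lra).
  pose proof (nudged_nonzero_factors q (f * f / a) (fun n => f * nudge n * (f * nudge n) / a) _ Hq
    ltac:(nonzero) Hn2 nudge_sq_ne ltac:(intros n; cbv beta; field; auto)) as E1.
  pose proof (nudged_nonzero_factors q (q * a / (f * f)) (fun n => q * a / (f * nudge n * (f * nudge n))) _ Hq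
    ltac:(nonzero) Hi2 Hi2' ltac:(intros n; cbv beta; field; auto)) as E2.
  pose proof (nudged_nonzero_factors q (q * a / (f * g)) (fun n => q * a / (f * nudge n * (g * nudge n))) _ Hq
    ltac:(nonzero) Hi2 Hi2' ltac:(intros n; cbv beta; field; auto)) as E3.
  pose proof (nudged_nonzero_factors q (q * f / b) (fun n => q * (f * nudge n) / b) _ Hq
    ltac:(nonzero) Hn H1 ltac:(intros n; cbv beta; field; auto)) as E4.
  pose proof (nudged_nonzero_factors q (q * f / c) (fun n => q * (f * nudge n) / c) _ Hq
    ltac:(nonzero) Hn H1 ltac:(intros n; cbv beta; field; auto)) as E5.
  generalize (filter_and _ _ E1 (filter_and _ _ E2 (filter_and _ _ E3 (filter_and _ _ E4 E5)))).
  apply filter_imp. intros n [A1 [A2 [A3 [A4 A5]]]]. unfold generic_params.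
  repeat (constructor; auto).
Qed.

Lemma T_Clim (q : C) (N D PN PD : nat -> list C) (num den pn pd : list C) (z : C) :
  (0 < Cmod q < 1)%R -> Clim_list eventually N num -> Clim_list eventually D den ->
  Clim_list eventually PN pn -> Clim_list eventually PD pd -> (Cmod z < 1)%R ->
  List.Forall (nonzero_factors q) den -> List.Forall (nonzero_factors q) (q :: pd) ->
  has_sum (phi_term pn pd q z) (phi pn pd q z) /\
  Clim eventually (fun n => qpochs_inf (N n) q / qpochs_inf (D n) q * phi (PN n) (PD n) q z)
    (qpochs_inf num q / qpochs_inf den q * phi pn pd q z).
Proof.
  intros Hq HN HD HPN HPD Hz Hden Hpd.
  assert (HPD' : Clim_list eventually (fun n => q :: PD n) (q :: pd)).
  { apply (Clim_cons eventually (fun _ => q)); auto. apply Clim_const, eventually_filter. }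
  destruct (qratio_sum_Clim eventually _ q PN (fun n => q :: PD n) pn (q :: pd) (fun _ => z) z Hq HPN HPD'
    (Clim_const eventually _ z) Hz Hpd) as [s [Hs [HL HE]]].
  pose proof (phi_has_sum _ _ _ _ _ Hs) as Ephi. split.
  - rewrite Ephi. revert Hs. apply has_sum_ext. intros n. now rewrite phi_term_qratio.
  - assert (G : forall L l, Clim_list eventually L l ->
      Clim eventually (fun n => qpochs_inf (L n) q) (qpochs_inf l q)).
    { intros L l HLl. apply (lprod_Clim eventually _ (fun x : C => qpoch_inf x q) L l); auto.
      intros h x Hh. now apply qinf_continuous; try apply eventually_filter. }
    unfold Cdiv. apply Clim_mult; [apply eventually_filter| |].
    + apply Clim_mult; [apply eventually_filter|now apply G|].
      apply Clim_inv; [apply eventually_filter| |now apply G].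
      clear - Hden Hq. induction Hden as [|x l Hx Hl IH]; simpl; [exact C1_nz|].
      apply Cmult_neq_0; auto. now apply qinf_nz.
    + rewrite Ephi. intros eps Heps.
      generalize (filter_and _ _ HE (HL eps Heps)). apply filter_imp. intros n [A1 A2].
      now rewrite (phi_has_sum _ _ _ _ _ A1).
Qed.

Ltac clim Hf Hg :=
  unfold Cdiv;
  repeat first [exact Hf | exact Hg
    | apply (Clim_const eventually _)
    | apply (Clim_mult eventually _)
    | apply (Clim_inv eventually _); [nonzero|]
    | apply (Clim_opp eventually _)
    | apply (Clim_pow eventually _)].

Ltac clim_list Hf Hg :=
  repeat (apply Clim_cons; [clim Hf Hg|]); apply Clim_nil.

Theorem lemma1 (q a b c d e f g sa sl sl' : C)
  (hq : (0 < Cmod q < 1)%R)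
  (ha : a <> 0) (hb : b <> 0) (hc : c <> 0) (hd : d <> 0)
  (he : e <> 0) (hf : f <> 0) (hg : g <> 0)
  (hsa : sa ^ 2 = a)
  (hsl : sl ^ 2 = lambda q a d e f g)
  (hsl' : sl' ^ 2 = lambda q a d e g f)
  (hpsi : psi_well_defined
            (psi_num q b c d e f g sa) (psi_den q a b c d e f g sa) q)
  (hT : List.Forall (nonzero_factors q) (T_den q a b c d e f g))
  (hT' : List.Forall (nonzero_factors q) (T_den q a b c d e g f))
  (hphi : phi_well_defined (phi_den q a b c d e f g sl) q)
  (hphi' : phi_well_defined (phi_den q a b c d e g f sl') q)
  (hmax : (Rmax (Cmod (q ^ 2 * a ^ 3 / (b * c * d * e * f * g)))
                (Cmod (q * a / (b * c))) < 1)%R) :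
  ex_series (phi_term (phi_num q a b c d e f g sl) (phi_den q a b c d e f g sl)
               q (phi_arg q a b c)) /\
  ex_series (phi_term (phi_num q a b c d e g f sl') (phi_den q a b c d e g f sl')
               q (phi_arg q a b c)) /\
  is_psi (psi_num q b c d e f g sa) (psi_den q a b c d e f g sa)
    q (psi_arg q a b c d e f g)
    (T q a b c d e f g sl + T q a b c d e g f sl').
Proof.
  pose proof (Cmod_q_nz q hq) as hq0.
  assert (hs : sa <> 0).
  { intros E. apply ha. rewrite <- hsa, E. simpl. ring. }
  destruct hpsi as [hpd hpn].
  assert (hz1 : (Cmod (psi_arg q a b c d e f g) < 1)%R) by (eapply Rle_lt_trans; [apply Rmax_l|exact hmax]).
  assert (hz2 : (Cmod (phi_arg q a b c) < 1)%R) by (eapply Rle_lt_trans; [apply Rmax_r|exact hmax]).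
  clear hmax. unfold phi_well_defined in hphi, hphi'.
  assert (hpn' : List.Forall (nonzero_factors q) (map (fun x => q / x) (psi_num q b c d e f g sa))).
  { unfold psi_num in *. cbn [map].
    repeat match goal with H : List.Forall (nonzero_factors_neg q) (_ :: _) |- _ =>
      let H1 := fresh "NT" in pose proof (Forall_inv H) as H1; apply Forall_inv_tail in H;
      apply nonzero_factors_neg_inv in H1; [|auto|nonzero] end.
    repeat (constructor; auto). }
  clear hpn.
  (* The common factor keeps [f / g], hence both values of [lambda], fixed: the chosen
     square roots [sl] and [sl'] remain valid along the whole sequence. *)
  set (fn := fun n => f * nudge n). set (gn := fun n => g * nudge n).
  assert (Hf : Clim eventually fn f).
  { replace f with (f * 1) by ring. apply Clim_scal; [apply eventually_filter|apply nudge_Clim]. }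
  assert (Hg : Clim eventually gn g).
  { replace g with (g * 1) by ring. apply Clim_scal; [apply eventually_filter|apply nudge_Clim]. }
  assert (hfn : forall n, fn n <> 0) by (intros n; apply Cmult_neq_0; auto using nudge_nz).
  assert (hgn : forall n, gn n <> 0) by (intros n; apply Cmult_neq_0; auto using nudge_nz).
  assert (L1 : Clim_list eventually (fun n => psi_den q a b c d e (fn n) (gn n) sa) (psi_den q a b c d e f g sa)).
  { unfold psi_den. clim_list Hf Hg. }
  assert (L2 : Clim_list eventually (fun n => psi_num q b c d e (fn n) (gn n) sa) (psi_num q b c d e f g sa)).
  { unfold psi_num. clim_list Hf Hg. }
  assert (L3 : Clim_list eventually (fun n => map (fun x => q / x) (psi_num q b c d e (fn n) (gn n) sa))
      (map (fun x => q / x) (psi_num q b c d e f g sa))).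
  { unfold psi_num. cbn [map]. clim_list Hf Hg. }
  assert (L4 : Clim_list eventually (fun n => map (fun x => q / x) (psi_den q a b c d e (fn n) (gn n) sa))
      (map (fun x => q / x) (psi_den q a b c d e f g sa))).
  { unfold psi_den. cbn [map]. clim_list Hf Hg. }
  assert (L5 : Clim_list eventually (fun n => T_num q a b c d e (fn n) (gn n)) (T_num q a b c d e f g)).
  { unfold T_num. clim_list Hf Hg. }
  assert (L6 : Clim_list eventually (fun n => T_den q a b c d e (fn n) (gn n)) (T_den q a b c d e f g)).
  { unfold T_den. clim_list Hf Hg. }
  assert (L5' : Clim_list eventually (fun n => T_num q a b c d e (gn n) (fn n)) (T_num q a b c d e g f)).
  { unfold T_num. clim_list Hf Hg. }
  assert (L6' : Clim_list eventually (fun n => T_den q a b c d e (gn n) (fn n)) (T_den q a b c d e g f)).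
  { unfold T_den. clim_list Hf Hg. }
  assert (L7 : Clim_list eventually (fun n => phi_num q a b c d e (fn n) (gn n) sl) (phi_num q a b c d e f g sl)).
  { unfold phi_num, lambda. clim_list Hf Hg. }
  assert (L8 : Clim_list eventually (fun n => phi_den q a b c d e (fn n) (gn n) sl) (phi_den q a b c d e f g sl)).
  { unfold phi_den. clim_list Hf Hg. }
  assert (L7' : Clim_list eventually (fun n => phi_num q a b c d e (gn n) (fn n) sl') (phi_num q a b c d e g f sl')).
  { unfold phi_num, lambda. clim_list Hf Hg. }
  assert (L8' : Clim_list eventually (fun n => phi_den q a b c d e (gn n) (fn n) sl') (phi_den q a b c d e g f sl')).
  { unfold phi_den. clim_list Hf Hg. }
  assert (Lz : Clim eventually (fun n => psi_arg q a b c d e (fn n) (gn n)) (psi_arg q a b c d e f g)).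
  { unfold psi_arg. clim Hf Hg. }
  destruct (T_Clim q _ _ _ _ _ _ _ _ (phi_arg q a b c) hq L5 L6 L7 L8 hz2 hT hphi) as [S1 LT].
  destruct (T_Clim q _ _ _ _ _ _ _ _ (phi_arg q a b c) hq L5' L6' L7' L8' hz2 hT' hphi') as [S2 LT'].
  destruct (qratio_sum_Clim eventually _ q _ _ _ _ _ _ hq L2 L1 Lz hz1 hpd) as [P [HP [LP EP]]].
  destruct (qratio_sum_Clim eventually _ q _ _ _ _ _ _ hq L4 L3 Lz hz1 hpn') as [N [HN [LN EN]]].
  split; [|split].
  { eexists. apply has_sum_series, S1. }
  { eexists. apply has_sum_series, S2. }
  assert (split_psi : forall f' g' P' N' : C, f' <> 0 -> g' <> 0 ->
    has_sum (qratio (psi_num q b c d e f' g' sa) (psi_den q a b c d e f' g' sa) q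
      (psi_arg q a b c d e f' g')) P' ->
    has_sum (qratio (map (fun x => q / x) (psi_den q a b c d e f' g' sa))
      (map (fun x => q / x) (psi_num q b c d e f' g' sa)) q (psi_arg q a b c d e f' g')) N' ->
    let u := psi_term (psi_num q b c d e f' g' sa) (psi_den q a b c d e f' g' sa) q
               (psi_arg q a b c d e f' g') in
    has_sum (fun n : nat => u (Z.of_nat n)) P' /\
    has_sum (fun n : nat => u (- Z.of_nat (S n))%Z) (N' - 1)).
  { intros f' g' P' N' hf' hg' HP' HN' u. split.
    - revert HP'. apply has_sum_ext. intros n. unfold u. now rewrite psi_term_nat.
    - apply has_sum_S in HN'.
      match type of HN' with has_sum _ (_ - ?t) => replace t with (RtoC 1) in HN' end.
      + revert HN'. apply has_sum_ext. intros n. unfold u. rewrite <- hsa.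
        now rewrite psi_term_opp.
      + unfold qratio, psi_num, psi_den, qp. simpl. field. }
  destruct (split_psi f g P N hf hg HP HN) as [HPp HNn].
  (* The reversed series [N] starts at [k = 0], where its term is [1]. *)
  exists P, (N - 1). split; [|split]; [now apply has_sum_series|now apply has_sum_series|].
  symmetry. apply (Clim_unique eventually _ _ _ _
    (Clim_plus eventually _ _ _ _ _ LP (Clim_plus eventually _ _ _ _ _ LN (Clim_const eventually _ (- (1)))))).
  pose proof (Clim_plus eventually _ _ _ _ _ LT LT') as LTT.
  intros eps Heps.
  pose proof (generic_nudged q a b c f g hq ha hb hc hf hg) as G1.
  pose proof (generic_nudged q a b c g f hq ha hb hc hg hf) as G2.
  assert (O : forall L l, Clim_list eventually L l -> List.Forall (nonzero_factors q) l ->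
     eventually (fun n => List.Forall (nonzero_factors q) (L n))).
  { intros L l HL Hl. now apply (nonzero_factors_list_open eventually _ q L l). }
  assert (Oz : eventually (fun n => (Cmod (psi_arg q a b c d e (fn n) (gn n)) < 1)%R)).
  { assert (Hd0 : (0 < 1 - Cmod (psi_arg q a b c d e f g))%R) by lra.
    generalize (Lz _ Hd0). apply filter_imp. intros n Hn.
    replace (psi_arg q a b c d e (fn n) (gn n)) with
      (psi_arg q a b c d e f g + (psi_arg q a b c d e (fn n) (gn n) - psi_arg q a b c d e f g)) by ring.
    eapply Rle_lt_trans; [apply Cmod_triangle|]. lra. }
  generalize (filter_and _ _ (LTT eps Heps) (filter_and _ _ (filter_and _ _ G1 G2)
    (filter_and _ _ Oz (filter_and _ _ (filter_and _ _ EP EN)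
    (filter_and _ _ (filter_and _ _ (O _ _ L1 hpd) (O _ _ L3 hpn'))
    (filter_and _ _ (filter_and _ _ (O _ _ L6 hT) (O _ _ L6' hT'))
       (filter_and _ _ (O _ _ L8 (Forall_inv_tail hphi)) (O _ _ L8' (Forall_inv_tail hphi'))))))))).
  apply filter_imp. intros n [A1 [[A2 A3] [A4 [[A5 A6] [[A7 A8] [[A9 A10] [A11 A12]]]]]]].
  assert (El : lambda q a d e (fn n) (gn n) = lambda q a d e f g).
  { unfold lambda, fn, gn. pose proof (nudge_nz n). field. auto. }
  assert (El' : lambda q a d e (gn n) (fn n) = lambda q a d e g f).
  { unfold lambda, fn, gn. pose proof (nudge_nz n). field. auto. }
  destruct (split_psi (fn n) (gn n) _ _ (hfn n) (hgn n) A5 A6) as [B1 B2].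
  pose proof (bilateral_has_sum _ _ _ B1 B2) as B3.
  assert (B4 := psi_generic q sa b c d e (fn n) (gn n) sl sl' hq hs hb hc hd he (hfn n) (hgn n)).
  cbv zeta in B4. rewrite hsa in B4.
  specialize (B4 ltac:(congruence) ltac:(congruence) A7 A8 A9 A10 A11 A12 A2 A3 A4 hz2).
  pose proof (has_sum_unique _ _ _ B3 B4) as B5.
  unfold Cminus at 1 in B5. cbv beta in B5 |- *. rewrite B5. exact A1.
Qed.
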